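(* Let $G$ be a discrete Cayley graph of polynomial growth with vertex set $V$, let $\mathcal X=\{X_x\}_{x\in V}$ be a stationary random field on $G$ with values in a countable set which is exponentially $\alpha$-mixing, i.e. $\limsup_{s\to\infty}s^{-b}\log\alpha(s)<0$ for some $b\in(0,\infty)$, and let $\xi$ be an exponentially quasi-local score function on $\mathcal X$ such that $(\xi,\mathcal X)$ satisfies the $p$-moment condition for all $p\ge1$. Let $H_n^\xi=\sum_{x\in W_n}\xi(x,\mathcal X_n)$ and assume that $\operatorname{Var}(H_n^\xi)=\Omega(w_n^\nu)$ for some $\nu>0$. Then as $n\to\infty$, $$\frac{H_n^\xi-\mathbb E(H_n^\xi)}{\sqrt{\operatorname{Var}(H_n^\xi)}}\stackrel{d}{\Rightarrow}N(0,1).$$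
   Context: **Cayley graphs.** $(V,+)$ is a countably infinite group (not necessarily commutative) with identity $O$, generated by a finite symmetric set $S_0$ ($h\in S_0\iff -h\in S_0$) with $O\notin S_0$. The discrete Cayley graph $G=(V,E)$ has $(g_1,g_2)\in E$ iff $-g_1+g_2\in S_0$. $d$ is the graph distance, $|x|=d(O,x)$; $d(A,B)=\min_{x\in A,y\in B}d(x,y)$. $W_r=\{x:|x|\le r\}$, $W_\infty=V$, $w_n=|W_n|$. $G$ has polynomial growth if $|W_n|=O(n^{d_2})$ for some $d_2>0$. $a_n=\Omega(b_n)$ means there is $c>0$ with $a_n\ge c\,b_n$ for all large $n$. **Random fields.** $\mathcal S$ is a countable set, $\mathcal X=\{X_x\}_{x\in V}$ a random element of $\mathcal S^V$. $\mathcal X$ is stationary if $\{X_{y+x}\}_{x\in V}\stackrel d=\{X_x\}_{x\in V}$ for all $y\in V$. For $A\subset V$, $\omega\cap A$ is the restriction of a configuration $\omega$ to $A$; $\mathcal X_n=\mathcal X\cap W_n$, $\mathcal X_\infty=\mathcal X$. For $A,B\subset V$ let $\alpha(A,B)=\sup|\mathbb P(E\cap F)-\mathbb P(E)\mathbb P(F)|$ over $E\in\sigma(X_x,x\in A)$, $F\in\sigma(X_x,x\in B)$, and $\alpha(s)=\sup\{\alpha(A,B):d(A,B)\ge s\}$. **Score functions.** A score function $\xi$ assigns a real number $\xi(x,\omega)$, measurably in $\omega$, to $x\in V$ and to each configuration $\omega$, where configurations may be indexed by all of $V$ or by a subset $A\subset V$ (elements of $\mathcal S^A$). It is translation-invariant: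 $\xi(y+x,\vartheta_y\omega)=\xi(x,\omega)$, where $\vartheta_y\omega$ is indexed by $y+A$ with $(\vartheta_y\omega)_x=\omega_{-y+x}$. The radius of stabilisation is $R(O,\omega)=\inf\{r>0,\ r\in\mathbb N:\xi(O,\omega)=\xi(O,\omega')\text{ for all configurations }\omega'\text{ with }\omega'\cap W_r=\omega\cap W_r\}$ and $R(x,\omega)=R(O,\vartheta_{-x}\omega)$. $\xi$ is exponentially quasi-local on $\mathcal X$ if there are $A>0$ and a function $\varphi(t)\downarrow0$ with $\sup_{1\le n\le\infty}\sup_{x\in W_n}\mathbb P(R(x,\mathcal X_n)\ge t)\le A\varphi(t)$ for all $t$ and $\limsup_{t\to\infty}\log\varphi(t)/t^c<0$ for some $c\in(0,\infty)$. $p$-moment condition: $\sup_{1\le n\le\infty}\sup_{x\in W_n}\mathbb E(\max\{|\xi(x,\mathcal X_n)|,1\}^p)<\infty$. *)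

(* Defs.v *)
From HB Require Import structures.
From mathcomp Require Import all_boot all_order all_algebra finmap.
From mathcomp Require Import all_classical all_reals all_analysis.

Set Implicit Arguments.
Unset Strict Implicit.
Unset Printing Implicit Defensive.

Import Order.TTheory GRing.Theory Num.Theory.
Import numFieldNormedType.Exports.

Local Open Scope classical_set_scope.
Local Open Scope ring_scope.

(* The group V is written multiplicatively: 1%g is the identity O, x^-1 is -x
   and (x * y)%g is x + y. *)

Definition generates (V : groupType) (S0 : {fset V}) : Prop :=
  forall H : set V,
    H 1%g -> (forall x y, H x -> H y -> H (x * y)%g) ->
    (forall x, H x -> H x^-1%g) -> (forall x, x \in S0 -> H x) ->
    H = setT.

Definition cayley_generators (V : groupType) (S0 : {fset V}) : Prop :=
  [/\ countable [set: V], infinite_set [set: V],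
      generates S0, (forall h, (h \in S0) = (h^-1%g \in S0))
    & 1%g \notin S0].

Definition cayley_edge (V : groupType) (S0 : {fset V}) : rel V :=
  fun g1 g2 => (g1^-1 * g2)%g \in S0.

(* The distances take values in \bar R, so that the distance between vertices
   not joined by any path and the distance to an empty set are +oo. *)
Definition dist (R : realType) (V : groupType) (S0 : {fset V}) (x y : V) :
    \bar R :=
  ereal_inf [set (size p)%:R%:E
    | p in [set p : seq V | path (cayley_edge S0) x p /\ last x p = y]].

Definition dist_set (R : realType) (V : groupType) (S0 : {fset V})
    (A B : set V) : \bar R :=
  ereal_inf [set dist R S0 x y | x in A & y in B].

(* W_r for r in [0, +oo]; the ball of radius +oo is the whole of V. *)
Definition word_ball (R : realType) (V : groupType) (S0 : {fset V}) (r : \bar R) :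
    set V :=
  [set x | (dist R S0 1%g x <= r)%E].

Definition word_ball_card (R : realType) (V : groupType) (S0 : {fset V}) (n : nat) : nat :=
  #|` fset_set (word_ball S0 (n%:R%:E : \bar R))|.

Definition polynomial_growth (R : realType) (V : groupType) (S0 : {fset V}) :
    Prop :=
  exists2 d2 : R, 0 < d2 &
  exists C : R, \forall n \near \oo, (word_ball_card R S0 n)%:R <= C * n%:R `^ d2.

(* sigma(Y_x, x \in A), each Y_x taking its values in Z with the discrete
   sigma-algebra. *)
Definition sigma_of (V T Z : Type) (Y : V -> T -> Z) (A : set V) :
    set (set T) :=
  <<s [set E | exists2 x, A x & exists D : set Z, E = Y x @^-1` D] >>.

Definition product_sigma (V Z : Type) : set (set (V -> Z)) :=
  sigma_of (fun x (c : V -> Z) => c x) setT.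

Definition random_field d (T : measurableType d) (V : Type) (S : countType)
    (X : V -> T -> S) : Prop :=
  forall x (D : set S), measurable (X x @^-1` D).

Definition stationary d (T : measurableType d) (R : realType)
    (P : probability T R) (V : groupType) (S : countType) (X : V -> T -> S) :
    Prop :=
  forall (y : V) (B : set (V -> S)), product_sigma B ->
    P [set t | B (fun x => X (y * x)%g t)] = P [set t | B (fun x => X x t)].

Definition alpha_sets d (T : measurableType d) (R : realType)
    (P : probability T R) (V : groupType) (S : countType) (X : V -> T -> S)
    (A B : set V) : \bar R :=
  ereal_sup [set `| P (E `&` F) - P E * P F |%E
    | E in sigma_of X A & F in sigma_of X B].

Definition alpha d (T : measurableType d) (R : realType)
    (P : probability T R) (V : groupType) (S0 : {fset V}) (S : countType)
    (X : V -> T -> S) (s : R) : \bar R :=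
  ereal_sup [set alpha_sets P X AB.1 AB.2
    | AB in [set AB : set V * set V | (s%:E <= dist_set R S0 AB.1 AB.2)%E]].

(* Here lne 0 = -oo, so vanishing mixing coefficients are allowed. *)
Definition exponentially_alpha_mixing d (T : measurableType d)
    (R : realType) (P : probability T R) (V : groupType) (S0 : {fset V})
    (S : countType) (X : V -> T -> S) : Prop :=
  exists2 b : R, 0 < b &
  (limf_esup (fun s : R => (s `^ (- b))%:E * lne (alpha P S0 X s))
     (pinfty_nbhs R) < 0)%E.

(* A configuration indexed by a subset A of V, i.e. an element of S^A, is
   represented by the function V -> option S that equals None exactly
   outside A. *)
Definition config (V : Type) (S : Type) : Type := V -> option S.

Definition index_set (V S : Type) (c : config V S) : set V :=
  [set x | c x <> None].

Definition restrict_config (V S : Type) (c : config V S) (A : set V) :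
    config V S :=
  fun x => if x \in A then c x else None.

Definition translate_config (V : groupType) (S : Type) (y : V) (c : config V S) :
    config V S :=
  fun x => c (y^-1 * x)%g.

(* The sets [set c | index_set c = A] `&` U with U in the product
   sigma-algebra of V -> option S form the product sigma-algebra of S^A. *)
Definition score_function (R : realType) (V : groupType) (S : countType)
    (xi : V -> config V S -> R) : Prop :=
  (forall x (A : set V) (B : set R), measurable B ->
     exists2 U, product_sigma U &
     [set c | index_set c = A] `&` xi x @^-1` B =
     [set c | index_set c = A] `&` U) /\
  (forall x y c, xi (y * x)%g (translate_config y c) = xi x c).

Definition stab_radius_at_origin (R : realType) (V : groupType)
    (S0 : {fset V}) (S : countType) (xi : V -> config V S -> R)
    (c : config V S) : \bar R :=
  ereal_inf [set r%:R%:E | r in [set r : nat | (0 < r)%N /\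
    forall c' : config V S,
      restrict_config c' (word_ball S0 (r%:R%:E : \bar R)) =
      restrict_config c (word_ball S0 (r%:R%:E : \bar R)) ->
      xi 1%g c = xi 1%g c']].

Definition stab_radius (R : realType) (V : groupType) (S0 : {fset V})
    (S : countType) (xi : V -> config V S -> R) (x : V) (c : config V S) :
    \bar R :=
  stab_radius_at_origin S0 xi (translate_config x^-1%g c).

Definition field_in_ball (T : Type) (R : realType) (V : groupType)
    (S0 : {fset V}) (S : countType) (X : V -> T -> S) (n : \bar R) (t : T) :
    config V S :=
  restrict_config (fun x => Some (X x t)) (word_ball S0 n).

(* The pairs (n, x) over which both suprema below are taken: n >= 1 possibly
   +oo, and x in W_n. *)
Definition scales (R : realType) (V : groupType) (S0 : {fset V}) :
    set (\bar R * V) :=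
  [set nx | ((exists2 n : nat, (1 <= n)%N & nx.1 = n%:R%:E) \/ nx.1 = +oo%E) /\
            word_ball S0 nx.1 nx.2].

Definition exponentially_quasi_local d (T : measurableType d)
    (R : realType) (P : probability T R) (V : groupType) (S0 : {fset V})
    (S : countType) (X : V -> T -> S) (xi : V -> config V S -> R) : Prop :=
  exists (a : R) (phi : R -> R),
  [/\ 0 < a,
      {homo phi : s t / s <= t >-> t <= s},
      phi t @[t --> +oo] --> (0 : R),
      forall t : R,
        (ereal_sup [set P [set om | (t%:E <=
             stab_radius S0 xi nx.2 (field_in_ball S0 X nx.1 om))%E]
           | nx in @scales R V S0] <= (a * phi t)%:E)%E
    & exists2 c : R, 0 < c &
      (limf_esup (fun t : R => lne (phi t)%:E * ((t `^ c)^-1)%:E)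
         (pinfty_nbhs R) < 0)%E].

Definition moment_condition d (T : measurableType d) (R : realType)
    (P : probability T R) (V : groupType) (S0 : {fset V}) (S : countType)
    (X : V -> T -> S) (xi : V -> config V S -> R) (p : R) : Prop :=
  (ereal_sup
     [set 'E_P[fun om =>
             (Num.max `|xi nx.2 (field_in_ball S0 X nx.1 om)| 1 `^ p)%R]
       | nx in @scales R V S0] < +oo)%E.

Definition total_score (T : Type) (R : realType) (V : groupType)
    (S0 : {fset V}) (S : countType) (X : V -> T -> S)
    (xi : V -> config V S -> R) (n : nat) (om : T) : R :=
  \sum_(x \in word_ball S0 (n%:R%:E : \bar R))
    xi x (field_in_ball S0 X (n%:R%:E : \bar R) om).

Definition cvg_in_distribution d (T : measurableType d) (R : realType)
    (P : probability T R) (Y : nat -> T -> R) (mu : set R -> \bar R) : Prop :=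
  forall f : R -> R, continuous f -> (exists M : R, forall x, `|f x| <= M) ->
    ('E_P[f \o Y n] @[n --> \oo] --> \int[mu]_x (f x)%:E)%E.

(* Main.v *)
Require Import Defs.
From HB Require Import structures.
From mathcomp Require Import all_boot all_order all_algebra finmap.
From mathcomp Require Import all_classical all_reals all_analysis.
From mathcomp Require Import measurable_realfun ring lra zify.

(* Method of moments.  Truncating the scores at level b_n and replacing them by 0
   when their stabilisation radius reaches s_n, both slowly growing powers of
   w_n, changes H_n by an L^2-error of order w_n^(-1/2), and makes each score a
   function of the field in a ball of radius s_n.  Joint cumulants of bounded
   local scores are small as soon as the points split into two groups at distance
   > 3 s_n, by mixing; the remaining tuples are few, by polynomial growth.  So the
   cumulants of order >= K ~ 4 / nu of the normalised sum tend to 0; nothing is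
   known about the lower ones since nu is arbitrary.  By compactness, a limit point
   of the moment sequences, rescaled if necessary, has only finitely many nonzero
   cumulants, and positivity of the moment functional then forces, as in
   Marcinkiewicz' theorem, cumulants of order >= 3 to vanish: the moments
   converge to the Gaussian ones.  Taylor polynomials of the cosine and the
   density of trigonometric polynomials turn this into weak convergence. *)

Set Implicit Arguments.
Unset Strict Implicit.
Unset Printing Implicit Defensive.

Import Order.TTheory GRing.Theory Num.Theory.
Import numFieldNormedType.Exports.

Local Open Scope classical_set_scope.
Local Open Scope ring_scope.

(** * Joint cumulants *)

Fixpoint splits (A : Type) (l : seq A) : seq (seq A * seq A) :=
  if l is y :: l' then
    [seq (y :: ab.1, ab.2) | ab <- splits l'] ++
    [seq (ab.1, y :: ab.2) | ab <- splits l']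
  else [:: ([::], [::])].

Lemma size_splits (A : Type) (l : seq A) : size (splits l) = (2 ^ size l)%N.
Proof. by elim: l => //= y l IH; rewrite size_cat !size_map IH expnS mul2n addnn. Qed.

Lemma mem_splits (A : eqType) (l : seq A) ab : ab \in splits l ->
  (size ab.1 + size ab.2)%N = size l /\ (ab.1 ++ ab.2) =i l.
Proof.
elim: l ab => [|y l IH] ab /=; first by rewrite inE => /eqP->.
rewrite mem_cat => /orP[] /mapP[cd /IH[sz mm] ->] /=.
  by rewrite addSn sz; split=> // z; rewrite !inE mm.
rewrite addnS sz; split=> // z.
by rewrite mem_cat !inE -mm mem_cat orbCA.
Qed.

Section SplitSums.
Context {R : pzRingType}.

Lemma big_splits_cons (A : Type) (y : A) l (F : seq A * seq A -> R) P :
  \sum_(ab <- splits (y :: l) | P ab) F ab =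
  \sum_(ab <- splits l | P (y :: ab.1, ab.2)) F (y :: ab.1, ab.2) +
  \sum_(ab <- splits l | P (ab.1, y :: ab.2)) F (ab.1, y :: ab.2).
Proof. by rewrite /= big_cat !big_map. Qed.

Lemma big_splits_nil (A : Type) (l : seq A) (F : seq A * seq A -> R) :
  \sum_(ab <- splits l | nilp ab.2) F ab = F (l, [::]).
Proof.
elim: l F => [|y l IH] F; first by rewrite big_cons big_nil /= addr0.
by rewrite big_splits_cons /= big_pred0_eq addr0 (IH (fun ab => F (y :: ab.1, ab.2))).
Qed.

Lemma big_splits_filter (A : Type) (p : pred A) (l : seq A)
    (g : seq A -> seq A -> seq A -> R) :
  \sum_(ab <- splits l | all p ab.1)
     g ab.1 (seq.filter p ab.2) (seq.filter (predC p) ab.2) =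
  \sum_(ac <- splits (seq.filter p l)) g ac.1 ac.2 (seq.filter (predC p) l).
Proof.
elim: l g => [|y l IH] g; first by rewrite !big_cons !big_nil /=.
rewrite big_splits_cons /=; case: (boolP (p y)) => py /=.
  rewrite big_splits_cons /=; congr (_ + _).
    exact: (IH (fun a b c => g (y :: a) b c)).
  exact: (IH (fun a b c => g a (y :: b) c)).
rewrite big_pred0_eq add0r.
exact: (IH (fun a b c => g a b (y :: c))).
Qed.

End SplitSums.

Section ListSum.
Context {R : comPzRingType} {A : Type}.
Variable W : seq A.

Fixpoint list_sum (n : nat) (f : seq A -> R) : R :=
  if n is n'.+1 then \sum_(x <- W) list_sum n' (fun l => f (x :: l)) else f [::].

Lemma eq_list_sum n f g : f =1 g -> list_sum n f = list_sum n g.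
Proof.
elim: n f g => [|n IH] f g fg /=; first exact: fg.
by apply: eq_bigr => x _; apply: IH => l; exact: fg.
Qed.

Lemma list_sumD n f g :
  list_sum n (fun l => f l + g l) = list_sum n f + list_sum n g.
Proof.
elim: n f g => [|n IH] f g //=.
by rewrite -big_split /=; apply: eq_bigr => x _; exact: IH.
Qed.

Lemma list_sumZ n c f : list_sum n (fun l => c * f l) = c * list_sum n f.
Proof.
elim: n f => [|n IH] f //=.
by rewrite mulr_sumr; apply: eq_bigr => x _; exact: IH.
Qed.

Lemma list_sum_splits n f g :
  list_sum n (fun l => \sum_(ab <- splits l) f ab.1 * g ab.2) =
  \sum_(j < n.+1) (list_sum j f * list_sum (n - j) g) *+ 'C(n, j).
Proof.
elim: n f g => [|n IH] f g.
  by rewrite big_ord_recl big_ord0 /= big_seq1 bin0 addr0.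
transitivity (\sum_(x <- W)
   (\sum_(j < n.+1) (list_sum j (fun l => f (x :: l)) * list_sum (n - j) g) *+ 'C(n, j)
  + \sum_(j < n.+1) (list_sum j f * list_sum (n - j) (fun l => g (x :: l))) *+ 'C(n, j))).
  apply: eq_bigr => x _; rewrite -!IH -list_sumD; apply: eq_list_sum => l.
  by rewrite big_splits_cons.
rewrite big_split /= exchange_big /= [X in _ + X]exchange_big /=.
transitivity (\sum_(j < n.+1) (list_sum j.+1 f * list_sum (n - j) g) *+ 'C(n, j) +
   \sum_(j < n.+1) (list_sum j f * list_sum (n.+1 - j) g) *+ 'C(n, j)).
  congr (_ + _); apply: eq_bigr => j _.
    by rewrite sumrMnl -mulr_suml.
  by rewrite sumrMnl -mulr_sumr subSn // -ltnS.
rewrite [RHS]big_ord_recl [in RHS]/= bin0.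
under [X in _ = _ + X]eq_bigr do
  rewrite /bump /= add1n binS mulrnDr subSS.
rewrite [X in _ = _ + X]big_split /= [X in _ = _ + X]addrC [RHS]addrCA.
congr (_ + _).
rewrite big_ord_recl /= bin0; congr (_ + _).
rewrite [RHS]big_ord_recr /= bin_small // mulr0n addr0.
by apply: eq_bigr => j _; rewrite /bump /= add1n subSS.
Qed.

Lemma expr_sum_list_sum (Z : A -> R) n :
  (\sum_(x <- W) Z x) ^+ n = list_sum n (fun l => \prod_(x <- l) Z x).
Proof.
elim: n => [|n IH] /=; first by rewrite big_nil expr0.
rewrite exprS mulr_suml; apply: eq_bigr => x _.
by rewrite IH -list_sumZ; apply: eq_list_sum => l; rewrite big_cons.
Qed.

End ListSum.

Section JointCumulant.
Context {R : realFieldType} {A : eqType}.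
Variable E : seq A -> R.

Fixpoint jcum_rec (n : nat) (l : seq A) : R :=
  if n is n'.+1 then
    if l is x :: l' then
      E l - \sum_(ab <- splits l' | ~~ nilp ab.2) jcum_rec n' (x :: ab.1) * E ab.2
    else 0
  else 0.

(* Joint cumulants are defined by singling out the block of the first element
   in the moment-cumulant formula. *)
Definition joint_cumulant (l : seq A) : R := jcum_rec (size l) l.

Lemma split_size_lt (l : seq A) ab : ab \in splits l -> ~~ nilp ab.2 ->
  (size ab.1 < size l)%N.
Proof. by move=> /mem_splits[<- _]; rewrite /nilp; lia. Qed.

Lemma jcum_rec_fuel n l : (size l <= n)%N -> jcum_rec n l = joint_cumulant l.
Proof.
elim/ltn_ind: n l => -[|n] IH [|x l] //= sl.
rewrite /joint_cumulant /=; congr (_ - _); rewrite big_seq_cond [RHS]big_seq_cond.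
apply: eq_bigr => ab /andP[abl ab2]; have := split_size_lt abl ab2 => lt1.
rewrite IH //=; last exact: leq_trans lt1 sl.
by rewrite IH.
Qed.

Lemma joint_cumulantE x l : E [::] = 1 ->
  E (x :: l) = \sum_(ab <- splits l) joint_cumulant (x :: ab.1) * E ab.2.
Proof.
move=> E1; rewrite (bigID (fun ab => nilp ab.2)) /=.
rewrite (big_splits_nil l (fun ab => joint_cumulant (x :: ab.1) * E ab.2)) /= E1 mulr1.
rewrite {1}/joint_cumulant /=.
apply/eqP; rewrite -subr_eq; apply/eqP; congr (_ - _).
rewrite big_seq_cond [RHS]big_seq_cond.
apply: eq_bigr => ab /andP[abl ab2]; have := split_size_lt abl ab2 => lt1.
by rewrite jcum_rec_fuel.
Qed.

Fixpoint jcum_bound (n : nat) : nat :=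
  if n is m.+1 then (1 + 2 ^ m * jcum_bound m)%N else 0.

Fixpoint jcum_mix_bound (n : nat) : nat :=
  if n is m.+1 then (1 + 2 ^ m * (jcum_mix_bound m + jcum_bound m))%N else 0.

Lemma jcum_bound_mono m n : (m <= n)%N -> (jcum_bound m <= jcum_bound n)%N.
Proof.
elim: n m => [|n IH] [|m] //= le; rewrite leq_add2l leq_mul ?leq_pexp2l//; exact: IH.
Qed.

Lemma jcum_mix_bound_mono m n : (m <= n)%N -> (jcum_mix_bound m <= jcum_mix_bound n)%N.
Proof.
elim: n m => [|n IH] [|m] //= le; rewrite leq_add2l leq_mul ?leq_pexp2l// leq_add//.
  exact: IH.
exact: jcum_bound_mono.
Qed.

Lemma ler_norm_sum_splits (l : seq A) (P : pred (seq A * seq A)) (F : seq A * seq A -> R) c :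
  0 <= c ->
  (forall ab, ab \in splits l -> P ab -> `|F ab| <= c) ->
  `|\sum_(ab <- splits l | P ab) F ab| <= (2 ^ size l)%:R * c.
Proof.
move=> c0 Fc; apply: le_trans (ler_norm_sum _ _ _) _.
rewrite -size_splits mulr_natl.
apply: (@le_trans _ _ (\sum_(ab <- splits l | P ab) c)).
  by rewrite big_seq_cond [leRHS]big_seq_cond; apply: ler_sum => ab /andP[]; exact: Fc.
rewrite big_const_seq iter_addr_0 -!(mulr_natl c) ler_wpM2r // ler_nat.
exact: count_size.
Qed.

Lemma norm_joint_cumulant_le l : (forall l, `|E l| <= 1) ->
  `|joint_cumulant l| <= (jcum_bound (size l))%:R.
Proof.
move=> E1; have [n] := ubnP (size l); elim: n l => [|n IH] [|x l] //.
  by move=> _; rewrite /joint_cumulant normr0.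
rewrite ltnS {1}/joint_cumulant /= => sl.
apply: le_trans (ler_normB _ _) _; rewrite /= natrD natrM; apply: lerD => //.
apply: ler_norm_sum_splits => // ab abl ab2.
have lt1 := split_size_lt abl ab2.
rewrite jcum_rec_fuel // normrM -[leRHS]mulr1 ler_pM //.
apply: le_trans (IH _ _) _; first exact: leq_ltn_trans lt1 sl.
by rewrite ler_nat; apply: jcum_bound_mono.
Qed.

(* Both factors of the decoupled moment E(p-part) E(rest) expand by the same
   recursion, so that subtracting the two expansions expresses the cumulant of a
   mixed list through cumulants of shorter mixed lists and decoupling errors. *)
Lemma norm_joint_cumulant_mixed_le (D p : pred A) eps l : E [::] = 1 ->
  0 <= eps -> (forall l, `|E l| <= 1) ->
  (forall l, all D l ->
    `|E l - E (seq.filter p l) * E (seq.filter (predC p) l)| <= eps) ->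
  all D l -> has p l -> has (predC p) l ->
  `|joint_cumulant l| <= (jcum_mix_bound (size l))%:R * eps.
Proof.
move=> E0 eps0 E1; have [n] := ubnP (size l).
elim: n l p => [|n IH] [|x l] p //; rewrite ltnS => sl Ep Dl hp hNp.
wlog px : p Ep hp hNp / p x.
  move=> wlg; have [px|Npx] := boolP (p x); first exact: (wlg p).
  apply: (wlg (predC p)) => //.
    move=> k Dk; rewrite mulrC (_ : seq.filter (predC (predC p)) k = seq.filter p k) ?Ep//.
    by apply: eq_filter => y /=; rewrite negbK.
  by apply: sub_has hp => y /=; rewrite negbK.
have /= /andP[Dx Dl'] := Dl.
have {hNp} hNp : has (predC p) l by move: hNp => /=; rewrite px.
have expE := joint_cumulantE x l E0.
have expEp := joint_cumulantE x (seq.filter p l) E0.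
rewrite (bigID (fun ab => nilp ab.2)) /= in expE.
rewrite (big_splits_nil l (fun ab => joint_cumulant (x :: ab.1) * E ab.2)) /= E0 mulr1 in expE.
rewrite (bigID (fun ab => all p ab.1)) /= in expE.
have nonnil ab : ab \in splits l -> all p ab.1 -> ~~ nilp ab.2.
  move=> /mem_splits[_ mm] pa; apply/negP => /nilP b0.
  have [y yl Npy] := hasP hNp.
  by move: yl; rewrite -mm b0 cats0 => /(allP pa) py; move: Npy; rewrite /= py.
have EE : E (x :: seq.filter p l) * E (seq.filter (predC p) l) =
    \sum_(ab <- splits l | all p ab.1) joint_cumulant (x :: ab.1) *
       (E (seq.filter p ab.2) * E (seq.filter (predC p) ab.2)).
  rewrite expEp mulr_suml.
  rewrite (big_splits_filter p l (fun a b c => joint_cumulant (x :: a) * (E b * E c))).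
  by apply: eq_bigr => ab _; rewrite mulrA.
have eqS : \sum_(ab <- splits l | ~~ nilp ab.2 && all p ab.1) joint_cumulant (x :: ab.1) * E ab.2
   = \sum_(ab <- splits l | all p ab.1) joint_cumulant (x :: ab.1) * E ab.2.
  rewrite big_seq_cond [RHS]big_seq_cond; apply: eq_bigl => ab.
  case: (boolP (ab \in splits l)) => //= abl.
  by case: (boolP (all p ab.1)) => pa; rewrite ?andbF ?andbT ?(nonnil ab).
have -> : joint_cumulant (x :: l) =
  (E (x :: l) - E (x :: seq.filter p l) * E (seq.filter (predC p) l))
  - \sum_(ab <- splits l | all p ab.1) joint_cumulant (x :: ab.1) *
       (E ab.2 - E (seq.filter p ab.2) * E (seq.filter (predC p) ab.2))
  - \sum_(ab <- splits l | ~~ nilp ab.2 && ~~ all p ab.1)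
       joint_cumulant (x :: ab.1) * E ab.2.
  under [X in _ - X - _]eq_bigr do rewrite mulrBr.
  by rewrite sumrB -EE expE eqS; ring.
have b1 : `|E (x :: l) - E (x :: seq.filter p l) * E (seq.filter (predC p) l)| <= eps.
  by have := Ep (x :: l) Dl; rewrite /= px /=.
have b2 : `|\sum_(ab <- splits l | all p ab.1) joint_cumulant (x :: ab.1) *
       (E ab.2 - E (seq.filter p ab.2) * E (seq.filter (predC p) ab.2))|
    <= (2 ^ size l)%:R * ((jcum_bound (size l))%:R * eps).
  apply: ler_norm_sum_splits; first exact: mulr_ge0.
  move=> ab abl pa; have lt1 := split_size_lt abl (nonnil _ abl pa).
  rewrite normrM ler_pM //.
    apply: le_trans (norm_joint_cumulant_le _ E1) _.
    by rewrite ler_nat; apply: jcum_bound_mono.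
  apply: Ep; have [_ mm] := mem_splits abl.
  by apply/allP => y yb; apply: (allP Dl'); rewrite -mm mem_cat yb orbT.
have b3 : `|\sum_(ab <- splits l | ~~ nilp ab.2 && ~~ all p ab.1)
       joint_cumulant (x :: ab.1) * E ab.2|
    <= (2 ^ size l)%:R * ((jcum_mix_bound (size l))%:R * eps).
  apply: ler_norm_sum_splits; first exact: mulr_ge0.
  move=> ab abl /andP[ab2 Npa]; have lt1 := split_size_lt abl ab2.
  rewrite normrM -[leRHS]mulr1 ler_pM //.
  have [_ mm] := mem_splits abl.
  apply: le_trans (IH _ p _ _ _ _ _) _ => //; first exact: leq_ltn_trans lt1 sl.
  - rewrite /= Dx; apply/allP => y ya; apply: (allP Dl').
    by rewrite -mm mem_cat ya.
  - by rewrite /= px.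
  - by rewrite /= has_predC Npa orbT.
  by rewrite ler_wpM2r // ler_nat; apply: jcum_mix_bound_mono.
apply: le_trans (ler_normB _ _) _; apply: le_trans (lerD (ler_normB _ _) (lexx _)) _.
apply: le_trans (lerD (lerD b1 b2) b3) _.
by rewrite /= !natrD natrM natrD; lra.
Qed.

End JointCumulant.

(** * Marcinkiewicz' theorem for moment sequences *)

Section EntireSeries.
Context {R : realType}.
Implicit Types (d : R^nat) (r x : R).

Definition entire d := forall r, 0 <= r -> exists M, forall n, `|d n| * r ^+ n <= M.

Lemma entire_cvg d x : entire d -> cvgn (pseries d x).
Proof.
move=> dE; apply: normed_cvg.
have [M dM] : exists M, forall n, `|d n| * (2 * `|x|) ^+ n <= M by apply: dE; rewrite mulr_ge0.
have M0 : 0 <= M by apply: le_trans (dM 0%N); rewrite mulr_ge0// exprn_ge0// mulr_ge0.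
apply: (@series_le_cvg _ _ (geometric M 2^-1)) => [n|n|n|] /=.
- by [].
- by rewrite mulr_ge0// exprn_ge0.
- rewrite normrM normrX exprVn ler_pdivlMr ?exprn_gt0// -mulrA -exprMn.
  by rewrite (mulrC _ 2); exact: dM.
- by apply: is_cvg_geometric_series; rewrite ger0_norm// invf_lt1// ltr1n.
Qed.

Lemma entire_diffs d : entire d -> entire (pseries_diffs d).
Proof.
move=> dE r r0; have [M dM] := dE (2 * (r + 1)) ltac:(lra).
exists M => n; apply: le_trans (dM n.+1); rewrite /pseries_diffs normrM normr_nat.
rewrite (mulrC n.+1%:R) -mulrA ler_wpM2l// exprMn.
have h1 : n.+1%:R <= 2 ^+ n.+1 :> R by rewrite -natrX ler_nat ltnW// ltn_expl.
have h2 : r ^+ n <= (r + 1) ^+ n.+1.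
  apply: (@le_trans _ _ ((r + 1) ^+ n)).
    by rewrite lerXn2r ?nnegrE//; lra.
  by rewrite exprS ler_peMl ?exprn_ge0//; lra.
by apply: ler_pM => //; rewrite exprn_ge0.
Qed.

Lemma is_derive_entire d x : entire d ->
  is_derive x (1 : R) (fun x => limn (pseries d x)) (limn (pseries (pseries_diffs d) x)).
Proof.
move=> dE; apply: (@pseries_snd_diffs _ _ (`|x| + 1)).
- exact: entire_cvg.
- by apply: entire_cvg; exact: entire_diffs.
- by apply: entire_cvg; do 2 apply: entire_diffs.
- by rewrite [ltRHS]ger0_norm ?ltrDl// addr_ge0.
Qed.

Lemma entireM d (c : R^nat) rho : 0 <= rho -> (forall n, `|c n| <= rho ^+ n) ->
  entire d -> entire (fun n => d n * c n).
Proof.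
move=> rho0 cE dE r r0; have [M dM] := dE (rho * r) (mulr_ge0 rho0 r0).
exists M => n; apply: le_trans (dM n); rewrite normrM -mulrA exprMn.
by rewrite ler_wpM2l// ler_wpM2r// exprn_ge0.
Qed.

End EntireSeries.

Section ReIm.
Context {R : realFieldType}.
Implicit Types a b : R.

Fixpoint re_im a b n : R * R :=
  if n is n'.+1 then
    (a * (re_im a b n').1 - b * (re_im a b n').2,
     a * (re_im a b n').2 + b * (re_im a b n').1)
  else (1, 0).
Definition re_pow a b n := (re_im a b n).1.
Definition im_pow a b n := (re_im a b n).2.

Lemma re_powS a b n : re_pow a b n.+1 = a * re_pow a b n - b * im_pow a b n.
Proof. by []. Qed.
Lemma im_powS a b n : im_pow a b n.+1 = a * im_pow a b n + b * re_pow a b n.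
Proof. by []. Qed.

Lemma re_im_powD a b m n :
  re_pow a b (m + n) = re_pow a b m * re_pow a b n - im_pow a b m * im_pow a b n /\
  im_pow a b (m + n) = re_pow a b m * im_pow a b n + im_pow a b m * re_pow a b n.
Proof.
elim: m => [|m [IH1 IH2]]; first by rewrite add0n /re_pow /im_pow /=; split; ring.
by rewrite addSn !re_powS !im_powS IH1 IH2; split; ring.
Qed.

Lemma re_im_pow_real a n : re_pow a 0 n = a ^+ n /\ im_pow a 0 n = 0.
Proof.
elim: n => [|n [IH1 IH2]]; first by rewrite expr0.
by rewrite re_powS im_powS IH1 IH2 exprS; split; ring.
Qed.

Lemma norm_re_im_pow_le a b n :
  `|re_pow a b n| <= (`|a| + `|b|) ^+ n /\ `|im_pow a b n| <= (`|a| + `|b|) ^+ n.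
Proof.
suff : `|re_pow a b n| + `|im_pow a b n| <= (`|a| + `|b|) ^+ n.
  by move=> h; split; apply: le_trans h; rewrite ?lerDl ?lerDr.
elim: n => [|n IH]; first by rewrite expr0 /re_pow /im_pow /= normr1 normr0 addr0.
rewrite re_powS im_powS exprS.
apply: (@le_trans _ _ ((`|a| + `|b|) * (`|re_pow a b n| + `|im_pow a b n|))).
  apply: le_trans (lerD (ler_normB _ _) (ler_normD _ _)) _.
  by rewrite !normrM; lra.
by rewrite ler_wpM2l// addr_ge0.
Qed.

Lemma sum_binS (F : nat -> R) n :
  \sum_(i < n.+2) F i *+ 'C(n.+1, i) = \sum_(i < n.+1) (F i + F i.+1) *+ 'C(n, i).
Proof.
rewrite big_ord_recl bin0.
under eq_bigr => i _ do rewrite lift0 binS mulrnDr.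
rewrite big_split /= addrA.
under [RHS]eq_bigr => i _ do rewrite mulrnDl.
rewrite [RHS]big_split /=; congr (_ + _).
rewrite [RHS]big_ord_recl bin0; congr (_ + _).
by rewrite big_ord_recr /= bin_small // mulr0n addr0.
Qed.

Lemma sum_bin_re_im a b n :
  [/\ \sum_(i < n.+1) (re_pow a b i * re_pow a b (n - i)) *+ 'C(n, i) =
        ((2 * a) ^+ n + 2 ^+ n * re_pow a b n) / 2,
      \sum_(i < n.+1) (im_pow a b i * im_pow a b (n - i)) *+ 'C(n, i) =
        ((2 * a) ^+ n - 2 ^+ n * re_pow a b n) / 2 &
      \sum_(i < n.+1) (re_pow a b i * im_pow a b (n - i)
        + im_pow a b i * re_pow a b (n - i)) *+ 'C(n, i) = 2 ^+ n * im_pow a b n].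
Proof.
have sumC : \sum_(i < n.+1) 1 *+ 'C(n, i) = 2 ^+ n :> R.
  rewrite -[2%R]/(1 + 1) exprDn.
  by apply: eq_bigr => i _; rewrite !expr1n mulr1.
have minus : \sum_(i < n.+1) (re_pow a b i * re_pow a b (n - i)
     - im_pow a b i * im_pow a b (n - i)) *+ 'C(n, i) = 2 ^+ n * re_pow a b n.
  rewrite -sumC mulr_suml; apply: eq_bigr => i _.
  rewrite -(re_im_powD a b i (n - i)).1 subnKC -1?ltnS//.
  by rewrite mulrnAl mul1r.
have cross : \sum_(i < n.+1) (re_pow a b i * im_pow a b (n - i)
     + im_pow a b i * re_pow a b (n - i)) *+ 'C(n, i) = 2 ^+ n * im_pow a b n.
  rewrite -sumC mulr_suml; apply: eq_bigr => i _.
  rewrite -(re_im_powD a b i (n - i)).2 subnKC -1?ltnS//.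
  by rewrite mulrnAl mul1r.
have plus : \sum_(i < n.+1) (re_pow a b i * re_pow a b (n - i)
     + im_pow a b i * im_pow a b (n - i)) *+ 'C(n, i) = (2 * a) ^+ n.
  elim: n {sumC minus cross} => [|n IH].
    by rewrite big_ord_recl big_ord0 /re_pow /im_pow /= bin0 expr0; ring.
  rewrite (sum_binS (fun i => re_pow a b i * re_pow a b (n.+1 - i)
     + im_pow a b i * im_pow a b (n.+1 - i))) exprS -IH mulr_sumr.
  apply: eq_bigr => i _; rewrite subSS subSn -1?ltnS// mulrnAr; congr (_ *+ _).
  by rewrite !re_powS !im_powS; ring.
split=> //.
- rewrite -plus -minus -big_split /= mulr_suml; apply: eq_bigr => i _.
  by rewrite -mulrnDl mulrnAl; congr (_ *+ _); field.
- rewrite -plus -minus -sumrB /= mulr_suml; apply: eq_bigr => i _.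
  by rewrite -mulrnBl mulrnAl; congr (_ *+ _); field.
Qed.

End ReIm.

Definition moment_cumulant (R : pzRingType) (m k : nat -> R) : Prop :=
  m 0%N = 1 /\
  forall n, m n.+1 = \sum_(j < n.+1) (k j.+1 * m (n - j)%N) *+ 'C(n, j).

Definition positive_moments (R : numDomainType) (m : nat -> R) : Prop :=
  forall N (x : nat -> R), 0 <= \sum_(i < N) \sum_(j < N) x i * x j * m (i + j)%N.

Section BigTriangle.
Context {R : zmodType}.
Implicit Types G : nat -> nat -> R.

Lemma sum_triangleS G N :
  \sum_(j < N.+1) \sum_(i < N.+1 - j) G j i =
  \sum_(j < N) \sum_(i < N - j) G j i + \sum_(j < N.+1) G j (N - j)%N.
Proof.
rewrite big_ord_recr [in RHS]big_ord_recr /= addrA -big_split /=.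
rewrite subnn subSnn big_ord_recl big_ord0 addr0; congr (_ + _).
by apply: eq_bigr => j _; rewrite subSn ?(ltnW (ltn_ord j))// big_ord_recr.
Qed.

Lemma sum_triangle G N :
  \sum_(n < N) \sum_(j < n.+1) G j (n - j)%N = \sum_(j < N) \sum_(i < N - j) G j i.
Proof.
elim: N => [|N IH]; first by rewrite !big_ord0.
by rewrite sum_triangleS -IH big_ord_recr.
Qed.

Lemma sum_support (F : nat -> R) (m n : nat) : (m <= n)%N ->
  (forall j, (m <= j)%N -> F j = 0) -> \sum_(j < n) F j = \sum_(j < m) F j.
Proof.
move=> mn F0; rewrite -!(big_mkord xpredT) (big_cat_nat (leq0n _) mn)/=.
have -> : \sum_(m <= j < n) F j = 0.
  by apply: big1_seq => j; rewrite mem_index_iota => /andP[_ /andP[mj _]]; exact: F0.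
by rewrite addr0.
Qed.

End BigTriangle.

Lemma cvg_sumr (R : realType) (T I : Type) (F : set_system T) {FF : Filter F} (r : seq I)
    (f : I -> T -> R) (l : I -> R) :
  (forall i, f i x @[x --> F] --> l i) ->
  \sum_(i <- r) f i x @[x --> F] --> \sum_(i <- r) l i.
Proof.
move=> fl; elim: r => [|i r IH].
  by rewrite big_nil; under eq_fun do rewrite big_nil; exact: cvg_cst.
by rewrite big_cons; under eq_fun do rewrite big_cons; apply: cvgD.
Qed.

Section FiniteCumulants.
Context {R : realType}.
Variables (m k : nat -> R) (K : nat).
Hypothesis mk : moment_cumulant m k.
Hypothesis kK : forall j, (K <= j)%N -> k j = 0.

Let a n := m n / n`!%:R.
Let h j := k j.+1 / j`!%:R.

Let factR_neq0 n : n`!%:R != 0 :> R.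
Proof. by rewrite pnatr_eq0 -lt0n fact_gt0. Qed.

Let h0 j : (K <= j)%N -> h j = 0.
Proof. by move=> Kj; rewrite /h kK ?mul0r// leqW. Qed.

Let a_rec n : n.+1%:R * a n.+1 = \sum_(j < n.+1) h j * a (n - j)%N.
Proof.
rewrite /a mk.2 factS natrM invfM mulrCA mulVKf ?pnatr_eq0// mulr_suml.
apply: eq_bigr => j _; rewrite /h.
have jn : (j <= n)%N by rewrite -ltnS.
rewrite -(bin_fact jn) !natrM !invfM -mulr_natr.
have : 'C(n, j)%:R != 0 :> R by rewrite pnatr_eq0 -lt0n bin_gt0.
have := factR_neq0 j; have := factR_neq0 (n - j)%N.
by move=> ? ? ?; field; do ?[apply/andP; split].
Qed.

Let norm_sum_h_le r n : 0 <= r ->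
  \sum_(j < n) `|h j| * r ^+ j.+1 <= \sum_(j < K) `|h j| * r ^+ j.+1.
Proof.
move=> r0; have t0 j : 0 <= `|h j| * r ^+ j.+1 by rewrite mulr_ge0// exprn_ge0.
have [nK|Kn] := leqP n K; last first.
  rewrite (@sum_support _ (fun j => `|h j| * r ^+ j.+1) K)// 1?ltnW//.
  by move=> j Kj; rewrite h0// normr0 mul0r.
rewrite -!(big_mkord xpredT (fun j => `|h j| * r ^+ j.+1)) (big_cat_nat (leq0n _) nK)/=.
by rewrite lerDl sumr_ge0.
Qed.

Lemma entire_moments : entire (fun n => m n / n`!%:R).
Proof.
move=> r r0; rewrite -/a.
pose C := \sum_(j < K) `|h j| * r ^+ j.+1.
pose b n := `|a n| * r ^+ n.
have b0 n : 0 <= b n by rewrite mulr_ge0// exprn_ge0.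
have [N0 CN0] : exists N0 : nat, C <= N0%:R.
  by exists (Num.truncn C).+1; rewrite ltW// truncnS_gt.
exists (\sum_(i < N0.+1) b i) => n; rewrite -/(b n).
elim/ltn_ind: n => n IH.
have [nN|Nn] := ltnP n N0.+1.
  by rewrite (bigD1 (Ordinal nN))//= lerDl sumr_ge0.
case: n IH Nn => // n IH; rewrite ltnS => Nn.
set M := \sum_(i < _) _ in IH *.
have M0 : 0 <= M by apply: sumr_ge0.
rewrite -(ler_pM2l (ltr0Sn R n)).
apply: (@le_trans _ _ (C * M)); last first.
  by rewrite ler_wpM2r// (le_trans CN0)// ler_nat leqW.
apply: (@le_trans _ _ (\sum_(j < n.+1) `|h j| * r ^+ j.+1 * b (n - j)%N)).
  rewrite /b mulrA -[X in X * `|_|]normr_nat -normrM a_rec.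
  apply: le_trans (ler_wpM2r _ (ler_norm_sum _ _ _)) _; first exact: exprn_ge0.
  rewrite mulr_suml; apply: ler_sum => j _; rewrite normrM.
  rewrite mulrACA ler_pM ?mulr_ge0 ?exprn_ge0//.
  by rewrite -exprD addSn subnKC// -ltnS.
apply: (@le_trans _ _ ((\sum_(j < n.+1) `|h j| * r ^+ j.+1) * M)).
  rewrite mulr_suml; apply: ler_sum => j _.
  by rewrite ler_wpM2l ?mulr_ge0 ?exprn_ge0// IH// ltnS leq_subr.
by rewrite ler_wpM2r// norm_sum_h_le.
Qed.

Let lim_diffs (e f g x y : nat -> R) (F G : R) r :
  (forall n j, (j <= n)%N -> e n.+1 = x j * f (n - j)%N + y j * g (n - j)%N) ->
  pseries (fun n => a n * f n) r @ \oo --> F ->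
  pseries (fun n => a n * g n) r @ \oo --> G ->
  limn (pseries (pseries_diffs (fun n => a n * e n)) r) =
  \sum_(j < K) h j * r ^+ j * (x j * F + y j * G).
Proof.
move=> efg cF cG; apply/cvg_lim => //.
apply: (@cvg_trans _ ((fun N => \sum_(j < K) h j * r ^+ j *
   (x j * pseries (fun n => a n * f n) r (N - j)%N
    + y j * pseries (fun n => a n * g n) r (N - j)%N)) @ \oo)); last first.
  apply: cvg_sumr => j; apply: cvgMl_tmp; apply: cvgD; apply: cvgMl_tmp.
    by rewrite -(cvg_shiftn j); under eq_fun do rewrite addnK.
  by rewrite -(cvg_shiftn j); under eq_fun do rewrite addnK.
apply: near_eq_cvg; near=> N.
have KN : (K <= N)%N by near: N; exact: nbhs_infty_ge.
rewrite /pseries /series /= big_mkord.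
transitivity (\sum_(j < N) h j * r ^+ j * (x j * (\sum_(i < N - j) a i * f i * r ^+ i)
  + y j * (\sum_(i < N - j) a i * g i * r ^+ i))).
  rewrite (@sum_support _ (fun j => h j * r ^+ j * (x j * (\sum_(i < N - j) a i * f i * r ^+ i)
  + y j * (\sum_(i < N - j) a i * g i * r ^+ i))) K)//.
    by apply: eq_bigr => j _; rewrite !big_mkord.
  by move=> j Kj; rewrite h0// !mul0r.
transitivity (\sum_(j < N) \sum_(i < N - j) h j * r ^+ j * (x j * (a i * f i * r ^+ i) + y j * (a i * g i * r ^+ i))).
  by apply: eq_bigr => j _; rewrite !mulr_sumr -big_split mulr_sumr.
rewrite -(sum_triangle (fun j i => h j * r ^+ j * (x j * (a i * f i * r ^+ i) + y j * (a i * g i * r ^+ i)))).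
apply: eq_bigr => n _; rewrite /pseries_diffs mulrA a_rec !mulr_suml.
apply: eq_bigr => j _; have jn : (j <= n)%N by rewrite -ltnS.
have -> : r ^+ n = r ^+ j * r ^+ (n - j) by rewrite -exprD subnKC.
by rewrite (efg n j)//; ring.
Unshelve. all: by end_near. Qed.

Let U al be r := limn (pseries (fun n => a n * re_pow al be n) r).
Let W al be r := limn (pseries (fun n => a n * im_pow al be n) r).

Let entire_re al be : entire (fun n => a n * re_pow al be n).
Proof.
apply: (@entireM _ _ _ (`|al| + `|be|)) => //.
- by move=> n; exact: (norm_re_im_pow_le _ _ _).1.
- exact: entire_moments.
Qed.

Let entire_im al be : entire (fun n => a n * im_pow al be n).
Proof.
apply: (@entireM _ _ _ (`|al| + `|be|)) => //.
- by move=> n; exact: (norm_re_im_pow_le _ _ _).2.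
- exact: entire_moments.
Qed.

Let pU al be : {poly R} :=
  \poly_(i < K.+1) (if i == 0%N then 0 else k i / i`!%:R * re_pow al be i).

Let horner_pU al be r : (pU al be).[r] = \sum_(i < K) k i.+1 / i.+1`!%:R * re_pow al be i.+1 * r ^+ i.+1.
Proof.
rewrite (@horner_coef_wide _ K.+1); last exact: size_poly.
rewrite big_ord_recl coef_poly /= mul0r add0r.
by apply: eq_bigr => i _; rewrite coef_poly /bump /= add1n ltnS ltn_ord.
Qed.

Let horner_dpU al be r : (pU al be)^`().[r] = \sum_(j < K) h j * re_pow al be j.+1 * r ^+ j.
Proof.
rewrite (@horner_coef_wide _ K); last first.
  have [->|p0] := eqVneq (pU al be) 0; first by rewrite deriv0 size_poly0.
  by rewrite -ltnS (leq_trans (lt_size_deriv p0))// size_poly.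
apply: eq_bigr => j _; rewrite coef_deriv -mulr_natr coef_poly ltnS ltn_ord /=.
rewrite /h factS natrM.
have n1 : j.+1%:R != 0 :> R by rewrite pnatr_eq0.
have n2 := factR_neq0 j.
by move: (j.+1%:R : R) (j`!%:R : R) n1 n2 => y z y0 z0; field; rewrite y0 z0.
Qed.

Let is_derive_U al be r : is_derive r (1 : R) (U al be)
  (\sum_(j < K) h j * r ^+ j * (re_pow al be j.+1 * U al be r
     + (- im_pow al be j.+1) * W al be r)).
Proof.
have -> : \sum_(j < K) h j * r ^+ j * (re_pow al be j.+1 * U al be r
    + (- im_pow al be j.+1) * W al be r)
    = limn (pseries (pseries_diffs (fun n => a n * re_pow al be n)) r).
  rewrite (@lim_diffs _ (re_pow al be) (im_pow al be)
    (fun j => re_pow al be j.+1) (fun j => - im_pow al be j.+1) (U al be r) (W al be r))//.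
  - move=> n j jn; rewrite -[in LHS](subnKC jn) -addSn.
    by rewrite (re_im_powD _ _ _ _).1 mulNr.
  - exact: entire_cvg.
  - exact: entire_cvg.
exact: is_derive_entire.
Qed.

Let is_derive_W al be r : is_derive r (1 : R) (W al be)
  (\sum_(j < K) h j * r ^+ j * (im_pow al be j.+1 * U al be r
     + re_pow al be j.+1 * W al be r)).
Proof.
have -> : \sum_(j < K) h j * r ^+ j * (im_pow al be j.+1 * U al be r
    + re_pow al be j.+1 * W al be r)
    = limn (pseries (pseries_diffs (fun n => a n * im_pow al be n)) r).
  rewrite (@lim_diffs _ (re_pow al be) (im_pow al be)
    (fun j => im_pow al be j.+1) (fun j => re_pow al be j.+1) (U al be r) (W al be r))//.
  - move=> n j jn; rewrite -[in LHS](subnKC jn) -addSn.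
    by rewrite (re_im_powD _ _ _ _).2 addrC.
  - exact: entire_cvg.
  - exact: entire_cvg.
exact: is_derive_entire.
Qed.

Let lim_pseries0 (d : R^nat) : limn (pseries d 0) = d 0%N.
Proof.
apply/cvg_lim => //; apply: cvg_near_cst; near=> n.
have n0 : (0 < n)%N by near: n; exact: nbhs_infty_gt.
rewrite /pseries /series /= big_mkord -(prednK n0) big_ord_recl big1 ?addr0.
  by rewrite expr0 mulr1.
by move=> i _; rewrite expr0n mulr0.
Unshelve. all: by end_near. Qed.

(* [U + i W] is the moment generating function along the ray through
   [al + i be]; its modulus solves a linear differential equation. *)
Let mgf_modulus al be r :
  U al be r ^+ 2 + W al be r ^+ 2 = expR (2 * (pU al be).[r]).
Proof.
pose f x := (U al be x ^+ 2 + W al be x ^+ 2) * expR (- (2 * (pU al be).[x])).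
have f0 : f 0 = 1.
  have p0 : (pU al be).[0] = 0 by rewrite horner_coef0 coef_poly.
  rewrite /f /U /W !lim_pseries0 p0 [2 * 0]mulr0 oppr0 expR0 mulr1.
  by rewrite /a /re_pow /im_pow mk.1 fact0 /= divr1; ring.
have fc : f r = f 0.
  apply: is_derive_0_is_cst => x.
  have dU := is_derive_U al be x.
  have dW := is_derive_W al be x.
  have dp : is_derive x (1 : R) (fun x => - (2 * (pU al be).[x])) (- (2 * (pU al be)^`().[x])).
    have -> : (fun x => - (2 * (pU al be).[x])) = horner (- (2%:P * pU al be)).
      by apply/funext => y; rewrite !hornerE.
    have := is_derive_poly (- (2%:P * pU al be)) x.
    by rewrite derivN derivM derivC mul0r add0r !hornerE.
  have dE : is_derive x (1 : R) (fun x => expR (- (2 * (pU al be).[x])))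
     (- (2 * (pU al be)^`().[x]) * expR (- (2 * (pU al be).[x]))).
    apply: is_derive_eq; last exact: mulrC.
  rewrite /f; apply: trigger_derive.
  rewrite /GRing.scale /= horner_dpU.
  set D1 := \sum_(j < K) _ * (_ + - _ * _); set D2 := \sum_(j < K) _ * (_ * U _ _ _ + _).
  set S := \sum_(j < K) _.
  have key : U al be x * D1 + W al be x * D2 = (U al be x ^+ 2 + W al be x ^+ 2) * S.
    rewrite !mulr_sumr -big_split; apply: eq_bigr => j _ /=; ring.
  rewrite [LHS](_ : _ = 2 * expR (- (2 * (pU al be).[x])) *
    ((U al be x * D1 + W al be x * D2) - (U al be x ^+ 2 + W al be x ^+ 2) * S)); last by ring.
  by rewrite key subrr mulr0.
apply: (@mulIf _ (expR (- (2 * (pU al be).[r])))); first by rewrite gt_eqF// expR_gt0.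
by rewrite -expRD subrr expR0; exact: etrans fc f0.
Qed.

Section Positive.
Hypothesis m_pos : positive_moments m.

Let quadratic_form_ge0 (A B al be r : R) :
  0 <= A ^+ 2 * (U al 0 r + U al be r) / 2 + A * B * W al be r
       + B ^+ 2 * (U al 0 r - U al be r) / 2.
Proof.
pose x i := (A * re_pow al be i + B * im_pow al be i) * (r / 2) ^+ i / i`!%:R.
pose tri N := \sum_(j < N) \sum_(i < N - j) x j * x i * m (j + i)%N.
have triE N : tri N =
    A ^+ 2 * (pseries (fun n => a n * re_pow al 0 n) r N + pseries (fun n => a n * re_pow al be n) r N) / 2
    + A * B * pseries (fun n => a n * im_pow al be n) r N
    + B ^+ 2 * (pseries (fun n => a n * re_pow al 0 n) r N - pseries (fun n => a n * re_pow al be n) r N) / 2.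
  rewrite /tri -(sum_triangle (fun j i => x j * x i * m (j + i)%N)).
  rewrite /pseries /series /= !big_mkord -sumrB -big_split /= !mulr_sumr !mulr_suml -!big_split /=.
  apply: eq_bigr => n _.
  have [s1 s2 s3] := sum_bin_re_im al be n.
  transitivity (a n * (r / 2) ^+ n * (\sum_(j < n.+1)
     ((A * re_pow al be j + B * im_pow al be j) *
     (A * re_pow al be (n - j) + B * im_pow al be (n - j))) *+ 'C(n, j))).
    rewrite mulr_sumr; apply: eq_bigr => j _.
    have jn : (j <= n)%N by rewrite -ltnS.
    rewrite subnKC// -(mulr_natr _ 'C(n, j)) /x /a -(bin_fact jn) !natrM.
        have -> : (r / 2) ^+ n = (r / 2) ^+ j * (r / 2) ^+ (n - j) by rewrite -exprD subnKC.
    have b0 : 'C(n, j)%:R != 0 :> R by rewrite pnatr_eq0 -lt0n bin_gt0.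
    have f1 := factR_neq0 j; have f2 := factR_neq0 (n - j)%N.
    move: ('C(n, j)%:R : R) (j`!%:R : R) ((n - j)`!%:R : R) b0 f1 f2 => z1 z2 z3 *.
    by field; do ?[apply/andP; split].
  have -> : \sum_(j < n.+1) ((A * re_pow al be j + B * im_pow al be j) *
     (A * re_pow al be (n - j) + B * im_pow al be (n - j))) *+ 'C(n, j) =
     A ^+ 2 * (((2 * al) ^+ n + 2 ^+ n * re_pow al be n) / 2)
     + A * B * (2 ^+ n * im_pow al be n)
     + B ^+ 2 * (((2 * al) ^+ n - 2 ^+ n * re_pow al be n) / 2).
    rewrite -s1 -s2 -s3 !mulr_sumr -!big_split /=; apply: eq_bigr => j _.
    by rewrite !mulrnAr -!mulrnDl; congr (_ *+ _); ring.
  rewrite (re_im_pow_real al n).1 exprMn exprVn exprMn.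
  have two : (2 : R) ^+ n != 0 by rewrite expf_neq0.
  by move: ((2 : R) ^+ n) two => z ?; field.
have tri_lim : tri @ \oo --> A ^+ 2 * (U al 0 r + U al be r) / 2 + A * B * W al be r
       + B ^+ 2 * (U al 0 r - U al be r) / 2.
  rewrite (funext triE : tri = _).
  have c1 : pseries (fun n => a n * re_pow al 0 n) r @ \oo --> U al 0 r by exact: entire_cvg.
  have c2 : pseries (fun n => a n * re_pow al be n) r @ \oo --> U al be r by exact: entire_cvg.
  have c3 : pseries (fun n => a n * im_pow al be n) r @ \oo --> W al be r by exact: entire_cvg.
  apply: cvgD; [apply: cvgD|]; do ?[apply: cvgMr_tmp|apply: cvgMl_tmp] => //.
    exact: cvgD.
  exact: cvgB.
pose rho : R := `|al| + `|be|; pose C : R := `|A| + `|B|.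
have rho0 : 0 <= rho by rewrite addr_ge0.
have C0 : 0 <= C by rewrite addr_ge0.
have r8 : 0 <= 8 * (rho * `|r|) by rewrite !mulr_ge0.
have [M aM] := entire_moments r8.
have M0 : 0 <= M by apply: le_trans (aM 0%N); rewrite mulr_ge0// exprn_ge0// !mulr_ge0.
have x_le j : `|x j| <= C * (rho * (`|r| / 2)) ^+ j / j`!%:R.
  rewrite /x !normrM normfV normr_nat ler_wpM2r ?invr_ge0//.
  rewrite normrX normrM normfV (ger0_norm (_ : 0 <= 2))// (exprMn _ rho) (mulrA C) ler_wpM2r ?exprn_ge0//.
  apply: le_trans (ler_normD _ _) _; rewrite !normrM mulrDl.
  have [c1 c2] := norm_re_im_pow_le al be j.
  by apply: lerD; rewrite ler_wpM2l.
have term_le i j : `|x i * x j * m (i + j)%N| <= C ^+ 2 * M * 8^-1 ^+ (i + j).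
  have -> : C ^+ 2 * M * 8^-1 ^+ (i + j) = C ^+ 2 * (M * 8^-1 ^+ (i + j)) by ring.
  apply: (@le_trans _ _ (C ^+ 2 * (`|a (i + j)%N| * (rho * `|r|) ^+ (i + j)))); last first.
    rewrite ler_wpM2l ?exprn_ge0// exprVn ler_pdivlMr ?exprn_gt0// -mulrA -exprMn.
    by rewrite (mulrC _ 8); exact: aM.
  rewrite 2!normrM; apply: (@le_trans _ _ ((C * (rho * (`|r| / 2)) ^+ i / i`!%:R) *
     (C * (rho * (`|r| / 2)) ^+ j / j`!%:R) * `|m (i + j)%N|)).
    by rewrite ler_wpM2r// ler_pM ?x_le.
  have ij : (i <= i + j)%N by rewrite leq_addr.
  rewrite /a normrM normfV normr_nat -(bin_fact ij) (addnC i j) addnK (addnC j i) !natrM.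
  have -> : rho * `|r| = 2 * (rho * (`|r| / 2)) by field.
  rewrite (exprMn _ 2) (exprD (rho * _)).
  set t := rho * (`|r| / 2); have t0 : 0 <= t by rewrite !mulr_ge0.
  have b0 : 'C(i + j, i)%:R != 0 :> R by rewrite pnatr_eq0 -lt0n bin_gt0.
  have b2 : 'C(i + j, i)%:R <= 2 ^+ (i + j) :> R.
    rewrite -natrX ler_nat -[in leqRHS](add1n 1) Pascal (bigD1 (Ordinal (ij : (i < (i + j).+1)%N)))//=.
    by rewrite !exp1n !muln1 leq_addr.
  have f1 := factR_neq0 i; have f2 := factR_neq0 j.
  apply: (@le_trans _ _ (C ^+ 2 * (`|m (i + j)%N| / (i`!%:R * j`!%:R)) * (t ^+ i * t ^+ j))).
    by rewrite le_eqVlt; apply/orP; left; apply/eqP; field; rewrite f1 f2.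
  have -> : C ^+ 2 * (`|m (i + j)%N| / ('C(i + j, i)%:R * (i`!%:R * j`!%:R)) * (2 ^+ (i + j) * (t ^+ i * t ^+ j)))
     = C ^+ 2 * (`|m (i + j)%N| / (i`!%:R * j`!%:R)) * (t ^+ i * t ^+ j) * (2 ^+ (i + j) / 'C(i + j, i)%:R).
    by field; rewrite f1 f2 b0.
  rewrite ler_peMr ?mulr_ge0 ?exprn_ge0 ?invr_ge0 ?mulr_ge0//.
  by rewrite ler_pdivlMr ?mul1r// ltr0n bin_gt0.
have tail N : - (C ^+ 2 * M * (1 / 2) ^+ N) <= tri N.
  have sq := m_pos N x.
  have -> : tri N = \sum_(i < N) \sum_(j < N) x i * x j * m (i + j)%N -
      \sum_(i < N) \sum_(N - i <= j < N) x i * x j * m (i + j)%N.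
    rewrite -sumrB; apply: eq_bigr => i _.
    rewrite -!(big_mkord xpredT (fun j => x i * x j * m (i + j)%N)).
    by rewrite (big_cat_nat (leq0n _) (leq_subr i N)) /= addrK.
  apply: (@le_trans _ _ (- \sum_(i < N) \sum_(N - i <= j < N) x i * x j * m (i + j)%N)); last by rewrite lerDr.
  rewrite lerN2; apply: le_trans (ler_norm _) _.
  apply: le_trans (ler_norm_sum _ _ _) _.
  apply: (@le_trans _ _ (\sum_(i < N) \sum_(j < N) C ^+ 2 * M * 8^-1 ^+ N)).
    apply: ler_sum => i _; apply: le_trans (ler_norm_sum _ _ _) _.
    rewrite -(big_mkord xpredT (fun=> C ^+ 2 * M * 8^-1 ^+ N)).
    rewrite (big_cat_nat (leq0n _) (leq_subr i N)) /=.
    rewrite -[leLHS]add0r lerD ?sumr_ge0//.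
      by move=> j _; rewrite !mulr_ge0 ?exprn_ge0 ?invr_ge0.
    rewrite big_nat_cond [leRHS]big_nat_cond; apply: ler_sum => j /andP[/andP[ij _] _].
    apply: le_trans (term_le i j) _.
    rewrite ler_wpM2l ?mulr_ge0 ?exprn_ge0//.
    rewrite ler_wiXn2l ?invr_ge0 ?invf_le1 ?ler1n//.
    by rewrite -leq_subLR.
  rewrite !sumr_const !card_ord -mulrnA -(mulr_natr _ (N * N)) -!mulrA ler_wpM2l ?exprn_ge0// ler_wpM2l//.
  have -> : 8^-1 = (1 / 2) * 4^-1 :> R by field.
  rewrite ler_wpM2l// (exprMn _ (1 / 2)) -mulrA ler_piMr ?exprn_ge0//.
  rewrite exprVn mulrC ler_pdivrMr ?exprn_gt0// mul1r -natrX ler_nat.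
  by rewrite -[4%N]/(2 * 2)%N expnMn leq_mul// ltnW// ltn_expl.
have lim0 : (fun N => tri N + C ^+ 2 * M * (1 / 2) ^+ N) @ \oo --> A ^+ 2 * (U al 0 r + U al be r) / 2 + A * B * W al be r
       + B ^+ 2 * (U al 0 r - U al be r) / 2.
  rewrite -[X in _ --> X]addr0; apply: cvgD => //.
  have := @cvg_geometric R (C ^+ 2 * M) (1 / 2); apply.
  by rewrite ger0_norm; lra.
rewrite -(cvg_lim _ lim0)//; apply: limr_ge; first by apply/cvg_ex; eexists; exact: lim0.
by apply: nearW => N; rewrite -lerBlDr sub0r.
Qed.

Let mgf_ridge (al be r : R) : (pU al be).[r] <= (pU al 0).[r].
Proof.
have q A B := quadratic_form_ge0 A B al be r.
suff : U al be r ^+ 2 + W al be r ^+ 2 <= U al 0 r ^+ 2 + W al 0 r ^+ 2.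
  by rewrite !mgf_modulus ler_expR ler_pM2l.
apply: (@le_trans _ _ (U al 0 r ^+ 2)); last by rewrite lerDl sqr_ge0.
set F := U al 0 r in q *; set u := U al be r in q *; set w := W al be r in q *.
have Fu0 : 0 <= F + u by have := q 1 0; lra.
have uF0 : 0 <= F - u by have := q 0 1; lra.
have [Fu|Fu] := ltP 0 (F + u).
  have := q (- w) (F + u).
  have -> : (- w) ^+ 2 * (F + u) / 2 + (- w) * (F + u) * w + (F + u) ^+ 2 * (F - u) / 2
     = (F + u) / 2 * ((F ^+ 2) - (u ^+ 2 + w ^+ 2)) by field.
  by rewrite pmulr_rge0 ?subr_ge0// divr_gt0.
have e1 : F + u = 0 by lra.
have [uF|uF] := ltP 0 (F - u).
  have := q (F - u) (- w).
  have -> : (F - u) ^+ 2 * (F + u) / 2 + (F - u) * (- w) * w + (- w) ^+ 2 * (F - u) / 2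
     = (F - u) / 2 * ((F ^+ 2) - (u ^+ 2 + w ^+ 2)) by field.
  by rewrite pmulr_rge0 ?subr_ge0// divr_gt0.
have e2 : F - u = 0 by lra.
have [F0 u0] : F = 0 /\ u = 0 by split; lra.
have w0 : w = 0 by have := q 1 1; have := q 1 (-1); lra.
by rewrite F0 u0 w0; lra.
Qed.

Lemma sum_cumulants_le0 (al be r : R) :
  \sum_(i < K) k i.+1 / i.+1`!%:R * (re_pow al be i.+1 - al ^+ i.+1) * r ^+ i.+1 <= 0.
Proof.
have := mgf_ridge al be r; rewrite !horner_pU -subr_le0 -sumrB.
rewrite (eq_bigr (fun i : 'I_K =>
  k i.+1 / i.+1`!%:R * (re_pow al be i.+1 - al ^+ i.+1) * r ^+ i.+1))// => i _.
by rewrite (re_im_pow_real al i.+1).1 -mulrBl -mulrBr.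
Qed.

End Positive.

End FiniteCumulants.

Lemma top_coef_le0 (R : realFieldType) (q : nat -> R) n :
  (forall r, 0 <= r -> \sum_(i < n.+1) q i * r ^+ i <= 0) -> q n <= 0.
Proof.
move=> qle; rewrite leNgt; apply/negP => qn.
pose C := \sum_(i < n) `|q i|; have C0 : 0 <= C by apply: sumr_ge0.
pose r := 1 + C / q n; have r1 : 1 <= r by rewrite lerDl divr_ge0// ltW.
have := qle r ltac:(lra); rewrite leNgt => /negP; apply.
case: n => [|n] in qle qn C C0 r r1 *.
  by rewrite big_ord_recl big_ord0 expr0 mulr1 addr0.
rewrite big_ord_recr /=.
have lb : - (C * r ^+ n) <= \sum_(i < n.+1) q i * r ^+ i.
  rewrite -[leRHS]opprK lerN2 -sumrN /C mulr_suml; apply: ler_sum => i _.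
  rewrite -mulNr; apply: (@le_trans _ _ (`|q i| * r ^+ i)).
    by rewrite ler_wpM2r ?exprn_ge0 -1?normrN ?ler_norm//; lra.
  by rewrite ler_wpM2l// ler_weXn2l// -ltnS.
apply: lt_le_trans (lerD lb (lexx _)).
rewrite (_ : _ + _ = (q n.+1 * r - C) * r ^+ n); last by rewrite exprS; ring.
rewrite mulr_gt0 ?exprn_gt0//; last by lra.
by rewrite /r mulrDr mulr1 mulrCA divff ?gt_eqF// mulr1; lra.
Qed.

Lemma re_im_pow_cos (R : realType) (t : R) n :
  re_pow (cos t) (sin t) n = cos (n%:R * t) /\ im_pow (cos t) (sin t) n = sin (n%:R * t).
Proof.
elim: n => [|n [IH1 IH2]]; first by rewrite !mul0r cos0 sin0.
rewrite re_powS im_powS IH1 IH2 -natr1 mulrDl mul1r cosD sinD; split; ring.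
Qed.

Lemma cosX_lt1 (R : realType) (t : R) n : 0 < t < pi -> (0 < n)%N -> cos t ^+ n < 1.
Proof.
move=> tpi n0; have s0 := sin_gt0_pi tpi.
have c1 : `|cos t| < 1.
  rewrite -(@ltr_pXn2r _ 2)// ?nnegrE// expr1n real_normK ?num_real//.
  by rewrite cos2sin2 gtrBl exprn_gt0.
apply: le_lt_trans (ler_norm _) _; rewrite normrX.
by rewrite exprn_ilt1// -lt0n.
Qed.

Section Marcinkiewicz.
Context {R : realType}.
Variables (m k : nat -> R).
Hypothesis mk : moment_cumulant m k.
Hypothesis m_pos : positive_moments m.

Let top_cumulant_eq0 n : (3 <= n)%N -> (forall j, (n < j)%N -> k j = 0) -> k n = 0.
Proof.
move=> n3 kn.
(* The inequality along the ray through [exp (i t)] is polynomial in [r] with top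
   coefficient [k n (cos (n t) - cos t ^ n)]; the angles [2 pi / n] and [pi / n],
   with both signs of [r], then leave no room for a nonzero [k n]. *)
have key t (e : bool) : (-1) ^+ (e * n) * (k n * (cos (n%:R * t) - cos t ^+ n)) <= 0.
  pose q j := (-1) ^+ (e * j) * (if j == 0%N then 0 else k j / j`!%:R * (re_pow (cos t) (sin t) j - cos t ^+ j)).
  have : q n <= 0.
    apply: top_coef_le0 => r r0.
    have := sum_cumulants_le0 mk kn m_pos (cos t) (sin t) ((-1) ^+ e * r).
    apply: le_trans; rewrite le_eqVlt; apply/orP; left; apply/eqP.
    rewrite big_ord_recl /q /= mulr0 mul0r add0r.
    rewrite [RHS]big_ord_recr /= kn// !mul0r addr0.
    apply: eq_bigr => i _; rewrite /= /bump add1n exprMn -exprM; ring.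
  rewrite /q; case: eqP => [e0|_]; first by rewrite e0 in n3.
  rewrite (re_im_pow_cos t n).1 => h.
  have -> : (-1) ^+ (e * n) * (k n * (cos (n%:R * t) - cos t ^+ n)) =
    (-1) ^+ (e * n) * (k n / n`!%:R * (cos (n%:R * t) - cos t ^+ n)) * n`!%:R.
    by field; rewrite pnatr_eq0 -lt0n fact_gt0.
  by rewrite mulr_le0_ge0.
have n0 : (0 < n)%N by apply: leq_trans n3.
have nR : 3 <= n%:R :> R by rewrite ler_nat.
have piR : 0 < pi :> R by exact: pi_gt0.
have npi x : n%:R * (x / n%:R) = x :> R by field; rewrite pnatr_eq0 -lt0n.
have k2 (e : bool) : (-1) ^+ (e * n) * k n <= 0.
  have := key (pi *+ 2 / n%:R) e; rewrite npi cos2pi mulrA pmulr_lle0//.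
  rewrite subr_gt0; apply: cosX_lt1 => //; apply/andP; split; first by rewrite divr_gt0 ?ltr0n// mulr2n; lra.
  by rewrite ltr_pdivrMr ?ltr0n// mulr2n; nra.
have kle : k n <= 0 by have := k2 false; rewrite mul0n expr0 mul1r.
apply/eqP; rewrite eq_le kle /=.
have [no|ne] := boolP (odd n).
  by have := k2 true; rewrite mul1n -signr_odd no expr1 mulN1r oppr_le0.
have := key (pi / n%:R) false; rewrite npi cospi mul0n expr0 mul1r.
rewrite nmulr_lle0//; rewrite -opprD oppr_lt0 ltr_pwDl// exprn_even_ge0//.
Qed.

Lemma marcinkiewicz K j : (forall j, (K <= j)%N -> k j = 0) -> (3 <= j)%N -> k j = 0.
Proof.
elim: K => [|K IH] kK j3; first exact: kK.
have [K3|K3] := ltnP K 3; first by apply: kK; exact: leq_trans K3 j3.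
apply: IH => // i; rewrite leq_eqVlt => /orP[/eqP <-|]; last exact: kK.
exact: top_cumulant_eq0.
Qed.

End Marcinkiewicz.

Lemma cvg_ultra (T : Type) (U : topologicalType) (F : set_system T) {FF : ProperFilter F}
    (f : T -> U) (l : U) :
  (forall G : set_system T, UltraFilter G -> F `<=` G -> f @ G --> l) -> f @ F --> l.
Proof.
move=> H A Al; apply: contrapT => nFA.
have wP : ProperFilter (within (~` (f @^-1` A)) F).
  apply: Build_ProperFilter_ex => B; rewrite /within /= => hB.
  apply: contrapT => nB; apply: nFA; apply: filterS hB => x hx; apply: contrapT => nAx.
  by apply: nB; exists x; exact: hx.
have [G [GU sG]] := ultraFilterLemma wP.
have GA : G (f @^-1` A).
  apply: (H G GU _ A Al) => B FB; apply: sG; rewrite /within /=.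
  exact: filterS FB.
have GnA : G (~` (f @^-1` A)) by apply: sG; exact: withinT.
by have [x []] := filter_ex (filterI GA GnA).
Qed.

Lemma ultra_fmap (T U : Type) (f : T -> U) (F : set_system T) :
  UltraFilter F -> UltraFilter (f @ F).
Proof.
move=> FU; split=> [|G GF sG]; first exact: fmap_proper_filter.
rewrite eqEsubset; split=> // A GA.
have [//|FnA] := in_ultra_setVsetC (f @^-1` A) FU.
have GnA : G (~` A) by exact: sG.
by have [x []] := filter_ex (filterI GA GnA).
Qed.

Lemma ultra_bounded_cvg (R : realType) (T : Type) (F : set_system T) (FU : UltraFilter F)
    (f : T -> R) (C : R) :
  (\forall x \near F, `|f x| <= C) -> exists l : R, f @ F --> l.
Proof.
move=> fC; have := @segment_compact R (- C) C; rewrite compact_ultra.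
move=> /(_ (f @ F)); case.
- exact: ultra_fmap.
- by apply: filterS fC => x; rewrite /= in_itv /= ler_norml.
by move=> l [_ fl]; exists l.
Qed.

Lemma cumulant_scale (R : realType) (k : nat -> R) K : exists M : R, [/\ 1 <= M,
  forall j, (0 < j < K)%N -> `|k j| <= M ^+ j &
  M = 1 \/ exists2 j, (0 < j < K)%N & `|k j| = M ^+ j].
Proof.
elim: K => [|K [M [M1 kM Meq]]].
  by exists 1; split=> // [j|]; [rewrite ltn0 andbF|left].
have [K0|K0] := posnP K.
  by exists 1; split=> // [j|]; [rewrite K0; case: j => [|[]]|left].
have [kKM|kKM] := leP `|k K| (M ^+ K).
  exists M; split=> // [j /andP[j0]|].
    by rewrite ltnS leq_eqVlt => /orP[/eqP->//|jK]; apply: kM; rewrite j0.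
  by case: Meq => [|[j /andP[j0 jK]]]; [left|right; exists j => //; rewrite j0 ltnW].
pose M' : R := `|k K| `^ K%:R^-1.
have M'K : M' ^+ K = `|k K|.
  by rewrite -powR_mulrn ?powR_ge0// -powRrM mulVf ?powRr1// pnatr_eq0 -lt0n.
have MM' : M <= M'.
  rewrite ltW// -(@ltr_pXn2r _ K)// ?nnegrE ?powR_ge0//; last by lra.
  by rewrite M'K.
exists M'; split=> [|j /andP[j0]|]; first by lra.
  rewrite ltnS leq_eqVlt => /orP[/eqP->//|jK]; first by rewrite M'K.
  apply: le_trans (kM j _) _; first by rewrite j0.
  by rewrite lerXn2r// nnegrE; lra.
by right; exists K; rewrite ?K0 ?ltnSn.
Qed.

Lemma moment_cumulant_scale (R : realFieldType) (m k : nat -> R) c :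
  moment_cumulant m k -> moment_cumulant (fun j => c ^+ j * m j) (fun j => c ^+ j * k j).
Proof.
case=> m0 mS; split=> [|n]; first by rewrite expr0 mul1r.
rewrite mS mulr_sumr; apply: eq_bigr => j _; rewrite mulrnAr; congr (_ *+ _).
have jn : (j <= n)%N by rewrite -ltnS.
have -> : c ^+ n.+1 = c ^+ j.+1 * c ^+ (n - j) by rewrite -exprD addSn subnKC.
by ring.
Qed.

Lemma positive_moments_scale (R : numDomainType) (m : nat -> R) c :
  positive_moments m -> positive_moments (fun j => c ^+ j * m j).
Proof.
move=> mP N x; have := mP N (fun i => c ^+ i * x i); congr (_ <= _).
apply: eq_bigr => i _; apply: eq_bigr => j _.
by rewrite exprD; ring.
Qed.

Section LimitMoments.
Context {R : realType} {T : Type}.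
Variables (F : set_system T) (FF : ProperFilter F).
Variables (m k : T -> nat -> R) (kl : nat -> R).
Hypothesis mk : forall n, moment_cumulant (m n) (k n).
Hypothesis mP : forall n, positive_moments (m n).
Hypothesis k_cvg : forall j, k n j.+1 @[n --> F] --> kl j.+1.

Lemma limit_moments : exists ml : nat -> R,
  [/\ forall j, m n j @[n --> F] --> ml j, moment_cumulant ml kl & positive_moments ml].
Proof.
have ex j : exists l : R, m n j @[n --> F] --> l.
  elim/ltn_ind: j => -[|j] IH.
    by exists 1; rewrite (_ : (fun n => m n 0%N) = cst 1) ?funeqE; [exact: cvg_cst|move=> n; rewrite (mk n).1].
  have /choice[l lE] : forall i : 'I_j.+1, exists l : R, m n (j - i)%N @[n --> F] --> l.
    by move=> i; apply: IH; rewrite ltnS leq_subr.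
  exists (\sum_(i < j.+1) (kl i.+1 * l i) *+ 'C(j, i)).
  rewrite (_ : (fun n => m n j.+1) =
     (fun n => \sum_(i < j.+1) (k n i.+1 * m n (j - i)%N) *+ 'C(j, i))).
    apply: cvg_sumr => i; apply: cvgMn; apply: cvgM; [exact: k_cvg|exact: lE].
  by apply/funext => n; rewrite (mk n).2.
have [ml mlE] := choice ex; exists ml; split => //.
- split=> [|j].
    apply: (cvg_unique _ (mlE 0%N)) => //.
    by rewrite (_ : (fun n => m n 0%N) = cst 1) ?funeqE; [exact: cvg_cst|move=> n; rewrite (mk n).1].
  apply: (cvg_unique _ (mlE j.+1)) => //.
  rewrite (_ : (fun n => m n j.+1) =
     (fun n => \sum_(i < j.+1) (k n i.+1 * m n (j - i)%N) *+ 'C(j, i))).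
    by apply: cvg_sumr => i; apply: cvgMn; apply: cvgM; [exact: k_cvg|exact: mlE].
  by apply/funext => n; rewrite (mk n).2.
- move=> N x.
  have lim : \sum_(i < N) \sum_(j < N) x i * x j * m n (i + j)%N @[n --> F]
     --> \sum_(i < N) \sum_(j < N) x i * x j * ml (i + j)%N.
    by apply: cvg_sumr => i; apply: cvg_sumr => j; apply: cvgMl_tmp.
  rewrite -(cvg_lim _ lim)//; apply: limr_ge; first by apply/cvg_ex; eexists; exact: lim.
  by apply: nearW => n; exact: mP.
Qed.

End LimitMoments.

Lemma positive_moments_degenerate (R : realFieldType) (m k : nat -> R) :
  moment_cumulant m k -> positive_moments m -> m 1%N = 0 -> m 2 = 0 ->
  forall j, k j.+1 = 0.
Proof.
move=> mk mP m1 m2.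
have m0 j : m j.+1 = 0.
  case: j => [//|[//|j]].
  have q s t : 0 <= s ^+ 2 * m 2 + 2 * s * t * m j.+3 + t ^+ 2 * m (j.+2 + j.+2)%N.
    pose x i := s * (i == 1%N)%:R + t * (i == j.+2)%:R.
    have := mP j.+3 x; congr (_ <= _).
    have col i : \sum_(l < j.+3) x i * x l * m (i + l)%N = x i * s * m (i + 1)%N + x i * t * m (i + j.+2)%N.
      transitivity (\sum_(l < j.+3) ((x i * s * m (i + l)%N) *+ (l == 1%N :> nat) + (x i * t * m (i + l)%N) *+ (l == j.+2 :> nat))).
        by apply: eq_bigr => l _; rewrite /x; do 2 case: (_ == _); rewrite /=; ring.
      rewrite big_split /=; congr (_ + _).
        rewrite (bigD1 (inord 1))//= inordK// mulr1n big1 ?addr0// => l /eqP nl.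
        by case: eqP => // l1; case: nl; apply/val_inj; rewrite /= inordK.
      rewrite (bigD1 ord_max)//= eqxx mulr1n big1 ?addr0// => l /eqP nl.
      by case: eqP => // l1; case: nl; apply/val_inj.
    under eq_bigr do rewrite col.
    transitivity (\sum_(l < j.+3) ((s * s * m (l + 1)%N + s * t * m (l + j.+2)%N) *+ (l == 1%N :> nat)
       + (t * s * m (l + 1)%N + t * t * m (l + j.+2)%N) *+ (l == j.+2 :> nat))).
      by apply: eq_bigr => l _; rewrite /x; do 2 case: (_ == _); rewrite /=; ring.
    rewrite big_split /= (bigD1 (inord 1))//= inordK// mulr1n big1 ?addr0; last first.
      move=> l /eqP nl; case: eqP => // l1; case: nl; apply/val_inj; rewrite /= inordK//.
    rewrite (bigD1 ord_max)//= eqxx mulr1n big1 ?addr0; last first.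
      by move=> l /eqP nl; case: eqP => // l1; case: nl; apply/val_inj.
    by rewrite add1n addn1; ring.
  set M := m (j.+2 + j.+2)%N in q.
  apply/eqP; apply: contraT => mj.
  have := q (- (M + 1) / (2 * m j.+3)) 1; rewrite m2 mulr0 add0r.
  have -> : 2 * (- (M + 1) / (2 * m j.+3)) * 1 * m j.+3 + 1 ^+ 2 * M = -1 by field.
  by rewrite oppr_ge0 leNgt ltr01.
move=> j; have := mk.2 j; rewrite m0 big_ord_recr /= subnn mk.1 mulr1 binn mulr1n.
rewrite big1 ?add0r// => i _.
by have /subnSK <- : (i < j)%N by []; rewrite m0 mulr0 mul0rn.
Qed.

Lemma gaussian_moments (R : realFieldType) (m k : nat -> R) (g : nat -> R) :
  moment_cumulant m k -> k 1%N = 0 -> k 2 = 1 -> (forall j, (3 <= j)%N -> k j = 0) ->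
  g 0%N = 1 -> g 1%N = 0 -> (forall j, g j.+2 = j.+1%:R * g j) ->
  m =1 g.
Proof.
move=> mk k1 k2 k3 g0 g1 gS.
suff H n : m n = g n /\ m n.+1 = g n.+1 by move=> n; have [] := H n.
elim: n => [|n [IH1 IH2]].
  by rewrite mk.1 g0 g1; split=> //; rewrite mk.2 big_ord_recl big_ord0 /= k1 mul0r mul0rn addr0.
split=> //; rewrite mk.2 gS -IH1.
rewrite big_ord_recl big_ord_recl /= k1 mul0r mul0rn add0r big1 ?addr0.
  by rewrite /bump /= addn0 k2 mul1r subn1 bin1 mulr_natl.
by move=> i _; rewrite k3// mul0r mul0rn.
Qed.

Theorem gaussian_moments_cvg (R : realType) (m k : nat -> nat -> R) (K : nat) (g : nat -> R) :
  (forall n, moment_cumulant (m n) (k n)) ->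
  (forall n, positive_moments (m n)) ->
  (forall n, m n 1%N = 0) ->
  m n 2 @[n --> \oo] --> (1 : R) ->
  (forall j, (K <= j)%N -> k n j @[n --> \oo] --> (0 : R)) ->
  g 0%N = 1 -> g 1%N = 0 -> (forall j, g j.+2 = j.+1%:R * g j) ->
  forall j, m n j @[n --> \oo] --> g j.
Proof.
move=> mk mP m1 m2 kK g0 g1 gS j.
(* Along an ultrafilter bounded sequences converge; the cumulants are made
   bounded by the scaling [M n]. *)
apply: cvg_ultra => F FU sF.
have kKF i : (K <= i)%N -> k n i @[n --> F] --> (0 : R).
  by move=> Ki A A0; apply: sF; exact: kK.
have m2F : m n 2 @[n --> F] --> (1 : R) by move=> A A0; apply: sF; exact: m2.
have [M MP] := choice (fun n => cumulant_scale (k n) K).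
have M0 n : 0 < M n by case: (MP n) => M1 _ _; lra.
pose la n := (M n)^-1.
have la01 n : 0 < la n <= 1.
  by case: (MP n) => M1 _ _; rewrite invr_gt0 M0 invf_le1.
pose k' n i := la n ^+ i * k n i.
have k'_cvg i : exists l : R, k' n i.+1 @[n --> F] --> l.
  have [Ki|Ki] := leqP K i.+1.
    exists 0; apply/cvgr0Pnorm_le => e e0.
    have /cvgr0Pnorm_le /(_ e e0) := kKF _ Ki; apply: filterS => n; apply: le_trans.
    have /andP[l0 l1] := la01 n.
    by rewrite /k' normrM ler_piMl// normrX exprn_ile1// ger0_norm// ltW.
  apply: (@ultra_bounded_cvg _ _ _ _ _ 1); apply: nearW => n.
  case: (MP n) => M1 /(_ i.+1 _) kM _.
  rewrite /k' normrM normrX gtr0_norm ?invr_gt0// exprVn ler_pdivrMl ?exprn_gt0// mulr1.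
  by apply: kM.
have [kl klE] := choice k'_cvg.
have [l laE] : exists l : R, la @ F --> l.
  apply: (@ultra_bounded_cvg _ _ _ _ _ 1); apply: nearW => n.
  by have /andP[l0 l1] := la01 n; rewrite ger0_norm// ltW.
have la_pow i : la n ^+ i @[n --> F] --> l ^+ i.
  elim: i => [|i IH].
    by under eq_fun do rewrite expr0; rewrite expr0; exact: cvg_cst.
  by under eq_fun do rewrite exprS; rewrite exprS; exact: cvgM.
(* If [M] were unbounded, the rescaled moments would converge to those of the
   Dirac mass at 0, whose cumulants vanish, while by the choice of [M] one of the
   rescaled cumulants has modulus 1. *)
have l0 : l != 0.
  apply/eqP => l0.
  have [ml [mlE mkl mlP]] := @limit_moments R nat F _ (fun n i => la n ^+ i * m n i) k'
    (fun i => kl i.-1) (fun n => moment_cumulant_scale _ (mk n))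
    (fun n => positive_moments_scale _ (mP n)) klE.
  have ml1 : ml 1%N = 0.
    apply: (cvg_unique _ (mlE 1%N)) => //=; under eq_fun do rewrite m1 mulr0; exact: cvg_cst.
  have ml2 : ml 2 = 0.
    apply: (cvg_unique _ (mlE 2)) => //.
    have -> : 0 = l ^+ 2 * 1 :> R by rewrite l0 expr0n mul0r.
    exact: cvgM.
  have kl0 i : kl i = 0 := positive_moments_degenerate mkl mlP ml1 ml2 i.
  have : \forall n \near F, la n < 1 /\ forall i : 'I_K, `|k' n i.+1| < 1.
    apply: filterI.
      have := laE; rewrite l0 => /cvgr0Pnorm_lt /(_ 1 ltr01).
      by apply: filterS => n; apply: le_lt_trans; exact: ler_norm.
    apply: filter_forall => i.
    by have := klE i; rewrite kl0 => /cvgr0Pnorm_lt /(_ 1 ltr01).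
  move=> /filter_ex[n [la1 k'1]].
  case: (MP n) => M1 _ [Meq|[i /andP[i0 iK] ki]].
    by move: la1; rewrite /la Meq invr1 ltxx.
  have iK' : (i.-1 < K)%N by apply: leq_ltn_trans (leq_pred i) iK.
  have := k'1 (Ordinal iK'); rewrite /= prednK// /k' normrM ki normrX gtr0_norm; last first.
    by rewrite invr_gt0.
  by rewrite exprVn mulVf ?ltxx// expf_neq0// gt_eqF.
have k_cvg i : k n i.+1 @[n --> F] --> kl i / l ^+ i.+1.
  have -> : (fun n => k n i.+1) = (fun n => k' n i.+1 / la n ^+ i.+1).
    apply/funext => n; rewrite /k' mulrC mulKf// expf_neq0//.
    by have /andP[/gt_eqF ->] := la01 n.
  apply: cvgM; first exact: klE.
  by apply: cvgV; [rewrite expf_neq0|exact: la_pow].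
have [ml [mlE mkl mlP]] := @limit_moments R nat F _ m k
    (fun i => kl i.-1 / l ^+ i) mk mP k_cvg.
have ml1 : ml 1%N = 0.
  apply: (cvg_unique _ (mlE 1%N)) => //=; under eq_fun do rewrite m1; exact: cvg_cst.
have ml2 : ml 2 = 1 by apply: (cvg_unique _ (mlE 2)).
have klK i : (maxn K 1 <= i)%N -> kl i.-1 / l ^+ i = 0.
  rewrite geq_max => /andP[Ki i0].
  apply: (cvg_unique _ _ (kKF i Ki)) => //.
  by case: i {Ki} i0 => // i _; exact: k_cvg.
have kl3 := marcinkiewicz mkl mlP klK.
have kl1 : kl 0%N / l ^+ 1 = 0.
  by have := mkl.2 0%N; rewrite ml1 big_ord_recl big_ord0 /= mkl.1 mulr1 bin0 mulr1n addr0.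
have kl2 : kl 1%N / l ^+ 2 = 1.
  have := mkl.2 1%N; rewrite ml2 !big_ord_recl big_ord0 /= /bump /= mkl.1 ml1.
  by rewrite mulr0 mul0rn add0r mulr1 addr0.
rewrite -(gaussian_moments mkl kl1 kl2 _ g0 g1 gS)//.
Qed.

(** * From moments to weak convergence *)

Section CosTaylor.
Context {R : realType}.

Definition cos_taylor (n : nat) (th : R) : {poly R} :=
  \poly_(k < n) (cos (th + k%:R * (pi / 2)) / k`!%:R).

Lemma deriv_cos_taylor n th : (cos_taylor n.+1 th)^`() = cos_taylor n (th + pi / 2).
Proof.
apply/polyP => i; rewrite coef_deriv !coef_poly ltnS; case: ltnP => _; last by rewrite mul0rn.
rewrite -addrA -{2}[pi / 2]mul1r -mulrDl [1 + _]addrC natr1 -[LHS]mulr_natr.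
rewrite factS natrM.
have f0 : i`!%:R != 0 :> R by rewrite pnatr_eq0 -lt0n fact_gt0.
have n0 : i.+1%:R != 0 :> R by rewrite pnatr_eq0.
by move: (cos (th + i.+1%:R * (pi / 2))) (i.+1%:R : R) (i`!%:R : R) n0 f0 => c a b a0 b0; field; rewrite b0 a0.
Qed.

Let cos_taylor_pos n th x : 0 <= x ->
  `|cos (th + x) - (cos_taylor n th).[x]| <= x ^+ n / n`!%:R.
Proof.
elim: n th x => [|n IH] th x x0.
  by rewrite /cos_taylor poly_def big_ord0 horner0 subr0 fact0 expr0 divr1 cos_max.
have main (e : R) : `|e| = 1 -> e * (cos (th + x) - (cos_taylor n.+1 th).[x]) <= x ^+ n.+1 / n.+1`!%:R.
  move=> e1.
  pose G y := y ^+ n.+1 / n.+1`!%:R - e * (cos (th + y) - (cos_taylor n.+1 th).[y]).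
  have dG y : is_derive y (1 : R) G (y ^+ n / n`!%:R - e * (cos (th + pi / 2 + y) - (cos_taylor n (th + pi / 2)).[y])).
    have d1 : is_derive y (1 : R) (fun y => cos (th + y)) (cos (th + pi / 2 + y)).
      have -> : cos (th + pi / 2 + y) = - sin (th + y) * 1.
        by rewrite mulr1 -addrA (addrC (pi / 2)) addrA cosDpihalf.
      apply: (@is_derive1_comp _ cos (fun y => th + y)).
      have -> : (fun y => th + y) = cst th + id by [].
      by apply: is_derive_eq; rewrite add0r.
    have d2 := is_derive_poly (cos_taylor n.+1 th) y; rewrite deriv_cos_taylor in d2.
    have -> : G = (n.+1`!%:R^-1 *: (id ^+ n.+1)) - e *: ((fun y => cos (th + y)) - horner (cos_taylor n.+1 th)).
      by apply/funext => z; rewrite /G /= mulrC /GRing.scale /= !fctE.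
    apply: is_derive_eq.
    rewrite /GRing.scale /= mulr1; congr (_ - _).
    rewrite factS natrM invfM -mulr_natr.
    have f0 : n`!%:R != 0 :> R by rewrite pnatr_eq0 -lt0n fact_gt0.
    have n0 : n.+1%:R != 0 :> R by rewrite pnatr_eq0.
    by move: (n.+1%:R : R) (n`!%:R : R) n0 f0 => a b a0 b0; field; rewrite b0 a0.
  have G0 : G 0 = 0.
    rewrite /G expr0n mul0r add0r addr0 horner_coef0 coef_poly /= mul0r addr0 divr1 subrr mulr0.
    by rewrite oppr0.
  have : G 0 <= G x.
    apply: (@ger0_derive1_ndecry _ G 0) => //.
    - move=> y; rewrite in_itv /= andbT => y0; rewrite derive1E (@derive_val _ _ _ _ _ _ _ (dG y)) subr_ge0.
      by apply: le_trans (ler_norm _) _; rewrite normrM e1 mul1r IH// ltW.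
    - by apply: continuous_subspaceT => y; apply/differentiable_continuous/derivable1_diffP; have dy := dG y; exact: (@ex_derive _ _ _ _ _ _ _ dy).
  by rewrite G0 subr_ge0.
rewrite ler_norml; apply/andP; split.
  by rewrite lerNl -mulN1r main// normrN1.
by rewrite -[leLHS]mul1r main// normr1.
Qed.

Lemma cos_taylor_le n th x :
  `|cos (th + x) - (cos_taylor n th).[x]| <= `|x| ^+ n / n`!%:R.
Proof.
have [x0|x0] := leP 0 x; first by rewrite [in leRHS](ger0_norm x0); exact: cos_taylor_pos.
have := @cos_taylor_pos n (- th) (- x); rewrite -opprD cosN => /(_ ltac:(lra)).
rewrite (ltr0_norm x0).
congr (`|_ - _| <= _); rewrite !horner_poly; apply: eq_bigr => k _.
rewrite -cosN opprD opprK exprNn.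
have -> : cos (th - k%:R * (pi / 2)) = (-1) ^+ k * cos (th + k%:R * (pi / 2)).
  elim: (nat_of_ord k) (th) => [|i IH] t; first by rewrite mul0r subr0 addr0 expr0 mul1r.
  have -> : t - i.+1%:R * (pi / 2) = (t - pi / 2) - i%:R * (pi / 2) by rewrite -natr1; ring.
  rewrite IH exprS.
  have -> : t + i.+1%:R * (pi / 2) = (t - pi / 2 + i%:R * (pi / 2)) + pi.
    by rewrite -natr1; field.
  by rewrite cosDpi; ring.
have -> : (-1 : R) ^+ k * cos (th + k%:R * (pi / 2)) / k`!%:R * ((-1) ^+ k * x ^+ k)
  = ((-1) ^+ k * (-1) ^+ k) * (cos (th + k%:R * (pi / 2)) / k`!%:R * x ^+ k) by ring.
by rewrite -exprMn mulrNN mulr1 expr1n mul1r.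
Qed.

End CosTaylor.

Section Bernstein.
Context {R : realType}.

Definition bernstein_sum (n : nat) (x : R) (phi : nat -> R) :=
  \sum_(k < n.+1) (phi k * x ^+ k * (1 - x) ^+ (n - k)) *+ 'C(n, k).

Lemma bernstein_sumS n x phi : bernstein_sum n.+1 x phi =
  (1 - x) * bernstein_sum n x phi + x * bernstein_sum n x (phi \o S).
Proof.
rewrite /bernstein_sum (sum_binS (fun k => phi k * x ^+ k * (1 - x) ^+ (n.+1 - k))).
rewrite !mulr_sumr -big_split; apply: eq_bigr => k _ /=.
rewrite subSS subSn -1?ltnS// !mulrnAr -mulrnDl; congr (_ *+ _).
by rewrite !exprS; ring.
Qed.

Lemma bernstein_sumD n x phi psi : bernstein_sum n x (fun k => phi k + psi k) =
  bernstein_sum n x phi + bernstein_sum n x psi.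
Proof. by rewrite -big_split; apply: eq_bigr => k _ /=; rewrite -mulrnDl -!mulrDl. Qed.

Lemma bernstein_sumZ n x c phi : bernstein_sum n x (fun k => c * phi k) =
  c * bernstein_sum n x phi.
Proof. by rewrite mulr_sumr; apply: eq_bigr => k _; rewrite mulrnAr !mulrA. Qed.

Lemma bernstein_sum1 n x : bernstein_sum n x (fun=> 1) = 1.
Proof.
elim: n => [|n IH]; last by rewrite bernstein_sumS /comp IH; ring.
by rewrite /bernstein_sum big_ord_recl big_ord0 bin0 /= !expr0 ?expr0; ring.
Qed.

Lemma bernstein_sum_mean n x : bernstein_sum n x (fun k => k%:R - n%:R * x) = 0.
Proof.
elim: n => [|n IH].
  by rewrite /bernstein_sum big_ord_recl big_ord0 bin0 /= !expr0 ?expr0; ring.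
rewrite bernstein_sumS.
have e c : bernstein_sum n x (fun k => (k%:R - n%:R * x) + c) = c.
  rewrite bernstein_sumD IH add0r -[in LHS](mulr1 c).
  by rewrite (bernstein_sumZ n x c (fun=> 1)) bernstein_sum1 mulr1.
rewrite [X in _ * X](_ : _ = - x); last first.
  by rewrite -[RHS]e; congr bernstein_sum; apply/funext => k; rewrite -natr1; ring.
rewrite [X in _ + _ * X](_ : _ = 1 - x); last first.
  by rewrite -[RHS]e; congr bernstein_sum; apply/funext => k; rewrite /= -!natr1; ring.
by ring.
Qed.

Lemma bernstein_sum_var n x :
  bernstein_sum n x (fun k => (k%:R - n%:R * x) ^+ 2) = n%:R * (x * (1 - x)).
Proof.
elim: n => [|n IH].
  by rewrite /bernstein_sum big_ord_recl big_ord0 bin0 /= !expr0 ?expr0; ring.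
rewrite bernstein_sumS.
have e c : bernstein_sum n x (fun k => (k%:R - n%:R * x + c) ^+ 2) = n%:R * (x * (1 - x)) + c ^+ 2.
  transitivity (bernstein_sum n x (fun k => (k%:R - n%:R * x) ^+ 2
      + (2 * c * (k%:R - n%:R * x) + c ^+ 2 * 1))).
    by congr bernstein_sum; apply/funext => k; ring.
  by rewrite !bernstein_sumD !bernstein_sumZ IH bernstein_sum_mean bernstein_sum1; ring.
rewrite [X in _ * X](_ : _ = n%:R * (x * (1 - x)) + (- x) ^+ 2); last first.
  by rewrite -e; congr bernstein_sum; apply/funext => k; rewrite -natr1; ring.
rewrite [X in _ + _ * X](_ : _ = n%:R * (x * (1 - x)) + (1 - x) ^+ 2); last first.
  by rewrite -e; congr bernstein_sum; apply/funext => k; rewrite /= -!natr1; ring.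
by rewrite -natr1; ring.
Qed.

Lemma norm_bernstein_sum_le n x phi psi : 0 <= x <= 1 ->
  (forall k, (k <= n)%N -> `|phi k| <= psi k) ->
  `|bernstein_sum n x phi| <= bernstein_sum n x psi.
Proof.
move=> x01 le; have /andP[x0 x1] := x01.
apply: le_trans (ler_norm_sum _ _ _) _; apply: ler_sum => k _.
rewrite normrMn lerMn2r; apply/orP; right.
rewrite !normrM !normrX (ger0_norm x0) (ger0_norm (_ : 0 <= 1 - x)) ?subr_ge0//.
by do 2 (rewrite ler_wpM2r ?exprn_ge0 ?subr_ge0//); rewrite le// -ltnS.
Qed.

Lemma horner_bernstein n phi : exists p : {poly R}, forall x, p.[x] = bernstein_sum n x phi.
Proof.
exists (\sum_(k < n.+1) ((phi k)%:P * 'X ^+ k * (1 - 'X) ^+ (n - k)) *+ 'C(n, k)) => x.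
by rewrite horner_sum; apply: eq_bigr => k _; rewrite hornerMn !hornerE.
Qed.

Lemma continuous_unif_segment (f : R -> R) a b : continuous f ->
  forall e, 0 < e -> exists2 d, 0 < d &
    forall x u, a <= x <= b -> `|u - x| < d -> `|f u - f x| <= e.
Proof.
move=> cf e e0.
have /compact_near_coveringP cov := @segment_compact R a b.
have h : \forall d \near 0^'+, `[a, b] `<=`
    [set x | forall u, `|u - x| < d -> `|f u - f x| <= e].
  apply: (cov R (0^'+) (fun d x => forall u, `|u - x| < d -> `|f u - f x| <= e)) => x _.
  have /cvgrPdist_lt /(_ (e / 2) ltac:(lra)) [r /= r0 fr] := cf x.
  near=> x' d => u ux'.
  have xx' : `|x - x'| < r / 2.
    by near: x'; exists (r / 2); rewrite //= divr_gt0.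
  have dr : d <= r / 2.
    by near: d; apply: nbhs_right_le; rewrite divr_gt0.
  have f1 : `|f x - f x'| < e / 2 by apply: fr => /=; lra.
  have f2 : `|f x - f u| < e / 2.
    apply: fr => /=; have -> : x - u = (x - x') - (u - x') by ring.
    apply: le_lt_trans (ler_normB _ _) _; rewrite (splitr r) ltrD//; exact: lt_le_trans ux' dr.
  have -> : f u - f x' = (f x - f x') - (f x - f u) by ring.
  by apply: le_trans (ler_normB _ _) _; lra.
have [d [d0 dh]] := filter_ex (filterI (nbhs_right_gt (0 : R)) h).
by exists d => // x u xab; apply: dh; rewrite /= in_itv.
Unshelve. all: by end_near. Qed.

Theorem weierstrass (f : R -> R) : continuous f ->
  forall e, 0 < e -> exists p : {poly R}, forall x, 0 <= x <= 1 -> `|f x - p.[x]| <= e.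
Proof.
move=> cf e e0.
have [d d0 fd] := @continuous_unif_segment f 0 1 cf (e / 2) ltac:(lra).
have [M fM] : exists M, forall x, 0 <= x <= 1 -> `|f x| <= M.
  have f01 : {within `[0, 1], continuous f} by exact: continuous_subspaceT.
  have [c1 _ f1] := EVT_max ler01 f01; have [c2 _ f2] := EVT_min ler01 f01.
  exists (`|f c1| + `|f c2|) => x x01; rewrite ler_norml.
  have := f1 x x01; have := f2 x x01.
  have := ler_norm (f c1); have := ler_norm (- f c2); rewrite normrN => *.
  have ? := normr_ge0 (f c1); have ? := normr_ge0 (f c2).
  by apply/andP; split; lra.
have M0 : 0 <= M by apply: le_trans (fM 0 _) => //; rewrite lexx ler01.
pose n := (Num.truncn (M / (e * d ^+ 2))).+1.
have nM : M / (e * d ^+ 2) <= n%:R by rewrite ltW// truncnS_gt.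
have n0 : 0 < n%:R :> R by rewrite ltr0n.
have [p pE] := horner_bernstein n (fun k => f (k%:R / n%:R)).
exists p => x x01; rewrite pE.
have -> : f x - bernstein_sum n x (fun k => f (k%:R / n%:R))
  = bernstein_sum n x (fun k => f x * 1 + -1 * f (k%:R / n%:R)).
  by rewrite bernstein_sumD !bernstein_sumZ bernstein_sum1; ring.
apply: le_trans (@norm_bernstein_sum_le _ _ _
   (fun k => e / 2 * 1 + 2 * M / (n%:R * d) ^+ 2 * (k%:R - n%:R * x) ^+ 2) x01 _) _.
  move=> k kn; rewrite mulr1 mulN1r.
  have k01 : 0 <= (k%:R / n%:R : R) <= 1.
    by apply/andP; split; [rewrite divr_ge0|rewrite ler_pdivrMr// mul1r ler_nat].
  have nd0 : 0 < n%:R * d by rewrite mulr_gt0.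
  have dE : k%:R / n%:R - x = (k%:R - n%:R * x) / n%:R by field; rewrite gt_eqF.
  have [kd|kd] := ltP `|k%:R / n%:R - x| d.
    rewrite mulr1 distrC (le_trans (fd _ _ x01 kd))// lerDl.
    by rewrite mulr_ge0 ?sqr_ge0// divr_ge0 ?sqr_ge0// mulr_ge0.
  apply: (@le_trans _ _ (2 * M)).
    by apply: le_trans (ler_normB _ _) _; have := fM _ x01; have := fM _ k01; lra.
  rewrite -[leLHS]add0r mulr1 lerD//; first by lra.
  rewrite -mulrA ler_peMr ?mulr_ge0// mulrC ler_pdivlMr ?exprn_gt0// mul1r.
  rewrite -(real_normK (num_real (_ - _))) lerXn2r ?nnegrE//; first by rewrite ltW.
  move: kd; rewrite dE normrM normfV normr_nat ler_pdivlMr//.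
  by rewrite mulrC.
rewrite bernstein_sumD !bernstein_sumZ bernstein_sum1 bernstein_sum_var mulr1.
have /andP[x0 x1] := x01.
have xx : x * (1 - x) <= 1 / 4.
  rewrite -subr_ge0; have -> : 1 / 4 - x * (1 - x) = (x - 1 / 2) ^+ 2 by field.
  exact: sqr_ge0.
have : 2 * M / (n%:R * d) ^+ 2 * (n%:R * (x * (1 - x))) <= e / 2; last by lra.
apply: (@le_trans _ _ (2 * M / (n%:R * d) ^+ 2 * (n%:R * (1 / 4)))).
  rewrite ler_wpM2l ?divr_ge0 ?sqr_ge0 ?mulr_ge0// ler_wpM2l//.
have -> : 2 * M / (n%:R * d) ^+ 2 * (n%:R * (1 / 4)) = M / d ^+ 2 / n%:R / 2.
  by field; rewrite !gt_eqF.
rewrite ler_pM2r// ler_pdivrMr//.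
move: nM; rewrite ler_pdivrMr ?mulr_gt0 ?exprn_gt0// => nM.
by rewrite ler_pdivrMr ?exprn_gt0// (le_trans nM)// mulrA (mulrC e).
Qed.

End Bernstein.

Section Mean.
Context d (T : measurableType d) (R : realType) (P : probability T R).
Implicit Types f g : T -> R.

Definition mean f : R := \int[P]_t f t.
Definition in_L1 f : Prop := P.-integrable setT (EFin \o f).

Lemma expectation_mean f : in_L1 f -> ('E_P[f] = (mean f)%:E)%E.
Proof. by move=> fi; rewrite unlock fineK//; exact: integrable_fin_num. Qed.

Lemma in_L1_measurable f : in_L1 f -> measurable_fun setT f.
Proof. by move=> /measurable_int/measurable_EFinP. Qed.

Lemma in_L1_bounded f M : measurable_fun setT f -> (forall t, `|f t| <= M) -> in_L1 f.
Proof.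
move=> mf fM; apply: measurable_bounded_integrable => //.
  by rewrite (le_lt_trans (probability_le1 _ _))// ltry.
by exists M; split; [exact: num_real|move=> x Mx t _; apply: le_trans (fM t) (ltW Mx)].
Qed.

Lemma in_L1_cst c : in_L1 (fun=> c).
Proof. by apply: (@in_L1_bounded _ `|c|) => // t. Qed.

Lemma in_L1_le f g : measurable_fun setT f -> (forall t, `|f t| <= g t) -> in_L1 g -> in_L1 f.
Proof.
move=> mf fg; apply: le_integrable => //; first exact/measurable_EFinP.
by move=> t _; rewrite /= lee_fin (le_trans (fg t))// ler_norm.
Qed.

Lemma in_L1D f g : in_L1 f -> in_L1 g -> in_L1 (fun t => f t + g t).
Proof. by move=> fi gi; have := integrableD measurableT fi gi; apply: eq_integrable. Qed.

Lemma in_L1B f g : in_L1 f -> in_L1 g -> in_L1 (fun t => f t - g t).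
Proof. by move=> fi gi; have := integrableB measurableT fi gi; apply: eq_integrable. Qed.

Lemma in_L1Z c f : in_L1 f -> in_L1 (fun t => c * f t).
Proof. by move=> fi; have := integrableZl measurableT c fi; apply: eq_integrable. Qed.

Lemma in_L1_norm f : in_L1 f -> in_L1 (fun t => `|f t|).
Proof. by move=> /integrable_norm. Qed.

Lemma in_L1_sum_in (I : eqType) (r : seq I) (F : I -> T -> R) :
  (forall i, i \in r -> in_L1 (F i)) -> in_L1 (fun t => \sum_(i <- r) F i t).
Proof.
elim: r => [|i r IH] Fi.
  by under [X in in_L1 X]funext do rewrite big_nil; exact: in_L1_cst.
under [X in in_L1 X]funext do rewrite big_cons; apply: in_L1D.
  by apply: Fi; rewrite mem_head.
by apply: IH => j jr; apply: Fi; rewrite in_cons jr orbT.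
Qed.

Lemma in_L1_sum (I : Type) (r : seq I) (F : I -> T -> R) :
  (forall i, in_L1 (F i)) -> in_L1 (fun t => \sum_(i <- r) F i t).
Proof.
move=> Fi; elim: r => [|i r IH].
  by under [X in in_L1 X]funext do rewrite big_nil; exact: in_L1_cst.
by under [X in in_L1 X]funext do rewrite big_cons; exact: in_L1D.
Qed.

Lemma mean_cst c : mean (fun=> c) = c.
Proof.
rewrite /mean Rintegral_cst//; transitivity (c * fine (1%E : \bar R)); last exact: mulr1.
by congr (_ * fine _); exact: probability_setT.
Qed.

Lemma meanD f g : in_L1 f -> in_L1 g -> mean (fun t => f t + g t) = mean f + mean g.
Proof. by move=> fi gi; rewrite /mean RintegralD. Qed.

Lemma meanB f g : in_L1 f -> in_L1 g -> mean (fun t => f t - g t) = mean f - mean g.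
Proof. by move=> fi gi; rewrite /mean RintegralB. Qed.

Lemma meanZ c f : in_L1 f -> mean (fun t => c * f t) = c * mean f.
Proof. by move=> fi; rewrite /mean RintegralZl. Qed.

Lemma mean_sum (I : Type) (r : seq I) (F : I -> T -> R) :
  (forall i, in_L1 (F i)) -> mean (fun t => \sum_(i <- r) F i t) = \sum_(i <- r) mean (F i).
Proof.
move=> Fi; elim: r => [|i r IH].
  by under [X in mean X]funext do rewrite big_nil; rewrite big_nil mean_cst.
under [X in mean X]funext do rewrite big_cons.
by rewrite big_cons meanD// ?IH//; exact: in_L1_sum.
Qed.

Lemma mean_sum_in (I : eqType) (r : seq I) (F : I -> T -> R) :
  (forall i, i \in r -> in_L1 (F i)) ->
  mean (fun t => \sum_(i <- r) F i t) = \sum_(i <- r) mean (F i).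
Proof.
elim: r => [|i r IH] Fi.
  by under [X in mean X]funext do rewrite big_nil; rewrite big_nil mean_cst.
under [X in mean X]funext do rewrite big_cons.
have Fr j : j \in r -> in_L1 (F j) by move=> jr; apply: Fi; rewrite in_cons jr orbT.
rewrite big_cons meanD ?IH//; last exact: in_L1_sum_in.
by apply: Fi; rewrite mem_head.
Qed.

Lemma mean_le f g : in_L1 f -> in_L1 g -> (forall t, f t <= g t) -> mean f <= mean g.
Proof. by move=> fi gi fg; apply: le_Rintegral. Qed.

Lemma mean_ge0 f : (forall t, 0 <= f t) -> 0 <= mean f.
Proof. by move=> f0; apply: Rintegral_ge0. Qed.

Lemma norm_mean_le f g : in_L1 f -> in_L1 g -> (forall t, `|f t| <= g t) -> `|mean f| <= mean g.
Proof.
move=> fi gi fg; apply: (@le_trans _ _ (mean (fun t => `|f t|))).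
  exact: le_normr_Rintegral.
by apply: mean_le => //; exact: in_L1_norm.
Qed.

Lemma mean_indic (A : set T) : measurable A -> mean (\1_A) = fine (P A).
Proof. by move=> mA; rewrite /mean /Rintegral integral_indic// setIT. Qed.

End Mean.

Section MethodOfMoments.
Context d (T : measurableType d) (R : realType) (P : probability T R).
Context d' (T' : measurableType d') (Q : probability T' R).
Variables (Y : nat -> T -> R) (Z : T' -> R).

Section Cos.
Hypothesis Y_L1 : forall n k, in_L1 P (fun t => Y n t ^+ k).
Hypothesis Z_L1 : forall k, in_L1 Q (fun t => Z t ^+ k).
Hypothesis YZ : forall k, mean P (fun t => Y n t ^+ k) @[n --> \oo] --> mean Q (fun t => Z t ^+ k).
Hypothesis Z_det : forall a : R,
  a ^+ N.*2 / N.*2`!%:R * mean Q (fun t => Z t ^+ N.*2) @[N --> \oo] --> (0 : R).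

Lemma mean_cos_taylor_le d0 (T0 : measurableType d0) (P0 : probability T0 R) (Y0 : T0 -> R) a b N :
  (forall k, in_L1 P0 (fun t => Y0 t ^+ k)) ->
  in_L1 P0 (fun t => cos (a * Y0 t + b)) /\
  `|mean P0 (fun t => cos (a * Y0 t + b)) -
     \sum_(k < N.*2) (cos_taylor N.*2 b)`_k * a ^+ k * mean P0 (fun t => Y0 t ^+ k)|
  <= a ^+ N.*2 / N.*2`!%:R * mean P0 (fun t => Y0 t ^+ N.*2).
Proof.
move=> YL.
have mY : measurable_fun setT Y0.
  by have := in_L1_measurable (YL 1%N); under eq_fun do rewrite expr1.
have cL : in_L1 P0 (fun t => cos (a * Y0 t + b)).
  apply: (@in_L1_bounded _ _ _ _ _ 1); last by move=> t; exact: cos_max.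
  apply: (measurableT_comp (f := cos)).
    by apply: continuous_measurable_fun; exact: continuous_cos.
  by apply: measurable_funD => //; apply: measurable_funM.
split=> //.
have pL k : in_L1 P0 (fun t => (cos_taylor N.*2 b)`_k * a ^+ k * Y0 t ^+ k) by apply: in_L1Z.
rewrite -meanZ//.
have -> : \sum_(k < N.*2) (cos_taylor N.*2 b)`_k * a ^+ k * mean P0 (fun t => Y0 t ^+ k)
   = mean P0 (fun t => \sum_(k < N.*2) (cos_taylor N.*2 b)`_k * a ^+ k * Y0 t ^+ k).
  rewrite (@mean_sum _ _ _ P0 _ _ (fun (k : 'I_N.*2) t => (cos_taylor N.*2 b)`_k * a ^+ k * Y0 t ^+ k))//.
  by apply: eq_bigr => k _; rewrite meanZ.
rewrite -meanB//; last by apply: (@in_L1_sum _ _ _ P0 _ _ (fun (k : 'I_N.*2) t => (cos_taylor N.*2 b)`_k * a ^+ k * Y0 t ^+ k)).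
apply: norm_mean_le.
- by apply: in_L1B => //; apply: (@in_L1_sum _ _ _ P0 _ _ (fun (k : 'I_N.*2) t => (cos_taylor N.*2 b)`_k * a ^+ k * Y0 t ^+ k)).
- exact: in_L1Z.
move=> t; have := cos_taylor_le N.*2 b (a * Y0 t).
have -> : (cos_taylor N.*2 b).[a * Y0 t] =
    \sum_(k < N.*2) (cos_taylor N.*2 b)`_k * a ^+ k * Y0 t ^+ k.
  rewrite (horner_coef_wide _ (size_poly _ _)).
  by apply: eq_bigr => k _; rewrite exprMn mulrA.
rewrite (addrC b) => /le_trans; apply; rewrite mulrAC -exprMn.
by rewrite -normrX ger0_norm// -muln2 mulnC exprM exprn_ge0// sqr_ge0.
Qed.

Lemma mean_cos_cvg a b : mean P (fun t => cos (a * Y n t + b)) @[n --> \oo] -->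
  mean Q (fun t => cos (a * Z t + b)).
Proof.
apply/cvgrPdist_le => e e0.
have e4 : 0 < e / 4 by lra.
have /cvgr0Pnorm_le /(_ _ e4) /filter_ex[N ZN] := Z_det a.
have lim1 : a ^+ N.*2 / N.*2`!%:R * mean P (fun t => Y n t ^+ N.*2) @[n --> \oo] -->
   a ^+ N.*2 / N.*2`!%:R * mean Q (fun t => Z t ^+ N.*2) by apply: cvgMl_tmp.
have lim2 : \sum_(k < N.*2) (cos_taylor N.*2 b)`_k * a ^+ k * mean P (fun t => Y n t ^+ k) @[n --> \oo] -->
   \sum_(k < N.*2) (cos_taylor N.*2 b)`_k * a ^+ k * mean Q (fun t => Z t ^+ k).
  by apply: cvg_sumr => k; apply: cvgMl_tmp.
have [_ Zb] := mean_cos_taylor_le a b N Z_L1.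
near=> n.
have [_ Yb] := mean_cos_taylor_le a b N (Y_L1 n).
have l1 : `|a ^+ N.*2 / N.*2`!%:R * mean Q (fun t => Z t ^+ N.*2) -
   a ^+ N.*2 / N.*2`!%:R * mean P (fun t => Y n t ^+ N.*2)| <= e / 4.
  by near: n; move/cvgrPdist_le : lim1; apply.
have l2 : `|\sum_(k < N.*2) (cos_taylor N.*2 b)`_k * a ^+ k * mean Q (fun t => Z t ^+ k) -
  \sum_(k < N.*2) (cos_taylor N.*2 b)`_k * a ^+ k * mean P (fun t => Y n t ^+ k)| <= e / 4.
  by near: n; move/cvgrPdist_le : lim2; apply.
move: l1 l2 ZN Zb Yb; rewrite !ler_norml => /andP[? ?] /andP[? ?] /andP[? ?] /andP[? ?] /andP[? ?].
by apply/andP; split; lra.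
Unshelve. all: by end_near. Qed.

End Cos.

Section Weak.
Hypothesis mY : forall n, measurable_fun setT (Y n).
Hypothesis mZ : measurable_fun setT Z.
Variable C : R.
Hypothesis Y2 : \forall n \near \oo, in_L1 P (fun t => Y n t ^+ 2) /\ mean P (fun t => Y n t ^+ 2) <= C.
Hypothesis Z2 : in_L1 Q (fun t => Z t ^+ 2) /\ mean Q (fun t => Z t ^+ 2) <= C.
Hypothesis cosYZ : forall a b,
  mean P (fun t => cos (a * Y n t + b)) @[n --> \oo] --> mean Q (fun t => cos (a * Z t + b)).

Let good (h : R -> R) := [/\ measurable_fun setT h, exists M, forall x, `|h x| <= M &
  mean P (h \o Y n) @[n --> \oo] --> mean Q (h \o Z)].

Let good_L1 h : good h -> (forall n, in_L1 P (h \o Y n)) /\ in_L1 Q (h \o Z).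
Proof.
move=> [mh [M hM] _]; split=> [n|].
  by apply: (@in_L1_bounded _ _ _ _ _ M) => [|t]; [exact: measurableT_comp|exact: hM].
by apply: (@in_L1_bounded _ _ _ _ _ M) => [|t]; [exact: measurableT_comp|exact: hM].
Qed.

Let good_add h1 h2 : good h1 -> good h2 -> good (fun x => h1 x + h2 x).
Proof.
move=> g1 g2; have [Y1 Z1] := good_L1 g1; have [Y2' Z2'] := good_L1 g2.
have [m1 [M1 b1] c1] := g1; have [m2 [M2 b2] c2] := g2; split.
- exact: measurable_funD.
- by exists (M1 + M2) => x; apply: le_trans (ler_normD _ _) (lerD _ _).
- rewrite [X in X @ _ --> _](_ : _ = (fun n => mean P (h1 \o Y n) + mean P (h2 \o Y n))).
    by rewrite [X in _ --> X](meanD Z1 Z2'); exact: cvgD.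
  by apply/funext => n; exact: (meanD (Y1 n) (Y2' n)).
Qed.

Let good_scale c h : good h -> good (fun x => c * h x).
Proof.
move=> g; have [Y1 Z1] := good_L1 g; have [m1 [M b] cv] := g; split.
- exact: measurable_funM.
- by exists (`|c| * M) => x; rewrite normrM ler_wpM2l.
- rewrite [X in X @ _ --> _](_ : _ = (fun n => c * mean P (h \o Y n))).
    by rewrite [X in _ --> X](meanZ _ Z1); exact: cvgMl_tmp.
  by apply/funext => n; exact: (meanZ _ (Y1 n)).
Qed.

Let good_cos a b : good (fun x => cos (a * x + b)).
Proof.
split; last exact: cosYZ.
  apply: continuous_measurable_fun => x; apply: continuous_comp; last exact: continuous_cos.
  by apply: cvgD; [apply: cvgMl_tmp; exact: cvg_id|exact: cvg_cst].
by exists 1 => x; exact: cos_max.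
Qed.

Let good_sin_cos al i a b : good (fun x => sin (al * x) ^+ i * cos (a * x + b)).
Proof.
elim: i a b => [|i IH] a b.
  by under [X in good X]funext do rewrite expr0 mul1r; exact: good_cos.
have -> : (fun x => sin (al * x) ^+ i.+1 * cos (a * x + b)) =
  (fun x => 1 / 2 * (sin (al * x) ^+ i * cos ((al + a) * x + (b - pi / 2)))
    + 1 / 2 * (sin (al * x) ^+ i * cos ((al - a) * x + (- b - pi / 2)))).
  apply/funext => x; rewrite exprSr.
  rewrite !addrA !cosBpihalf.
  have -> : (al + a) * x + b = al * x + (a * x + b) by ring.
  have -> : (al - a) * x - b = al * x - (a * x + b) by ring.
  by rewrite sinD sinB; field.
by apply: good_add; apply: good_scale; exact: IH.
Qed.

Let good_poly_sin al (p : {poly R}) : good (fun x => p.[sin (al * x)]).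
Proof.
have -> : (fun x => p.[sin (al * x)]) = (fun x => \sum_(i < size p) p`_i * (sin (al * x) ^+ i * cos (0 * x + 0))).
  apply/funext => x; rewrite horner_coef; apply: eq_bigr => i _.
  by rewrite mul0r addr0 cos0 mulr1.
elim: (size p) => [|n IH].
  have -> : (fun x => \sum_(i < 0) p`_i * (sin (al * x) ^+ i * cos (0 * x + 0))) =
      (fun x => 0 * (sin (al * x) ^+ 0 * cos (0 * x + 0))).
    by apply/funext => x; rewrite big_ord0 mul0r.
  by apply: good_scale; exact: good_sin_cos.
under [X in good X]funext do rewrite big_ord_recr.
by apply: good_add => //; apply: good_scale; exact: good_sin_cos.
Qed.

(* On [-A, A] a continuous function of [x] is a continuous function of
   [sin (x / A)], hence uniformly close to a trigonometric polynomial. *)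
Let approx (f : R -> R) M A e : continuous f -> (forall x, `|f x| <= M) -> 0 < A -> 0 < e ->
  exists2 h, good h & (forall x, `|x| <= A -> `|f x - h x| <= e) /\ (forall x, `|h x| <= M + e).
Proof.
move=> cf fM A0 e0.
pose s1 : R := sin (1 / 2); pose B := 2 * A.
have B0 : 0 < B by rewrite mulr_gt0.
have pi1 : 1 <= pi / 2 :> R := pihalf_ge1 R.
have s1_gt0 : 0 < s1 by apply: sin_gt0_pihalf; lra.
have s1_lt1 : s1 < 1.
  have c0 : 0 < cos (1 / 2 : R) by apply: cos_gt0_pihalf; lra.
  rewrite -(@ltr_pXn2r _ 2)// ?nnegrE ?(ltW s1_gt0)// expr1n.
  have := cos2Dsin2 (1 / 2 : R); rewrite -/s1 => <-.
  by rewrite ltrDr exprn_gt0.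
pose clamp u := (`|u + s1| - `|u - s1|) / 2.
have clampP u : -1 < clamp u < 1.
  have : `|clamp u| <= s1.
    rewrite /clamp normrM normfV (ger0_norm (_ : 0 <= 2))// ler_pdivrMr//.
    apply: le_trans (ler_dist_dist _ _) _.
    have -> : u + s1 - (u - s1) = s1 * 2 by ring.
    by rewrite ger0_norm// mulr_ge0// ltW.
  by rewrite ler_norml => /andP[? ?]; apply/andP; split; lra.
have clampE u : `|u| <= s1 -> clamp u = u.
  rewrite ler_norml => /andP[? ?]; rewrite /clamp ger0_norm; last by lra.
  by rewrite ler0_norm; [field|lra].
have cclamp : continuous clamp.
  move=> u; apply: cvgMr_tmp; apply: cvgB; apply: cvg_norm.
    by apply: cvgD; [exact: cvg_id|exact: cvg_cst].
  by apply: cvgB; [exact: cvg_id|exact: cvg_cst].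
have cclamp2 : continuous (fun u : R => clamp (2 * u - 1)).
  move=> u; apply: (@continuous_comp _ _ _ (fun u : R => 2 * u - 1) clamp); last exact: cclamp.
  by apply: cvgB; [apply: cvgMl_tmp; exact: cvg_id|exact: cvg_cst].
pose g u := f (B * asin (clamp (2 * u - 1))).
have cg : continuous g.
  move=> u; apply: continuous_comp; last exact: cf.
  apply: cvgMl_tmp.
  exact: (cvg_comp _ _ (cclamp2 u) (continuous_asin (clampP (2 * u - 1)))).
have [p pg] := weierstrass cg e0.
pose q := p \Po ((1 / 2)%:P * 'X + (1 / 2)%:P).
have qE u : q.[u] = p.[(u + 1) / 2].
  by rewrite horner_comp !hornerE; congr (p.[_]); field.
exists (fun x => q.[sin (B^-1 * x)]); first exact: good_poly_sin.
have u01 x : 0 <= (sin (B^-1 * x) + 1) / 2 <= 1.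
  by have := sin_max (B^-1 * x); rewrite ler_norml => /andP[? ?]; apply/andP; split; lra.
have bd x : `|f (B * asin (clamp (sin (B^-1 * x)))) - q.[sin (B^-1 * x)]| <= e.
  rewrite qE; have := pg _ (u01 x); rewrite /g.
  by have -> : 2 * ((sin (B^-1 * x) + 1) / 2) - 1 = sin (B^-1 * x) by field.
split=> x.
  rewrite ler_norml => /andP[xA1 xA2]; have := bd x.
  have y1 : - (1 / 2) <= B^-1 * x by rewrite (mulrC _ x) ler_pdivlMr// /B; lra.
  have y2 : B^-1 * x <= 1 / 2 by rewrite (mulrC _ x) ler_pdivrMr// /B; lra.
  rewrite clampE.
    rewrite sinK; first by rewrite mulVKf ?gt_eqF.
    by rewrite in_itv /=; apply/andP; split; lra.
  rewrite ler_norml /s1 -sinN; apply/andP; split; rewrite leNgt; apply/negP.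
    by rewrite ltr_sin ?in_itv/=; [lra|apply/andP; split; lra..].
  by rewrite ltr_sin ?in_itv/=; [lra|apply/andP; split; lra..].
have := bd x; have := fM (B * asin (clamp (sin (B^-1 * x)))).
by rewrite !ler_norml => /andP[? ?] /andP[? ?]; apply/andP; split; lra.
Qed.

Theorem weak_cvg (f : R -> R) : continuous f -> (exists M, forall x, `|f x| <= M) ->
  mean P (f \o Y n) @[n --> \oo] --> mean Q (f \o Z).
Proof.
move=> cf [M fM]; apply/cvgrPdist_le => e e0.
have M0 : 0 <= M by apply: le_trans (fM 0).
have C0 : 0 <= C by apply: le_trans Z2.2; apply: mean_ge0 => t; exact: sqr_ge0.
have [A A0 hA] : exists2 A : R, 0 < A & (2 * M + e / 8) * C <= e / 8 * A ^+ 2.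
  pose K := (2 * M + e / 8) * C / (e / 8).
  have K0 : 0 <= K by rewrite divr_ge0 ?mulr_ge0//; lra.
  exists (1 + K); first by lra.
  have -> : (2 * M + e / 8) * C = e / 8 * K by rewrite /K; field; lra.
  by rewrite ler_wpM2l//; [lra|nra].
have e8 : 0 < e / 8 by lra.
have [h gh [h1 h2]] := approx cf fM A0 e8.
have [YhL ZhL] := good_L1 gh; have [mh _ hcv] := gh.
have mf : measurable_fun setT f by exact: continuous_measurable_fun.
have fh x : `|f x - h x| <= e / 8 + (2 * M + e / 8) / A ^+ 2 * x ^+ 2.
  have [xA|xA] := leP `|x| A.
    apply: le_trans (h1 x xA) _; rewrite lerDl mulr_ge0 ?sqr_ge0// divr_ge0 ?sqr_ge0//; lra.
  apply: (@le_trans _ _ (2 * M + e / 8)).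
    by apply: le_trans (ler_normB _ _) _; have := fM x; have := h2 x; lra.
  rewrite -[leLHS]add0r lerD//; first by lra.
  rewrite -mulrA ler_peMr//; first by lra.
  rewrite mulrC ler_pdivlMr ?exprn_gt0// mul1r -(real_normK (num_real x)).
  by rewrite lerXn2r ?nnegrE// ltW.
have main d0 (T0 : measurableType d0) (P0 : probability T0 R) (W : T0 -> R) :
   measurable_fun setT W -> in_L1 P0 (fun t => W t ^+ 2) -> mean P0 (fun t => W t ^+ 2) <= C ->
   in_L1 P0 (h \o W) -> `|mean P0 (f \o W) - mean P0 (h \o W)| <= e / 4.
  move=> mW W2 WC hL.
  have fL : in_L1 P0 (f \o W).
    by apply: (@in_L1_bounded _ _ _ _ _ M) => [|t]; [exact: measurableT_comp|exact: fM].
  rewrite -meanB//.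
  apply: (@le_trans _ _ (mean P0 (fun t => e / 8 + (2 * M + e / 8) / A ^+ 2 * W t ^+ 2))).
    apply: norm_mean_le => [||t]; [exact: in_L1B| |exact: fh].
    by apply: in_L1D; [exact: in_L1_cst|exact: in_L1Z].
  rewrite meanD ?mean_cst ?meanZ//; [|exact: in_L1_cst|exact: in_L1Z].
  have : (2 * M + e / 8) / A ^+ 2 * mean P0 (fun t => W t ^+ 2) <= e / 8; last by lra.
  rewrite mulrAC ler_pdivrMr ?exprn_gt0// (le_trans _ hA)// ler_wpM2l//; lra.
near=> n.
have [YL YC] : in_L1 P (fun t => Y n t ^+ 2) /\ mean P (fun t => Y n t ^+ 2) <= C by near: n.
have hn : `|mean Q (h \o Z) - mean P (h \o Y n)| <= e / 4.
  by near: n; move/cvgrPdist_le : hcv; apply; lra.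
have := main _ _ P (Y n) (mY n) YL YC (YhL n); have := main _ _ Q Z mZ Z2.1 Z2.2 ZhL.
move: hn; rewrite !ler_norml => /andP[? ?] /andP[? ?] /andP[? ?].
by apply/andP; split; lra.
Unshelve. all: by end_near. Qed.

End Weak.
End MethodOfMoments.

(** * Gaussian moments *)

Section GaussianMoments.
Context {R : realType}.
Local Notation mu := (@lebesgue_measure R).
Local Notation phi := (normal_pdf (0 : R) 1).
Let c0 : R := normal_peak 1.

Let pdfE (m x : R) : normal_pdf m 1 x = c0 * expR (- (x - m) ^+ 2 / 2).
Proof. by rewrite normal_pdfE ?oner_neq0// /normal_fun expr1n. Qed.

Let phiE x : phi x = c0 * expR (- x ^+ 2 / 2).
Proof. by rewrite pdfE subr0. Qed.

Let mphi : measurable_fun setT (EFin \o phi).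
Proof. by apply/measurable_EFinP; exact: measurable_normal_pdf. Qed.

Lemma integral_normal_prob (f : R -> \bar R) : measurable_fun setT f ->
  (\int[normal_prob 0 1]_x `|f x| < +oo)%E ->
  (\int[normal_prob 0 1]_x f x = \int[mu]_x (f x * (phi x)%:E))%E.
Proof.
move=> mf finf.
rewrite -(Radon_Nikodym_change_of_variables (normal_prob_dominates 0 1))//=; last first.
  by apply/integrableP; split.
apply: ae_eq_integral => //.
- apply: emeasurable_funM => //; apply: (measurable_int mu).
  by apply: Radon_Nikodym_integrable; exact: normal_prob_dominates.
- exact: emeasurable_funM.
- apply: ae_eqe_mul2l => /=.
  apply: integral_ae_eq => //=.
  + by apply: Radon_Nikodym_integrable; exact: normal_prob_dominates.
  + move=> E _ mE; rewrite -Radon_Nikodym_integral//; exact: normal_prob_dominates.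
Qed.

Lemma ge0_integral_normal_prob (f : R -> \bar R) : measurable_fun setT f ->
  (forall x, 0 <= f x)%E ->
  (\int[normal_prob 0 1]_x f x = \int[mu]_x (f x * (phi x)%:E))%E.
Proof.
move=> mf f0.
rewrite -(Radon_Nikodym_SigmaFinite.change_of_variables (normal_prob_dominates 0 1))//.
have RNi := Radon_Nikodym_SigmaFinite.f_integrable (normal_prob_dominates (0 : R) 1).
apply: ae_eq_integral => //.
- by apply: emeasurable_funM => //; exact: (measurable_int mu).
- exact: emeasurable_funM.
- apply: ae_eqe_mul2l => /=.
  apply: integral_ae_eq => //=.
  move=> E _ mE; rewrite -Radon_Nikodym_SigmaFinite.f_integral//.
  exact: normal_prob_dominates.
Qed.

Let pow_le k (x : R) : `|x| ^+ k <= k`!%:R * (expR x + expR (- x)).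
Proof.
have h : `|x| ^+ k <= k`!%:R * expR `|x|.
  case: k => [|k].
    by rewrite expr0 fact0 mul1r -expR0 ler_expR.
  have := expR_ge1Dxn k (normr_ge0 x) => h.
  rewrite mulrC -ler_pdivrMr ?ltr0n ?fact_gt0//; lra.
apply: le_trans h _; rewrite ler_wpM2l//.
have [x0|x0] := leP 0 x; first by rewrite ger0_norm// lerDl expR_ge0.
by rewrite ltr0_norm// lerDr expR_ge0.
Qed.

Let exp_phi (e x : R) : e ^+ 2 = 1 -> expR (e * x) * phi x = expR (1 / 2) * normal_pdf e 1 x.
Proof.
move=> e1; rewrite phiE pdfE mulrCA [RHS]mulrCA; congr (_ * _); rewrite -!expRD.
congr expR.
have -> : (x - e) ^+ 2 = x ^+ 2 - 2 * (e * x) + e ^+ 2 by ring.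
by rewrite e1; field.
Qed.

Let pow_phi_le k x : `|x| ^+ k * phi x <=
  k`!%:R * expR (1 / 2) * (normal_pdf 1 1 x + normal_pdf (-1) 1 x).
Proof.
apply: le_trans (ler_wpM2r (normal_pdf_ge0 0 1 x) (pow_le k x)) _.
have e1 := exp_phi x (expr1n R 2); have e2 := exp_phi x (sqrr_sign R 1).
rewrite mul1r in e1; rewrite expr1 mulN1r in e2.
by rewrite -[leLHS]mulrA mulrDl e1 e2 -mulrDr mulrA.
Qed.

Let integrable_pow_phi k : mu.-integrable setT (fun x : R => (x ^+ k * phi x)%:E).
Proof.
apply: (@le_integrable _ _ _ mu setT measurableT _
   (fun x => (k`!%:R * expR (1 / 2))%:E * ((normal_pdf 1 1 x)%:E + (normal_pdf (-1) 1 x)%:E))%E).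
- apply/measurable_EFinP; apply: measurable_funM; first exact: measurable_funX.
  exact: measurable_normal_pdf.
- move=> x _; rewrite -EFinD -EFinM !abse_EFin lee_fin.
  have -> : `|x ^+ k * phi x| = `|x| ^+ k * phi x.
    by rewrite normrM normrX (ger0_norm (normal_pdf_ge0 _ _ _)).
  by apply: le_trans (pow_phi_le k x) _; exact: ler_norm.
- apply: integrableZl => //; apply: integrableD => //; exact: integrable_normal_pdf.
Qed.

Lemma in_L1_normal_pow k : in_L1 (normal_prob (0 : R) 1) (fun x => x ^+ k).
Proof.
apply/integrableP; split; first by apply/measurable_EFinP; exact: measurable_funX.
rewrite ge0_integral_normal_prob//; last first.
  by apply: measurableT_comp => //; apply/measurable_EFinP; exact: measurable_funX.
have /integrableP[_] := integrable_pow_phi k; congr (_ < _)%E.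
apply: eq_integral => x _; rewrite !abse_EFin -EFinM normrM.
by rewrite [X in _ * X]ger0_norm// normal_pdf_ge0.
Qed.

Let mean_normal_pow k : (mean (normal_prob (0 : R) 1) (fun x => x ^+ k))%:E =
  (\int[mu]_x (x ^+ k * phi x)%:E)%E.
Proof.
rewrite -(expectation_mean (in_L1_normal_pow k)) unlock integral_normal_prob//.
- by apply/measurable_EFinP; exact: measurable_funX.
- by have /integrableP[] := in_L1_normal_pow k.
Qed.

Let boundary k : (n%:R : R) ^+ k * phi n%:R @[n --> \oo] --> (0 : R).
Proof.
apply/cvgr0Pnorm_le => e e0.
pose C := c0 * (k.+1`!%:R * 2 ^+ k.+1).
near=> n.
have n1 : 1 <= n%:R :> R by rewrite ler1n; near: n; exact: nbhs_infty_ge.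
have Cn : C / e <= n%:R by near: n; exact: nbhs_infty_ger.
rewrite ger0_norm ?mulr_ge0 ?exprn_ge0 ?normal_pdf_ge0//.
rewrite phiE mulrCA.
have nn : 0 <= (n%:R : R) ^+ 2 / 2 by rewrite divr_ge0 ?sqr_ge0.
have ex := expR_ge1Dxn k nn.
have exn : (n%:R ^+ 2 / 2) ^+ k.+1 / k.+1`!%:R <= expR (n%:R ^+ 2 / 2) :> R by lra.
have f0 : 0 < k.+1`!%:R :> R by rewrite ltr0n fact_gt0.
have n0 : 0 < n%:R :> R by lra.
apply: (@le_trans _ _ (C / n%:R)); last first.
  by rewrite ler_pdivrMr// -ler_pdivrMl// mulrC.
rewrite /C -!mulrA ler_wpM2l ?normal_peak_ge0// mulNr expRN.
rewrite ler_pdivrMr ?expR_gt0//.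
apply: (@le_trans _ _ (k.+1`!%:R * (2 ^+ k.+1 / n%:R) * ((n%:R ^+ 2 / 2) ^+ k.+1 / k.+1`!%:R))); last first.
  by rewrite ler_wpM2l// mulr_ge0// divr_ge0 ?exprn_ge0.
have -> : k.+1`!%:R * (2 ^+ k.+1 / n%:R) * ((n%:R ^+ 2 / 2) ^+ k.+1 / k.+1`!%:R) =
   n%:R ^+ k * (n%:R ^+ k.+1) :> R.
  rewrite exprMn exprVn -exprM mul2n -addnn exprD.
  have two : (2 : R) ^+ k.+1 != 0 by rewrite expf_neq0.
  rewrite !(exprS n%:R).
  move: (k.+1`!%:R : R) f0 ((2 : R) ^+ k.+1) two (n%:R ^+ k : R) => a a0 b b0 z.
  by field; rewrite b0 !gt_eqF.
by rewrite ler_peMr ?exprn_ge0// exprn_ege1.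
Unshelve. all: by end_near. Qed.

Let F k (x : R) := x ^+ k * phi x.
Let dF k (x : R) := k%:R * (x ^+ k.-1 * phi x) - x ^+ k.+1 * phi x.

Let is_derive_F k x : is_derive x (1 : R) (F k) (dF k x).
Proof.
have d1 : is_derive x (1 : R) (fun x => - x ^+ 2 / 2) (- x).
  have -> : (fun x : R => - x ^+ 2 / 2) = (- (2^-1)) *: (id ^+ 2 : R -> R).
    by apply/funext => y; rewrite !fctE /GRing.scale /=; field.
  by apply: is_derive_eq; rewrite /GRing.scale /= expr1 mulr1 -mulr_natl; field.
have d2 : is_derive x (1 : R) (fun x => expR (- x ^+ 2 / 2)) (expR (- x ^+ 2 / 2) * - x).
  exact: (@is_derive1_comp _ expR (fun x => - x ^+ 2 / 2)).
have -> : F k = (id ^+ k : R -> R) * (c0 *: (fun x => expR (- x ^+ 2 / 2))).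
  by apply/funext => y; rewrite /F phiE !fctE /GRing.scale /=.
apply: is_derive_eq.
rewrite /dF phiE !fctE /GRing.scale /=. rewrite (exprS x k).
by move: (x ^+ k) (x ^+ k.-1) (expR _) => a b c; ring.
Qed.

Let integral_dF k (n : nat) : (0 < n)%N ->
  (\int[mu]_(x in `[(- n%:R)%R, n%:R%R]) (dF k x)%:E = (F k n%:R%R)%:E - (F k (- n%:R)%R)%:E)%E.
Proof.
move=> n0; apply: continuous_FTC2.
- by rewrite gtrN// ltr0n.
- apply: continuous_subspaceT => x.
  have cphi : {for x, continuous phi} by apply: continuous_normal_pdf; exact: oner_neq0.
  apply: cvgB.
    by apply: cvgMl_tmp; apply: cvgM => //; exact: exprn_continuous.
  by apply: cvgM => //; exact: exprn_continuous.
- have cF : continuous (F k).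
    by move=> x; apply/differentiable_continuous/derivable1_diffP; have dy := is_derive_F k x; exact: (@ex_derive _ _ _ _ _ _ _ dy).
  split=> [x _||].
  + by have dy := is_derive_F k x; exact: (@ex_derive _ _ _ _ _ _ _ dy).
  + by apply: cvg_at_right_filter; exact: cF.
  + by apply: cvg_at_left_filter; exact: cF.
- by move=> x _; rewrite derive1E; exact: (@derive_val _ _ _ _ _ _ _ (is_derive_F k x)).
Qed.

Let integrable_dF k : mu.-integrable setT (EFin \o dF k).
Proof.
rewrite (_ : EFin \o dF k = (fun x => k%:R%:E * (x ^+ k.-1 * phi x)%:E - (x ^+ k.+1 * phi x)%:E)%E) //.
by apply: integrableB => //; apply: integrableZl.
Qed.

Let integral_dF0 k : (\int[mu]_x (dF k x)%:E = 0)%E.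
Proof.
pose f_ (n : nat) := (EFin \o dF k) \_ `[- n%:R, n%:R].
have mdF : measurable_fun setT (EFin \o dF k) by exact: measurable_int (integrable_dF k).
have mf n : measurable_fun setT (f_ n).
  apply/(measurable_restrictT _ _).1 => //; exact: measurable_funTS.
have f_cvg : {ae mu, forall x, setT x -> f_ ^~ x @ \oo --> (EFin \o dF k) x}.
  apply: aeW => x _; apply: cvg_near_cst; near=> n.
  rewrite /f_ patchE mem_set//= in_itv /= -ler_norml.
  by near: n; exact: nbhs_infty_ger.
have f_le : {ae mu, forall x n, setT x -> (`|f_ n x| <= (abse \o (EFin \o dF k)) x)%E}.
  apply: aeW => x n _; rewrite /f_ patchE; case: ifP => // _.
  by rewrite abse0 abse_ge0.
have [_ _ lim] := @dominated_convergence _ _ _ mu setT measurableT f_ (EFin \o dF k)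
  (abse \o (EFin \o dF k)) mf mdF f_cvg (integrable_abse (integrable_dF k)) f_le.
have lim0 : (\int[mu]_x f_ n x)%E @[n --> \oo] --> (0 : \bar R)%E.
  have FN n : F k (- n%:R) = (-1) ^+ k * F k n%:R.
    have -> : F k (- n%:R) = (- n%:R) ^+ k * phi n%:R by rewrite /F !phiE sqrrN.
    by rewrite exprNn -mulrA.
  apply: (@cvg_trans _ ((EFin \o (fun n => F k n%:R - (-1) ^+ k * F k n%:R)) @ \oo)).
    apply: near_eq_cvg; near=> n.
    have n0 : (0 < n)%N by near: n; exact: nbhs_infty_gt.
    by rewrite /f_ -integral_mkcond /= (integral_dF k n0) -EFinB FN.
  apply: cvg_EFin; first exact: nearW.
  rewrite -[X in _ --> X](subr0 0) -{2}(mulr0 ((-1) ^+ k)).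
  by apply: cvgB; [exact: boundary|apply: cvgMl_tmp; exact: boundary].
exact: (cvg_unique _ lim lim0).
Unshelve. all: by end_near. Qed.

Lemma mean_normal_powSS k :
  mean (normal_prob (0 : R) 1) (fun x => x ^+ k.+2) =
  k.+1%:R * mean (normal_prob (0 : R) 1) (fun x => x ^+ k).
Proof.
apply/eqP; rewrite eq_sym -subr_eq0 -eqe EFinB EFinM !mean_normal_pow.
rewrite -integralZl// -integralB//; last exact: integrableZl.
by rewrite -[X in _ == X](integral_dF0 k.+1).
Qed.

Lemma mean_normal_pow1 : mean (normal_prob (0 : R) 1) (fun x => x ^+ 1) = 0.
Proof.
have := integral_dF0 0; rewrite /dF; under eq_integral do rewrite mul0r sub0r EFinN.
rewrite integralN; last exact: integrable_add_def.
by rewrite -mean_normal_pow -EFinN => -[] /eqP; rewrite oppr_eq0 => /eqP.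
Qed.

Lemma mean_normal_even_cvg0 (a : R) :
  a ^+ N.*2 / N.*2`!%:R * mean (normal_prob (0 : R) 1) (fun x => x ^+ N.*2) @[N --> \oo]
  --> (0 : R).
Proof.
have evenE N : mean (normal_prob (0 : R) 1) (fun x => x ^+ N.*2) * (2 ^+ N * N`!%:R) = N.*2`!%:R.
  elim: N => [|N IH].
    rewrite double0 fact0 expr0 !mulr1 -[RHS](mean_cst (normal_prob (0 : R) 1)).
    by congr mean; apply/funext => x; rewrite expr0.
  rewrite doubleS mean_normal_powSS !factS exprS !natrM -IH.
  have -> : N.*2.+2%:R = 2 * N.+1%:R :> R by rewrite -doubleS -mul2n natrM.
  by ring.
apply: (@cvg_trans _ (exp_coeff (a ^+ 2 / 2) @ \oo)); last first.
  exact: cvg_series_cvg_0 (is_cvg_series_exp_coeff _).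
apply: near_eq_cvg; apply: nearW => N.
have f1 : N.*2`!%:R != 0 :> R by rewrite pnatr_eq0 -lt0n fact_gt0.
have f2 : N`!%:R != 0 :> R by rewrite pnatr_eq0 -lt0n fact_gt0.
have t0 : (2 : R) ^+ N != 0 by rewrite expf_neq0.
have -> : mean (normal_prob (0 : R) 1) (fun x => x ^+ N.*2) = N.*2`!%:R / (2 ^+ N * N`!%:R).
  by rewrite -(evenE N) mulfK// mulf_neq0.
rewrite /exp_coeff /= exprMn exprVn -exprM mul2n.
by move: (N.*2`!%:R : R) (N`!%:R : R) ((2 : R) ^+ N) f1 f2 t0 (a ^+ N.*2) => u v z u0 v0 z0 y; field; rewrite u0 v0 z0.
Qed.

End GaussianMoments.

(** * Covariances under mixing *)

Section Covariance.
Context d (T : measurableType d) (R : realType) (P : probability T R).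
Variables (A B : set (set T)) (al : R).
Hypothesis mA : A `<=` measurable.
Hypothesis mB : B `<=` measurable.
Hypothesis AB : forall E F, A E -> B F -> `|fine (P (E `&` F)) - fine (P E) * fine (P F)| <= al.

Let layer N (y : R) : 0 <= y ->
  (N%:R <= y -> \sum_(i < N) ((i.+1%:R <= y)%R)%:R = N%:R :> R) /\
  (y < N%:R -> \sum_(i < N) ((i.+1%:R <= y)%R)%:R <= y < \sum_(i < N) ((i.+1%:R <= y)%R)%:R + 1).
Proof.
move=> y0; elim: N => [|N [IH1 IH2]].
  by rewrite big_ord0; split=> //; rewrite ltNge y0.
rewrite big_ord_recr /=; split=> yN.
  rewrite yN IH1 -?natr1//; move: yN; rewrite -natr1; lra.
rewrite (ltNge y) in yN; rewrite (negbTE yN) addr0 ltNge; have [Ny|yN'] := leP N%:R y; last by rewrite -ltNge; exact: IH2.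
by rewrite IH1// Ny natr1.
Qed.

Let layer_sum N (f : T -> R) t : \sum_(i < N) ((i.+1%:R <= N%:R * f t)%R)%:R =
  \sum_(i < N) \1_[set t | i.+1%:R <= N%:R * f t] t :> R.
Proof.
apply: eq_bigr => i _; rewrite indicE.
have [h|h] := boolP (i.+1%:R <= N%:R * f t)%R; first by rewrite mem_set.
by rewrite memNset//; exact/negP.
Qed.

Let cov01 (f g : T -> R) :
  (forall t, 0 <= f t <= 1) -> (forall t, 0 <= g t <= 1) ->
  (forall D, A (f @^-1` D)) -> (forall D, B (g @^-1` D)) ->
  `|mean P (fun t => f t * g t) - mean P f * mean P g| <= al.
Proof.
move=> f01 g01 fA gB.
have meas h : (forall D, measurable (h @^-1` D)) -> measurable_fun setT (h : T -> R).
  by move=> mh _ D mD; rewrite setTI.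
have mf : measurable_fun setT f by apply: meas => D; exact: mA.
have mg : measurable_fun setT g by apply: meas => D; exact: mB.
apply/ler_addgt0Pr => e e0.
pose N := (Num.truncn (4 / e)).+1.
have N0 : 0 < N%:R :> R by rewrite ltr0n.
have Ne : 4 / N%:R <= e.
  by rewrite ler_pdivrMr// -ler_pdivrMl// mulrC ltW// truncnS_gt.
pose E i := [set t | i.+1%:R <= N%:R * f t]; pose F i := [set t | i.+1%:R <= N%:R * g t].
have AE i : A (E i) by exact: (fA [set x | i.+1%:R <= N%:R * x]).
have BF i : B (F i) by exact: (gB [set x | i.+1%:R <= N%:R * x]).
pose fN t : R := N%:R^-1 * \sum_(i < N) \1_(E i) t.
pose gN t : R := N%:R^-1 * \sum_(i < N) \1_(F i) t.
have near (h : T -> R) t (s : R) : 0 <= h t <= 1 -> s = \sum_(i < N) ((i.+1%:R <= N%:R * h t)%R)%:R ->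
    0 <= N%:R^-1 * s <= h t /\ h t <= N%:R^-1 * s + N%:R^-1.
  move=> /andP[h0 h1] sE.
  have y0 : 0 <= N%:R * h t by rewrite mulr_ge0.
  have [l1 l2] := layer N y0; rewrite -sE in l1 l2.
  have s0 : 0 <= s by rewrite sE; apply: sumr_ge0.
  have [Ny|yN] := leP N%:R (N%:R * h t).
    have hE : h t = 1.
      by apply/eqP; rewrite eq_le h1/=; move: Ny; rewrite -[leLHS]mulr1 ler_pM2l.
    rewrite l1// mulVf ?gt_eqF// hE; split; last by rewrite lerDl invr_ge0.
    by apply/andP; split.
  have /andP[l3 l4] := l2 yN.
  rewrite mulr_ge0 ?invr_ge0//= ler_pdivrMl// l3; split=> //.
  by rewrite -[X in _ + X]mulr1 -mulrDr ler_pdivlMl// ltW.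
have fN01 t : 0 <= fN t <= f t /\ f t <= fN t + N%:R^-1 by apply: near => //; rewrite layer_sum.
have gN01 t : 0 <= gN t <= g t /\ g t <= gN t + N%:R^-1 by apply: near => //; rewrite layer_sum.
have indL1 (G : set T) : measurable G -> in_L1 P (\1_G : T -> R).
  move=> mG; apply: (@in_L1_bounded _ _ _ _ _ 1) => [|t]; first exact: measurable_indic.
  by rewrite indicE; case: (_ \in _); rewrite ?normr1 ?normr0.
have EL i : in_L1 P (\1_(E i) : T -> R) by apply: indL1; exact: mA.
have FL i : in_L1 P (\1_(F i) : T -> R) by apply: indL1; exact: mB.
have EFL i j : in_L1 P (fun t => \1_(E i) t * \1_(F j) t : R).
  have := indL1 (E i `&` F j) (measurableI _ _ (mA (AE i)) (mB (BF j))).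
  by congr in_L1; apply/funext => t; rewrite indicI.
have fNL : in_L1 P fN by apply: in_L1Z; apply: in_L1_sum.
have gNL : in_L1 P gN by apply: in_L1Z; apply: in_L1_sum.
have b01 (h : T -> R) : measurable_fun setT h -> (forall t, 0 <= h t <= 1) -> in_L1 P h.
  move=> mh h01; apply: (@in_L1_bounded _ _ _ _ _ 1) => // t.
  by have /andP[h0 h1] := h01 t; rewrite ger0_norm.
have fL := b01 _ mf f01; have gL := b01 _ mg g01.
have mfg : measurable_fun setT (fun t => f t * g t) by exact: measurable_funM.
have mfgN : measurable_fun setT (fun t => fN t * gN t).
  by apply: measurable_funM; apply: in_L1_measurable; eauto.
have prod01 (u v : R) : 0 <= u <= 1 -> 0 <= v <= 1 -> 0 <= u * v <= 1.
  by move=> /andP[? ?] /andP[? ?]; rewrite mulr_ge0//= mulr_ile1.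
have fN1 t : 0 <= fN t <= 1.
  by have [/andP[a1 a2] _] := fN01 t; have /andP[a3 a4] := f01 t; rewrite a1 (le_trans a2).
have gN1 t : 0 <= gN t <= 1.
  by have [/andP[a1 a2] _] := gN01 t; have /andP[a3 a4] := g01 t; rewrite a1 (le_trans a2).
have fgL : in_L1 P (fun t => f t * g t) by apply: b01 => // t; exact: prod01.
have fgNL : in_L1 P (fun t => fN t * gN t) by apply: b01 => // t; exact: prod01.
have covN : `|mean P (fun t => fN t * gN t) - mean P fN * mean P gN| <= al.
  have -> : mean P (fun t => fN t * gN t) =
      N%:R^-1 * N%:R^-1 * \sum_(i < N) \sum_(j < N) fine (P (E i `&` F j)).
    transitivity (mean P (fun t => N%:R^-1 * N%:R^-1 * \sum_(i < N) \sum_(j < N) (\1_(E i) t * \1_(F j) t))).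
      congr mean; apply/funext => t; rewrite /fN /gN mulrACA mulr_suml; congr (_ * _).
      by apply: eq_bigr => i _; rewrite mulr_sumr.
    rewrite meanZ; last by apply: in_L1_sum => i; apply: in_L1_sum.
    congr (_ * _); rewrite mean_sum; last by move=> i; apply: in_L1_sum.
    apply: eq_bigr => i _; rewrite mean_sum//; apply: eq_bigr => j _.
    rewrite -mean_indic; last by apply: measurableI; [exact: mA|exact: mB].
    by congr mean; apply/funext => t; rewrite indicI.
  rewrite /fN /gN !meanZ ?mean_sum//; try by apply: in_L1_sum.
  rewrite mulrACA -mulrBr mulr_suml -sumrB.
  rewrite normrM (ger0_norm (_ : 0 <= N%:R^-1 * N%:R^-1)) ?mulr_ge0 ?invr_ge0// -invfM.
  rewrite ler_pdivrMl ?mulr_gt0//.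
  apply: le_trans (ler_norm_sum _ _ _) _.
  apply: (@le_trans _ _ (\sum_(i < N) \sum_(j < N) al)).
    apply: ler_sum => i _; rewrite mulr_sumr -sumrB.
    apply: le_trans (ler_norm_sum _ _ _) _; apply: ler_sum => j _.
    by rewrite !mean_indic; [exact: AB|exact: mB|exact: mA].
  by rewrite !sumr_const !card_ord -mulrnA -natrM mulr_natl.
have mf01 h : in_L1 P h -> (forall t, 0 <= h t <= 1) -> 0 <= mean P h <= 1.
  move=> hL h01; rewrite mean_ge0 => [|t]; last by have /andP[] := h01 t.
  rewrite -[leRHS](mean_cst P); apply: mean_le => // [|t]; first exact: in_L1_cst.
  by have /andP[] := h01 t.
have close h k c : in_L1 P h -> in_L1 P k -> (forall t, `|h t - k t| <= c) -> `|mean P h - mean P k| <= c.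
  move=> hL kL hk; rewrite -meanB// -[leRHS](mean_cst P).
  by apply: norm_mean_le => //; [exact: in_L1B|exact: in_L1_cst].
have iN0 : 0 < N%:R^-1 :> R by rewrite invr_gt0.
have c1 : `|mean P f - mean P fN| <= N%:R^-1.
  by apply: close => // t; have [/andP[a1 a2] a3] := fN01 t; rewrite ler_norml; apply/andP; split; lra.
have c2 : `|mean P g - mean P gN| <= N%:R^-1.
  by apply: close => // t; have [/andP[a1 a2] a3] := gN01 t; rewrite ler_norml; apply/andP; split; lra.
have prodd (u v u' v' c : R) : 0 <= u <= 1 -> 0 <= v' <= 1 -> `|u - u'| <= c -> `|v - v'| <= c ->
    `|u * v - u' * v'| <= 2 * c.
  move=> /andP[u0 u1] /andP[v0 v1] uu vv.
  have -> : u * v - u' * v' = u * (v - v') + (u - u') * v' by ring.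
  apply: le_trans (ler_normD _ _) _; rewrite !normrM (ger0_norm u0) (ger0_norm v0).
  have -> : 2 * c = c + c by ring.
  by apply: lerD; [apply: le_trans (ler_piMl _ u1) vv|apply: le_trans (ler_piMr _ v1) uu].
have c3 : `|mean P (fun t => f t * g t) - mean P (fun t => fN t * gN t)| <= 2 * N%:R^-1.
  apply: close => // t; apply: prodd => //.
    by have [/andP[a1 a2] a3] := fN01 t; rewrite ler_norml; apply/andP; split; lra.
  by have [/andP[a1 a2] a3] := gN01 t; rewrite ler_norml; apply/andP; split; lra.
have c4 : `|mean P f * mean P g - mean P fN * mean P gN| <= 2 * N%:R^-1.
  by apply: prodd => //; exact: mf01.
move: covN c3 c4 Ne; rewrite !ler_norml => /andP[? ?] /andP[? ?] /andP[? ?] Ne.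
by apply/andP; split; lra.
Qed.

Lemma covariance_mixing_le (f g : T -> R) :
  (forall t, `|f t| <= 1) -> (forall t, `|g t| <= 1) ->
  (forall D, A (f @^-1` D)) -> (forall D, B (g @^-1` D)) ->
  `|mean P (fun t => f t * g t) - mean P f * mean P g| <= 4 * al.
Proof.
move=> f1 g1 fA gB.
have meas h : (forall D, measurable (h @^-1` D)) -> measurable_fun setT (h : T -> R).
  by move=> mh _ D mD; rewrite setTI.
have mf : measurable_fun setT f by apply: meas => D; exact: mA.
have mg : measurable_fun setT g by apply: meas => D; exact: mB.
have fL : in_L1 P f by exact: in_L1_bounded f1.
have gL : in_L1 P g by exact: in_L1_bounded g1.
have fgL : in_L1 P (fun t => f t * g t).
  apply: (@in_L1_bounded _ _ _ _ _ 1) => [|t]; first exact: measurable_funM.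
  by rewrite normrM mulr_ile1.
have half (h : T -> R) : (forall t, `|h t| <= 1) -> forall t, 0 <= 1 / 2 * (h t + 1) <= 1.
  by move=> h1 t; have := h1 t; rewrite ler_norml => /andP[? ?]; apply/andP; split; lra.
have := cov01 (half _ f1) (half _ g1) (fun D => fA [set x | D (1 / 2 * (x + 1))])
  (fun D => gB [set x | D (1 / 2 * (x + 1))]).
have cL : in_L1 P (fun=> 1 : R) by exact: in_L1_cst.
rewrite !meanZ ?meanD ?mean_cst//; try exact: in_L1D.
have -> : mean P (fun t => 1 / 2 * (f t + 1) * (1 / 2 * (g t + 1)))
   = 1 / 4 * (mean P (fun t => f t * g t) + mean P f + mean P g + 1).
  transitivity (mean P (fun t => 1 / 4 * (f t * g t + f t + g t + 1))).
    by congr mean; apply/funext => t; field.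
  have s1 := in_L1D fgL fL; have s2 := in_L1D s1 gL; have s3 := in_L1D s2 cL.
  by rewrite (meanZ _ s3) (meanD s2 cL) (meanD s1 gL) (meanD fgL fL) mean_cst.
rewrite (_ : _ - _ = 1 / 4 * (mean P (fun t => f t * g t) - mean P f * mean P g)); last by field.
rewrite normrM ger0_norm; last by lra.
lra.
Qed.

End Covariance.

(** * Sums of cumulants over Cayley graphs *)

Section ListSumBounds.
Context {R : realFieldType} {A : eqType}.
Variable W : seq A.

Lemma ler_list_sum n (f g : seq A -> R) :
  (forall l, size l = n -> all (mem W) l -> f l <= g l) ->
  list_sum W n f <= list_sum W n g.
Proof.
elim: n f g => [|n IH] f g fg /=; first exact: fg.
rewrite big_seq [leRHS]big_seq; apply: ler_sum => x xW; apply: IH => l sl lW.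
by apply: fg; rewrite /= ?sl ?xW.
Qed.

Lemma norm_list_sum n (f : seq A -> R) :
  `|list_sum W n f| <= list_sum W n (fun l => `|f l|).
Proof.
elim: n f => [|n IH] f //=.
apply: le_trans (ler_norm_sum _ _ _) _; apply: ler_sum => x _; exact: IH.
Qed.

Lemma list_sum_const n (c : R) : list_sum W n (fun=> c) = (size W)%:R ^+ n * c.
Proof.
elim: n => [|n IH] /=; first by rewrite expr0 mul1r.
by under eq_bigr do rewrite IH; rewrite big_const_seq iter_addr_0 count_predT exprS -mulrA mulr_natl.
Qed.

Lemma list_sum_all n (p : pred A) :
  list_sum W n (fun l => (all p l)%:R) = (count p W)%:R ^+ n :> R.
Proof.
elim: n => [|n IH] /=; first by rewrite expr0.
transitivity (\sum_(x <- W) (p x)%:R * (count p W)%:R ^+ n : R).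
  apply: eq_bigr => x _; case: (p x) => /=; first by rewrite mul1r.
  by rewrite list_sum_const mulr0 mul0r.
by rewrite -mulr_suml exprS -natr_sum -big_mkcond sum1_count.
Qed.

End ListSumBounds.

(* k points cannot meet all of the k + 1 annuli [j r < dist <= (j + 1) r]. *)
Lemma empty_annulus (A : eqType) (D : nat -> pred A) (l : seq A) :
  (forall m n, (m <= n)%N -> subpred (D m) (D n)) ->
  exists2 j, (j <= size l)%N & all (fun y => D j y || ~~ D j.+1 y) l.
Proof.
move=> mono; apply: contrapT => none.
pose P j y := ~~ (D j y || ~~ D j.+1 y).
have bad j : (j <= size l)%N -> has (P j) l.
  by move=> jl; rewrite has_predC; apply/negP => h; apply: none; exists j.
have [y0 _] : exists2 y, y \in l & P 0%N y by apply/hasP; exact: bad.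
have fl (j : 'I_(size l).+1) : (find (P j) l < size l)%N.
  by rewrite -has_find bad// -ltnS.
pose f j := Ordinal (fl j).
have Pf (j : 'I_(size l).+1) : P j (nth y0 l (f j)) by apply: nth_find; rewrite bad// -ltnS.
have PP (i j : nat) y : (i < j)%N -> P i y -> ~~ P j y.
  move=> ij; rewrite /P !negb_or !negbK => /andP[_ Di].
  by rewrite (mono _ _ ij _ Di).
have finj : injective f.
  move=> i j fij; apply/val_inj; have Pi := Pf i; have Pj := Pf j.
  rewrite fij in Pi; case: (ltngtP i j) => // ij; exfalso.
    by move: (PP _ _ _ ij Pi); rewrite Pj.
  by move: (PP _ _ _ ij Pj); rewrite Pi.
by have := leq_card f finj; rewrite !card_ord ltnn.
Qed.

Section CumulantSum.
Context {R : realFieldType} {A : eqType}.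
Variables (W : seq A) (E : seq A -> R) (D : A -> nat -> pred A).
Variables (r N : nat) (eps : R).
Hypothesis E0 : E [::] = 1.
Hypothesis E1 : forall l, `|E l| <= 1.
Hypothesis eps0 : 0 <= eps.
Hypothesis D_refl : forall x m, D x m x.
Hypothesis D_mono : forall x m n, (m <= n)%N -> subpred (D x m) (D x n).
Hypothesis decoupled : forall x t l, x \in W -> all (mem W) l ->
  all (fun y => D x t y || ~~ D x (t + r) y) l ->
  `|E l - E (seq.filter (D x t) l) * E (seq.filter (predC (D x t)) l)| <= eps.

Lemma norm_sum_joint_cumulant_le k :
  (forall x, x \in W -> (count (D x (k * r)) W <= N)%N) ->
  `|list_sum W k.+1 (joint_cumulant E)| <=
    (jcum_bound k.+1)%:R * (size W)%:R * N%:R ^+ k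
    + (jcum_mix_bound k.+1)%:R * (size W)%:R ^+ k.+1 * eps.
Proof.
move=> DN.
apply: le_trans (norm_list_sum _ _ _) _; rewrite [list_sum _ _ _]/list_sum -/list_sum.
apply: (@le_trans _ _ (\sum_(x <- W) ((jcum_bound k.+1)%:R * N%:R ^+ k +
   (jcum_mix_bound k.+1)%:R * (size W)%:R ^+ k * eps))); last first.
  rewrite big_const_seq iter_addr_0 count_predT -[leLHS]mulr_natl exprS.
  by rewrite le_eqVlt; apply/orP; left; apply/eqP; ring.
rewrite big_seq [leRHS]big_seq; apply: ler_sum => x xW.
apply: (@le_trans _ _ (list_sum W k (fun l => (jcum_bound k.+1)%:R * (all (D x (k * r)) l)%:R
   + (jcum_mix_bound k.+1)%:R * eps))); last first.
  rewrite list_sumD list_sumZ list_sum_all list_sum_const; apply: lerD.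
    by rewrite ler_wpM2l// lerXn2r ?nnegrE// ler_nat; exact: DN.
  by rewrite le_eqVlt; apply/orP; left; apply/eqP; ring.
apply: ler_list_sum => l sl lW.
have [near|far] := boolP (all (D x (k * r)) l).
  rewrite mulr1; apply: le_trans (norm_joint_cumulant_le _ E1) _.
  by rewrite /= sl lerDl mulr_ge0.
rewrite mulr0 add0r.
have [j jl annulus] := @empty_annulus _ (fun j => D x (j * r)) l
  (fun m n mn => D_mono (leq_mul mn (leqnn r))).
have := @norm_joint_cumulant_mixed_le R A E
  (fun y => (y \in W) && (D x (j * r) y || ~~ D x (j * r + r) y)) (D x (j * r)) eps (x :: l) E0 eps0 E1.
rewrite /= sl; apply.
- move=> l' /allP l'P; apply: decoupled => //; apply/allP => y /l'P /andP[] //.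
- rewrite xW D_refl /=; apply/allP => y yl.
  have := allP annulus y yl; rewrite mulSn addnC => ->; rewrite andbT.
  exact: (allP lW).
- by rewrite D_refl.
- rewrite D_refl /= has_predC; apply: contra far => /allP nr; apply/allP => y yl.
  apply: (D_mono _ (nr y yl)); rewrite leq_mul2r -sl jl orbT//.
Qed.

End CumulantSum.

Section Walks.
Context (R : realType) (V : groupType) (S0 : {fset V}).
Hypothesis S0_sym : forall h, (h \in S0) = (h^-1%g \in S0).
Local Notation e := (cayley_edge S0).

Definition walk (k : nat) (x y : V) : Prop :=
  exists p : seq V, [/\ path e x p, last x p = y & (size p <= k)%N].

Lemma walk_refl k x : walk k x x.
Proof. by exists [::]. Qed.

Lemma walk_mono k l x y : (k <= l)%N -> walk k x y -> walk l x y.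
Proof. by move=> kl [p [pp lp sp]]; exists p; split=> //; exact: leq_trans sp kl. Qed.

Lemma walk_trans k l x y z : walk k x y -> walk l y z -> walk (k + l) x z.
Proof.
move=> [p [pp lp sp]] [q [pq lq sq]]; exists (p ++ q).
by rewrite cat_path last_cat pp lp size_cat; split=> //; exact: leq_add.
Qed.

Lemma walk_sym k x y : walk k x y -> walk k y x.
Proof.
move=> [p [pp lp sp]]; exists (rev (belast x p)); split.
- rewrite -lp rev_path; apply: sub_path pp => u v /=.
  by rewrite /cayley_edge S0_sym invgM invgK.
- by case: p lp {pp sp} => [//|a p /= _]; rewrite rev_cons last_rcons.
- by rewrite size_rev size_belast.
Qed.

Lemma walk_mulg g k x y : walk k (g * x)%g (g * y)%g <-> walk k x y.
Proof.
have imp h u v : walk k u v -> walk k (h * u)%g (h * v)%g.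
  move=> [p [pp lp sp]]; exists (map (fun z => (h * z)%g) p); rewrite size_map -lp last_map; split=> //.
  rewrite path_map; apply: sub_path pp => a b /=.
  by rewrite /cayley_edge invgM mulgA -(mulgA a^-1%g) mulVg mulg1.
split; last exact: imp.
by move=> /(imp g^-1%g); rewrite !mulKg.
Qed.

Lemma dist_leP k x y : (dist R S0 x y <= k%:R%:E)%E <-> walk k x y.
Proof.
split=> [h|[p [pp lp sp]]].
  have : (dist R S0 x y < k.+1%:R%:E)%E by apply: le_lt_trans h _; rewrite lte_fin ltr_nat.
  move=> /ereal_inf_lt[_ [p [pp lp] <-]]; rewrite lte_fin ltr_nat ltnS => sp.
  by exists p.
apply: (@le_trans _ _ (size p)%:R%:E); last by rewrite lee_fin ler_nat.
by apply: ereal_inf_lbound; exists p.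
Qed.

Lemma word_ballP k x : word_ball S0 (k%:R%:E : \bar R) x <-> walk k 1%g x.
Proof. exact: dist_leP. Qed.

Lemma walkS k x y : walk k.+1 x y -> x = y \/ exists2 h, h \in S0 & walk k (x * h)%g y.
Proof.
move=> [[|a p] [/= pp lp sp]]; first by left.
case/andP: pp => xa pp; right; exists (x^-1 * a)%g; first exact: xa.
by rewrite mulVKg; exists p.
Qed.

Lemma finite_word_ball k : finite_set (word_ball S0 (k%:R%:E : \bar R)).
Proof.
suff H : forall x, finite_set [set y | walk k x y].
  by apply: sub_finite_set (H 1%g) => y /word_ballP.
elim: k => [|k IH] x.
  apply: (@sub_finite_set _ _ [set x]); last exact: finite_set1.
  by move=> y [[|a p] [_ /= <- ]].
apply: (@sub_finite_set _ _ ([set x] `|` \bigcup_(h in [set` S0]) [set y | walk k (x * h)%g y])).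
  by move=> y /walkS[->|[h hS w]]; [left|right; exists h].
rewrite finite_setU; split; first exact: finite_set1.
apply: bigcup_finite; first exact: finite_fset.
by move=> h _; exact: IH.
Qed.

Lemma mem_ball k x : x \in fset_set (word_ball S0 (k%:R%:E : \bar R)) <-> walk k 1%g x.
Proof.
rewrite in_fset_set; last exact: finite_word_ball.
by rewrite in_setE; exact: word_ballP.
Qed.

Lemma word_ball_card_mono k l : (k <= l)%N ->
  (word_ball_card R S0 k <= word_ball_card R S0 l)%N.
Proof.
move=> kl; apply: fsubset_leq_card; apply/fsubsetP => x /mem_ball /(walk_mono kl).
by move=> /mem_ball.
Qed.

Lemma count_walk_le x k (W : seq V) : uniq W ->
  (count (fun y => `[< walk k x y >]) W <= word_ball_card R S0 k)%N.
Proof.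
move=> uW; rewrite -size_filter -(size_map (fun z => (x^-1 * z)%g)) /word_ball_card.
apply: uniq_leq_size.
  rewrite map_inj_uniq ?filter_uniq// => a b /(congr1 (fun z => (x * z)%g)).
  by rewrite !mulVKg.
move=> _ /mapP[y yW ->]; apply/mem_ball.
move: yW; rewrite mem_filter => /andP[/asboolP w _].
by have /(walk_mulg x^-1%g) := w; rewrite mulVg.
Qed.

Lemma word_ball_card_cvgy : generates S0 -> infinite_set [set: V] ->
  forall M, exists n, (M <= word_ball_card R S0 n)%N.
Proof.
move=> gen inf M.
have reach x : exists k, walk k 1%g x.
  suff : [set x | exists k, walk k 1%g x] = setT by move=> h; have : [set: V] x by []; rewrite -h.
  apply: gen => /=.
  - by exists 0%N; exact: walk_refl.
  - move=> y z [k wy] [l wz]; exists (k + l)%N; apply: walk_trans wy _.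
    by have /(walk_mulg y) := wz; rewrite mulg1.
  - move=> y [k wy]; exists k; apply: walk_sym.
    by have /(walk_mulg y^-1%g) := wy; rewrite mulVg mulg1.
  - move=> y yS; exists 1%N; exists [:: y]; split=> //=.
    by rewrite /cayley_edge invg1 mul1g yS.
have [B BM1 BM2] := infinite_set_fset M inf.
have walks (l : seq V) : exists k, forall x, x \in l -> walk k 1%g x.
  elim: l => [|x l [k kP]]; first by exists 0%N.
  have [k' wx] := reach x; exists (k + k')%N => y; rewrite inE => /orP[/eqP->|yl].
    by apply: walk_mono wx; exact: leq_addl.
  by apply: walk_mono (kP y yl); exact: leq_addr.
have [k kP] := walks (enum_fset B).
exists k; apply: (leq_trans BM2).
apply: fsubset_leq_card; apply/fsubsetP => x xB; apply/mem_ball; exact: kP.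
Qed.

Lemma dist_set_ge (s : nat) (I J : seq V) :
  (forall x y, x \in I -> y \in J -> ~ walk (3 * s) x y) ->
  (s%:R%:E <= dist_set R S0 [set z | exists2 x, x \in I & walk s x z]
     [set z | exists2 y, y \in J & walk s y z])%E.
Proof.
move=> far; apply: le_ereal_inf_tmp => _ [a [x xI xa] [b [y yJ yb] <-]].
rewrite leNgt; apply/negP => dab.
have : (dist R S0 a b <= s%:R%:E)%E by exact: ltW.
move=> /dist_leP ab; apply: (far x y xI yJ).
have -> : (3 * s)%N = (s + s + s)%N by rewrite mulSn mul2n -addnn addnA.
by apply: walk_trans (walk_trans xa ab) (walk_sym yb).
Qed.

End Walks.

(** * Truncated scores *)

Section SigmaOf.
Context d (T : measurableType d) (V : eqType) (S : countType) (X : V -> T -> S).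

Lemma sigma_of_measurable (A : set V) : random_field X -> sigma_of X A `<=` measurable.
Proof.
move=> hX; apply: smallest_sub; first exact: sigma_algebra_measurable.
by move=> _ [x _ [D ->]]; exact: hX.
Qed.

Let sigma_ofI (A : set V) E F : sigma_of X A E -> sigma_of X A F -> sigma_of X A (E `&` F).
Proof. exact: (@measurableI _ (g_sigma_algebraType _)). Qed.

Lemma sigma_of_finite (Z : Type) (A : set V) (l : seq V) (f : T -> Z) :
  (forall x, x \in l -> A x) ->
  (forall t t', (forall x, x \in l -> X x t = X x t') -> f t = f t') ->
  forall D : set Z, sigma_of X A (f @^-1` D).
Proof.
move=> lA fl D.
pose atom (k : seq S) := [set t | map (X^~ t) l = k].
have atomP k : sigma_of X A (atom k).
  rewrite /atom; elim: l lA {fl atom} k => [|x l IH] lA [|s k] /=.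
  - rewrite (_ : [set _ | _] = setT) ?predeqE//.
    exact: (@measurableT _ (g_sigma_algebraType _)).
  - rewrite (_ : [set _ | _] = set0) ?predeqE//.
    exact: (@measurable0 _ (g_sigma_algebraType _)).
  - rewrite (_ : [set _ | _] = set0) ?predeqE//.
    exact: (@measurable0 _ (g_sigma_algebraType _)).
  rewrite (_ : [set _ | _] = X x @^-1` [set s] `&` [set t | map (X^~ t) l = k]); last first.
    by rewrite predeqE => t /=; split=> [[-> ->]|[-> ->]].
  apply: sigma_ofI; last by apply: IH => y yl; apply: lA; rewrite inE yl orbT.
  apply: sub_sigma_algebra; exists x; first by apply: lA; rewrite inE eqxx.
  by exists [set s].
have -> : f @^-1` D = \bigcup_(k in [set k | exists2 t, D (f t) & map (X^~ t) l = k]) atom k.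
  rewrite predeqE => t; split=> [Dt|[k [t' Dt' <-] e]]; first by exists (map (X^~ t) l) => //; exists t.
  rewrite /preimage /= (fl t t')// => x xl.
  have := congr1 (fun k => nth (X x t) k (index x l)) e.
  by rewrite !(nth_map x) ?index_mem// nth_index.
rewrite bigcup_mkcond.
pose G : set (set T) := [set E | exists2 x, A x & exists D : set S, E = X x @^-1` D].
apply: (@countable_bigcupT_measurable _ (g_sigma_algebraType G) (seq S)).
  exact: countableP.
by move=> k; case: ifP => _; [exact: atomP|exact: (@measurable0 _ (g_sigma_algebraType _))].
Qed.

Lemma finite_dependence_measurable (l : seq V) d' (Z : measurableType d') (f : T -> Z) :
  random_field X ->
  (forall t t', (forall x, x \in l -> X x t = X x t') -> f t = f t') ->
  measurable_fun setT f.
Proof.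
move=> hX fl _ D _; rewrite setTI; apply: (@sigma_of_measurable setT) => //.
exact: (@sigma_of_finite _ setT l).
Qed.

End SigmaOf.

Section AlphaBound.
Context d (T : measurableType d) (R : realType) (P : probability T R).
Context (V : groupType) (S0 : {fset V}) (S : countType) (X : V -> T -> S).

Lemma alpha_ge (s : R) (A B : set V) E F : random_field X ->
  (s%:E <= dist_set R S0 A B)%E -> sigma_of X A E -> sigma_of X B F ->
  forall c : R, (alpha P S0 X s <= c%:E)%E ->
  `|fine (P (E `&` F)) - fine (P E) * fine (P F)| <= c.
Proof.
move=> hX AB AE BF c ac.
have fin (G : set T) : measurable G -> P G \is a fin_num by exact: fin_num_measure.
have mE := sigma_of_measurable hX AE; have mF := sigma_of_measurable hX BF.
have mEF : measurable (E `&` F) by exact: measurableI.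
rewrite -lee_fin; apply: le_trans ac.
apply: (@le_trans _ _ (alpha_sets P X A B)); last first.
  by apply: ereal_sup_ubound; exists (A, B).
apply: ereal_sup_ubound; exists E => //; exists F => //.
by rewrite -abse_EFin EFinB EFinM !fineK ?fin.
Qed.

End AlphaBound.

Section TruncatedScore.
Context d (T : measurableType d) (R : realType).
Context (V : groupType) (S0 : {fset V}) (S : countType) (X : V -> T -> S).
Variable xi : V -> config V S -> R.
Hypothesis S0_sym : forall h, (h \in S0) = (h^-1%g \in S0).
Hypothesis xi_inv : forall x y c, xi (y * x)%g (translate_config y c) = xi x c.
Hypothesis hX : random_field X.

Local Notation Xn n t := (field_in_ball S0 X (n%:R%:E : \bar R) t).

Definition score (n : nat) (x : V) (t : T) : R := xi x (Xn n t).

Definition unstable (n s : nat) (x : V) : set T :=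
  [set t | (s%:R%:E <= stab_radius S0 xi x (Xn n t))%E].

Definition truncated_score (n s : nat) (b : R) (x : V) (t : T) : R :=
  if (t \notin unstable n s x) && (`|score n x t| <= b) then score n x t else 0.

Lemma score_finite n (t t' : T) :
  (forall z, z \in enum_fset (fset_set (word_ball S0 (n%:R%:E : \bar R))) -> X z t = X z t') ->
  Xn n t = Xn n t'.
Proof.
move=> tt'; apply/funext => z; rewrite /field_in_ball /restrict_config.
case: ifPn => // zW; rewrite tt'//.
by rewrite in_fset_set//; exact: finite_word_ball.
Qed.

Lemma measurable_score n x : measurable_fun setT (score n x).
Proof.
apply: (finite_dependence_measurable (l := enum_fset (fset_set (word_ball S0 (n%:R%:E : \bar R)))) hX).
by move=> t t' /score_finite; rewrite /score => ->.
Qed.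

Lemma measurable_unstable n s x : measurable (unstable n s x).
Proof.
have := @sigma_of_finite d T V S X _ setT (enum_fset (fset_set (word_ball S0 (n%:R%:E : \bar R))))
  (fun t => Xn n t) (fun _ _ => I) (fun t t' => @score_finite n t t')
  [set c | (s%:R%:E <= stab_radius S0 xi x c)%E].
exact: sigma_of_measurable.
Qed.

Lemma truncated_score_local n s b x t t' :
  (forall z, walk S0 s x z -> X z t = X z t') ->
  truncated_score n s b x t = truncated_score n s b x t'.
Proof.
have score1 u : score n x u = xi 1%g (translate_config x^-1%g (Xn n u)).
  by rewrite /score -(xi_inv x x^-1%g) mulVg.
pose W r := word_ball S0 (r%:R%:E : \bar R).
have agree u u' r : (r <= s)%N -> (forall z, walk S0 s x z -> X z u = X z u') ->
    restrict_config (translate_config x^-1%g (Xn n u)) (W r) =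
    restrict_config (translate_config x^-1%g (Xn n u')) (W r).
  move=> rs uu'; apply/funext => y; rewrite /restrict_config /translate_config.
  case: ifPn => // /set_mem /word_ballP /(walk_mono rs) wy.
  rewrite invgK /field_in_ball /restrict_config uu'//.
  by have /(walk_mulg S0 x) := wy; rewrite mulg1.
have stable u u' : (forall z, walk S0 s x z -> X z u = X z u') -> u \notin unstable n s x ->
    u' \notin unstable n s x /\ score n x u = score n x u'.
  move=> uu' /negP; rewrite in_setE /unstable /= => /negP; rewrite -ltNge.
  move=> /ereal_inf_lt[_ [r [r0 good] <-]]; rewrite lte_fin ltr_nat => rs.
  have e := agree u u' r (ltnW rs) uu'.
  have sc := good _ (esym e).
  split; last by rewrite !score1.
  apply/negP; rewrite in_setE /unstable /= leNgt => /negP; apply.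
  apply: (@le_lt_trans _ _ (r%:R%:E)); last by rewrite lte_fin ltr_nat.
  apply: ereal_inf_lbound; exists r => //; split=> // c' cc'.
  by rewrite -sc; apply: good; rewrite cc' e.
move=> tt'; have t't z : walk S0 s x z -> X z t' = X z t by move=> /tt'.
rewrite /truncated_score.
have [tU|tU] := boolP (t \notin unstable n s x).
  by have [-> ->] := stable _ _ tt' tU.
have [t'U|//] := boolP (t' \notin unstable n s x).
by have [h _] := stable _ _ t't t'U; rewrite h in tU.
Qed.

Lemma norm_truncated_score_le n s b x t : 0 <= b -> `|truncated_score n s b x t| <= b.
Proof. by move=> b0; rewrite /truncated_score; case: ifP => [/andP[]//|_]; rewrite normr0. Qed.

Lemma measurable_truncated_score n s b x : measurable_fun setT (truncated_score n s b x).
Proof.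
apply: (finite_dependence_measurable (l := enum_fset (fset_set (word_ball S0 (n%:R%:E : \bar R)))) hX).
move=> t t' /score_finite e; rewrite /truncated_score /score e.
have -> : (t \notin unstable n s x) = (t' \notin unstable n s x).
  by congr (~~ _); apply/idP/idP; rewrite !in_setE /unstable /= e.
by [].
Qed.

End TruncatedScore.

Section LocalDecoupling.
Context d (T : measurableType d) (R : realType) (P : probability T R).
Context (V : groupType) (S0 : {fset V}) (S : countType) (X : V -> T -> S).
Hypothesis S0_sym : forall h, (h \in S0) = (h^-1%g \in S0).
Hypothesis hX : random_field X.
Variables (s : nat) (Z : V -> T -> R).
Hypothesis Z_local : forall x t t', (forall z, walk S0 s x z -> X z t = X z t') -> Z x t = Z x t'.
Hypothesis Z_le1 : forall x t, `|Z x t| <= 1.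

Definition walk_neighbourhood (l : seq V) : set V := [set z | exists2 x, x \in l & walk S0 s x z].

Lemma prod_local_sigma (l : seq V) D :
  sigma_of X (walk_neighbourhood l) ((fun t => \prod_(x <- l) Z x t) @^-1` D).
Proof.
pose B := enum_fset (fset_set (word_ball S0 (s%:R%:E : \bar R))).
pose pts := flatten [seq [seq (x * y)%g | y <- B] | x <- l].
apply: (@sigma_of_finite _ _ _ _ X _ _ pts).
  move=> z /flattenP[_ /mapP[x xl ->] /mapP[y yB ->]]; exists x => //.
  have /mem_ball wy : y \in fset_set (word_ball S0 (s%:R%:E : \bar R)) by [].
  by have /(walk_mulg S0 x) := wy; rewrite mulg1.
move=> t t' tt'; apply: eq_big_seq => x xl; apply: Z_local => z wz; apply: tt'.
apply/flattenP; exists [seq (x * y)%g | y <- B]; first exact: map_f.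
apply/mapP; exists (x^-1 * z)%g; last by rewrite mulVKg.
apply/(mem_ball R S0 s).
by have /(walk_mulg S0 x^-1%g) := wz; rewrite mulVg.
Qed.

Lemma norm_prod_local_le (l : seq V) t : `|\prod_(x <- l) Z x t| <= 1.
Proof.
elim: l => [|x l IH]; first by rewrite big_nil normr1.
by rewrite big_cons normrM mulr_ile1.
Qed.

Lemma decoupling (I J : seq V) (c : R) :
  (alpha P S0 X s%:R <= c%:E)%E ->
  (forall x y, x \in I -> y \in J -> ~ walk S0 (3 * s) x y) ->
  `|mean P (fun t => (\prod_(x <- I) Z x t) * \prod_(y <- J) Z y t)
    - mean P (fun t => \prod_(x <- I) Z x t) * mean P (fun t => \prod_(y <- J) Z y t)| <= 4 * c.
Proof.
move=> ac far.
apply: (@covariance_mixing_le _ _ _ P (sigma_of X (walk_neighbourhood I))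
  (sigma_of X (walk_neighbourhood J))).
- exact: sigma_of_measurable.
- exact: sigma_of_measurable.
- move=> E F IE JF; apply: (alpha_ge hX _ IE JF ac).
  exact: dist_set_ge.
- exact: norm_prod_local_le.
- exact: norm_prod_local_le.
- exact: prod_local_sigma.
- exact: prod_local_sigma.
Qed.

End LocalDecoupling.

Section TruncationError.
Context d (T : measurableType d) (R : realType) (P : probability T R).

Lemma mean_truncation_error_le (f : T -> R) (G : set T) (b la q C1 C2 : R) :
  measurable_fun setT f -> measurable G ->
  measurable_fun setT (fun t => if (t \notin G) && (`|f t| <= b) then f t else 0) ->
  0 < b -> 0 < la -> 0 <= q ->
  in_L1 P (fun t => Num.max `|f t| 1 `^ 4) -> in_L1 P (fun t => Num.max `|f t| 1 `^ (2 + q)) ->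
  mean P (fun t => Num.max `|f t| 1 `^ 4) <= C1 ->
  mean P (fun t => Num.max `|f t| 1 `^ (2 + q)) <= C2 ->
  let D t := f t - (if (t \notin G) && (`|f t| <= b) then f t else 0) in
  in_L1 P (fun t => D t ^+ 2) /\
  mean P (fun t => D t ^+ 2) <= la * C1 + la^-1 * fine (P G) + C2 / b `^ q.
Proof.
move=> mf mG mg b0 la0 q0 L4 Lq m4 mq D.
have GL : in_L1 P (\1_G : T -> R).
  apply: (@in_L1_bounded _ _ _ _ _ 1) => [|t]; first exact: measurable_indic.
  by rewrite indicE; case: (_ \in _); rewrite ?normr1 ?normr0.
pose B t := la * (Num.max `|f t| 1 `^ 4) + la^-1 * \1_G t + (b `^ q)^-1 * (Num.max `|f t| 1 `^ (2 + q)).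
have BL : in_L1 P B by apply: in_L1D; [apply: in_L1D; exact: in_L1Z|exact: in_L1Z].
have bq0 : 0 < b `^ q by exact: powR_gt0.
have DB t : `|D t ^+ 2| <= B t.
  rewrite /D /B; set M := Num.max _ _.
  have M1 : 1 <= M by rewrite le_max lexx orbT.
  have fM : `|f t| <= M by rewrite le_max lexx.
  have M4 : M `^ 4 = (M ^+ 2) ^+ 2 by rewrite powR_mulrn ?(le_trans ler01)// -exprM.
  have Mq : M `^ (2 + q) = M ^+ 2 * M `^ q.
    rewrite powRD; last by apply/implyP => _; rewrite gt_eqF//; lra.
    by rewrite powR_mulrn// (le_trans ler01).
  have f2 : f t ^+ 2 <= M ^+ 2.
    by rewrite -(real_normK (num_real (f t))) lerXn2r// ?nnegrE// (le_trans ler01).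
  have t1 : 0 <= la * M `^ 4 by rewrite mulr_ge0 ?powR_ge0// ltW.
  have t2 : 0 <= la^-1 * \1_G t by rewrite mulr_ge0 ?invr_ge0 ?(ltW la0)// indicE.
  have t3 : 0 <= (b `^ q)^-1 * M `^ (2 + q) by rewrite mulr_ge0 ?powR_ge0// invr_ge0 ltW.
  rewrite ger0_norm ?sqr_ge0//.
  have [tG|tG] /= := boolP (t \in G).
    rewrite subr0; apply: (@le_trans _ _ (la * M `^ 4 + la^-1 * \1_G t)); last by lra.
    rewrite indicE tG mulr1; apply: le_trans f2 _; rewrite M4.
    set y := M ^+ 2; have y0 : 0 <= y by exact: sqr_ge0.
    have lv : la * la^-1 = 1 by rewrite divff// gt_eqF.
    have : 0 <= la * (y - la^-1) ^+ 2 by rewrite mulr_ge0 ?sqr_ge0// ltW.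
    have -> : la * (y - la^-1) ^+ 2 = la * y ^+ 2 - 2 * (la * la^-1) * y + la * la^-1 * la^-1 by ring.
    by rewrite lv mulr1 mul1r; lra.
  have [fb|fb] := leP `|f t| b; first by rewrite subrr expr0n /=; lra.
  rewrite subr0; apply: (@le_trans _ _ ((b `^ q)^-1 * M `^ (2 + q))); last by lra.
  rewrite Mq mulrC -mulrA; apply: le_trans f2 _; rewrite ler_peMr ?sqr_ge0//.
  rewrite ler_pdivlMr// mul1r ge0_ler_powR ?nnegrE ?(ltW b0)//; first by rewrite (le_trans ler01).
  by rewrite (le_trans (ltW fb)).
have mD : measurable_fun setT (fun t => D t ^+ 2).
  by apply: measurable_funX; exact: measurable_funB.
split; first exact: in_L1_le DB BL.
apply: (@le_trans _ _ (mean P B)).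
  apply: mean_le => // [|t]; first exact: in_L1_le DB BL.
  by apply: le_trans (DB t); exact: ler_norm.
rewrite /B meanD; [|by apply: in_L1D; exact: in_L1Z|exact: in_L1Z].
rewrite meanD; [|exact: in_L1Z..].
rewrite !meanZ// mean_indic// [C2 / _]mulrC.
apply: lerD; last by rewrite ler_wpM2l// invr_ge0 ltW.
by rewrite lerD2r ler_wpM2l// ltW.
Qed.

End TruncationError.

Lemma moment_cumulant_list_sum (R : realFieldType) (A : eqType) (W : seq A) (E : seq A -> R) :
  E [::] = 1 ->
  moment_cumulant (fun n => list_sum W n E) (fun n => list_sum W n (joint_cumulant E)).
Proof.
move=> E0; split=> [|n]; first by [].
rewrite /= (eq_bigr (fun x => \sum_(j < n.+1)
   (list_sum W j (fun l => joint_cumulant E (x :: l)) * list_sum W (n - j) E) *+ 'C(n, j))).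
  by rewrite exchange_big; apply: eq_bigr => j _ /=; rewrite sumrMnl mulr_suml.
move=> x _; rewrite -list_sum_splits; apply: eq_list_sum => l.
exact: joint_cumulantE.
Qed.

Section RandomMoments.
Context d (T : measurableType d) (R : realType) (P : probability T R).

Lemma positive_moments_mean (Y : T -> R) :
  (forall k, in_L1 P (fun t => Y t ^+ k)) ->
  positive_moments (fun k => mean P (fun t => Y t ^+ k)).
Proof.
move=> YL N x.
have -> : \sum_(i < N) \sum_(j < N) x i * x j * mean P (fun t => Y t ^+ (i + j)) =
    mean P (fun t => (\sum_(i < N) x i * Y t ^+ i) ^+ 2); last first.
  by apply: mean_ge0 => t; exact: sqr_ge0.
transitivity (mean P (fun t => \sum_(i < N) \sum_(j < N) x i * x j * Y t ^+ (i + j))).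
  rewrite mean_sum; last by move=> i; apply: in_L1_sum => j; exact: in_L1Z.
  apply: eq_bigr => i _; rewrite mean_sum; last by move=> j; exact: in_L1Z.
  by apply: eq_bigr => j _; rewrite meanZ.
congr mean; apply/funext => t; rewrite expr2 mulr_suml; apply: eq_bigr => i _.
by rewrite mulr_sumr; apply: eq_bigr => j _; rewrite exprD; ring.
Qed.

Lemma mean_list_sum (A : Type) (W : seq A) n (F : seq A -> T -> R) :
  (forall l, in_L1 P (F l)) ->
  in_L1 P (fun t => list_sum W n (fun l => F l t)) /\
  mean P (fun t => list_sum W n (fun l => F l t)) = list_sum W n (fun l => mean P (F l)).
Proof.
elim: n F => [|n IH] F FL /=; first by [].
have IHx x := IH (fun l => F (x :: l)) (fun l => FL (x :: l)).
split; first by apply: in_L1_sum => x; exact: (IHx x).1.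
rewrite mean_sum; last by move=> x; exact: (IHx x).1.
by apply: eq_bigr => x _; rewrite (IHx x).2.
Qed.

Lemma mean_centered_sqr_le (X : T -> R) : in_L1 P X -> in_L1 P (fun t => X t ^+ 2) ->
  in_L1 P (fun t => (X t - mean P X) ^+ 2) /\
  mean P (fun t => (X t - mean P X) ^+ 2) <= mean P (fun t => X t ^+ 2).
Proof.
move=> XL X2.
have e : (fun t => (X t - mean P X) ^+ 2) =
    (fun t => X t ^+ 2 + (- (2 * mean P X) * X t + mean P X ^+ 2)).
  by apply/funext => t; ring.
have L1 : in_L1 P (fun t => - (2 * mean P X) * X t) by exact: in_L1Z.
have L2 : in_L1 P (fun t => - (2 * mean P X) * X t + mean P X ^+ 2).
  by apply: in_L1D => //; exact: in_L1_cst.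
rewrite e; split; first exact: in_L1D.
rewrite meanD// meanD//; last exact: in_L1_cst.
rewrite meanZ// mean_cst; have := sqr_ge0 (mean P X); rewrite expr2; lra.
Qed.

Lemma in_L1_sqr (X : T -> R) : measurable_fun setT X -> in_L1 P (fun t => X t ^+ 2) -> in_L1 P X.
Proof.
move=> mX X2; apply: (@in_L1_le _ _ _ _ _ (fun t => X t ^+ 2 + 1)) => // [t|].
  rewrite -(real_normK (num_real (X t))); set y := `|X t|.
  rewrite -subr_ge0; have -> : y ^+ 2 + 1 - y = (y - 1 / 2) ^+ 2 + 3 / 4 by field.
  by rewrite addr_ge0 ?sqr_ge0.
by apply: in_L1D => //; exact: in_L1_cst.
Qed.

End RandomMoments.

Lemma sqr_sum_le (R : realFieldType) (A : Type) (l : seq A) (a : A -> R) :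
  (\sum_(x <- l) a x) ^+ 2 <= (size l)%:R * \sum_(x <- l) a x ^+ 2.
Proof.
have : 0 <= \sum_(x <- l) \sum_(y <- l) (a x - a y) ^+ 2.
  by apply: sumr_ge0 => x _; apply: sumr_ge0 => y _; exact: sqr_ge0.
have -> : \sum_(x <- l) \sum_(y <- l) (a x - a y) ^+ 2 =
   2 * ((size l)%:R * (\sum_(x <- l) a x ^+ 2) - (\sum_(x <- l) a x) ^+ 2).
  have sc (c : R) : \sum_(x <- l) c = (size l)%:R * c.
    by rewrite big_const_seq iter_addr_0 count_predT mulr_natl.
  transitivity (\sum_(x <- l) ((size l)%:R * a x ^+ 2 + \sum_(y <- l) a y ^+ 2 - 2 * a x * \sum_(y <- l) a y)).
    apply: eq_bigr => x _; rewrite mulr_sumr -sc -big_split -sumrB /=.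
    by apply: eq_bigr => y _; ring.
  by rewrite sumrB big_split /= -mulr_sumr sc -mulr_suml -mulr_sumr; ring.
by rewrite pmulr_rge0// subr_ge0.
Qed.

Section Asymptotics.
Context {R : realType}.

Lemma esup_lne_lt0 (f : R -> \bar R) (g : R -> R) :
  (limf_esup (fun s => (g s)%:E * lne (f s))%E (pinfty_nbhs R) < 0)%E ->
  (forall s, 0 < s -> 0 < g s) ->
  exists2 de : R, 0 < de & exists M : R, forall s, M < s -> 0 < s ->
    (f s <= (expR (- (de / g s)))%:E)%E.
Proof.
rewrite limf_esupE => /ereal_inf_lt[_ [A FA <-] supA] g0.
have [de de0 supde] : exists2 de : R, 0 < de & (ereal_sup [set ((g s)%:E * lne (f s))%E | s in A] <= (- de)%:E)%E.
  move: supA; case: (ereal_sup _) => [r| |]//.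
    by rewrite lte_fin => r0; exists (- r); rewrite ?opprK// oppr_gt0.
  by exists 1; rewrite ?leNye.
case: FA => M [_ MA]; exists de => //; exists M => s Ms s0.
have : ((g s)%:E * lne (f s) <= (- de)%:E)%E.
  by apply: le_trans supde; apply: ereal_sup_ubound; exists s => //; exact: MA.
have gs := g0 s s0.
case: (f s) => [r| |] /=.
- case: ifPn => [r0 _|]; first by rewrite lee_fin (le_trans r0)// expR_ge0.
  rewrite -ltNge => r0; rewrite -EFinM !lee_fin => h.
  rewrite -[leLHS]lnK ?posrE// ler_expR -mulNr ler_pdivlMr// mulrC.
  exact: h.
- by rewrite gt0_muley ?lte_fin// leye_eq.
- by rewrite leNye.
Qed.

Lemma expR_powR_le (c be q : R) : 0 < c -> 0 < be -> 0 <= q ->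
  exists2 M : R, 1 <= M & forall y, M <= y -> expR (- (c * y `^ be)) <= y `^ (- q).
Proof.
move=> c0 be0 q0.
pose n := Num.truncn ((q + 1) / be).
have nq : q + 1 <= be * n.+1%:R.
  by rewrite -ler_pdivrMl// mulrC ltW// truncnS_gt.
pose C := n.+1`!%:R / c ^+ n.+1.
have f0 : 0 < n.+1`!%:R :> R by rewrite ltr0n fact_gt0.
have cn0 : 0 < c ^+ n.+1 by rewrite exprn_gt0.
have C0 : 0 < C by rewrite divr_gt0.
exists (1 + C); first by lra.
move=> y yM; have y1 : 1 <= y by lra.
have y0 : 0 < y by lra.
rewrite expRN powRN lef_pV2 ?posrE ?expR_gt0 ?powR_gt0//.
have z0 : 0 <= c * y `^ be by rewrite mulr_ge0 ?powR_ge0// ltW.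
have := expR_ge1Dxn n z0 => h.
apply: (@le_trans _ _ ((c * y `^ be) ^+ n.+1 / n.+1`!%:R)); last by lra.
rewrite exprMn -[(y `^ be) ^+ _]powR_mulrn ?powR_ge0// -powRrM.
apply: (@le_trans _ _ (c ^+ n.+1 * y `^ (q + 1) / n.+1`!%:R)); last first.
  by rewrite ler_pM2r ?invr_gt0// ler_pM2l// ler_powR.
rewrite powRD; last by apply/implyP => _; rewrite gt_eqF.
rewrite powRr1 ?(ltW y0)// ler_pdivlMr//.
rewrite mulrCA ler_pM2l ?powR_gt0//.
have : C <= y by lra.
by rewrite /C ler_pdivrMr// mulrC => /le_trans; apply; rewrite mulrC.
Qed.

Lemma powRN_cvg0 (u : nat -> R) (x : R) : 0 < x ->
  (forall M : R, \forall n \near \oo, M <= u n) ->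
  u n `^ (- x) @[n --> \oo] --> (0 : R).
Proof.
move=> x0 uy; apply/cvgr0Pnorm_le => e e0.
near=> n.
have u1 : 1 <= u n by near: n; exact: uy.
have ue : (e^-1) `^ (x^-1) <= u n by near: n; exact: uy.
rewrite ger0_norm ?powR_ge0// powRN -[leRHS]invrK.
rewrite lef_pV2 ?posrE ?invr_gt0 ?powR_gt0//; last by lra.
have -> : e^-1 = (e^-1 `^ x^-1) `^ x.
  by rewrite -powRrM mulVf ?gt_eqF// powRr1// invr_ge0 ltW.
by rewrite ge0_ler_powR ?(ltW x0)// nnegrE ?powR_ge0//; lra.
Unshelve. all: by end_near. Qed.

Lemma norm_cosB_le (u v : R) : `|cos u - cos v| <= `|u - v|.
Proof.
wlog uv : u v / u <= v.
  move=> h; have [uv|/ltW vu] := leP u v; first exact: h.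
  by rewrite distrC (distrC u); exact: h.
have [x _ e] : exists2 c, c \in `[u, v]%R & cos v - cos u = - sin c * (v - u).
  apply: (@MVT_segment _ cos (fun x => - sin x)) => //.
  by apply: continuous_subspaceT => x; exact: continuous_cos.
rewrite distrC e normrM normrN distrC ler_piMl//; exact: sin_max.
Qed.

End Asymptotics.

(** * The central limit theorem *)

(* [normal_prob] is a measure for the sigma-algebra generated by the half-open
   intervals, whereas [\int[mu]_x] with [mu : set R -> \bar R] uses the default
   measurable structure of [R], with the same measurable sets but another
   display: the two integrals are related by pushing forward along the identity. *)
Lemma integral_normal_prob_mean (R : realType) (f : R -> R) (mu : set R -> \bar R) :
  mu = normal_prob 0 1 -> in_L1 (normal_prob (0 : R) 1) f ->
  (\int[mu]_x (f x)%:E = (mean (normal_prob (0 : R) 1) f)%:E)%E.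
Proof.
move=> -> fL; have := expectation_mean fL; rewrite expectation.unlock => <-.
have mid : measurable_fun (@setT (measurableTypeR R)) (idfun : measurableTypeR R -> R).
  by move=> _ D mD; rewrite setTI.
have mf : measurable_fun (setT : set R) (EFin \o f).
  by apply/measurable_EFinP; exact: (in_L1_measurable fL).
have := @integral_pushforward _ _ (measurableTypeR R) R R idfun mid (normal_prob (0 : R) 1) setT (EFin \o f) mf fL measurableT.
exact.
Qed.

Section CentralLimit.
Context (R : realType) (V : groupType) (S0 : {fset V}).
Hypothesis hG : cayley_generators S0.
Context (d : measure_display) (T : measurableType d) (P : probability T R).
Context (S : countType) (X : V -> T -> S).
Hypothesis hX : random_field X.
Hypothesis hmix : exponentially_alpha_mixing P S0 X.
Variable xi : V -> config V S -> R.
Hypothesis hxi : score_function xi.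
Hypothesis hql : exponentially_quasi_local P S0 X xi.
Hypothesis hmom : forall p : R, 1 <= p -> moment_condition P S0 X xi p.
Variable nu : R.
Hypothesis hnu : 0 < nu.
Local Notation W n := (enum_fset (fset_set (word_ball S0 (n%:R%:E : \bar R)))).
Local Notation w n := ((word_ball_card R S0 n)%:R : R).
Variable cvar : R.
Hypothesis cvar0 : 0 < cvar.
Hypothesis hvar : \forall n \near \oo,
  ((cvar * w n `^ nu)%:E <= 'V_P[total_score S0 X xi n])%E.
Variables d2 C2 : R.
Hypothesis d20 : 0 < d2.
Hypothesis hgrowth : \forall n \near \oo, w n <= C2 * n%:R `^ d2.

Let S0_sym : forall h, (h \in S0) = (h^-1%g \in S0).
Proof. by case: hG. Qed.

Let w_ge (M : R) : \forall n \near \oo, M <= w n.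
Proof.
have [_ inf gen _ _] := hG.
have [n0 n0M] := @word_ball_card_cvgy R V S0 S0_sym gen inf (Num.truncn M).+1.
exists n0 => // n /= n0n; rewrite ltW// (lt_le_trans (truncnS_gt M))// ler_nat.
by rewrite (leq_trans n0M)//; exact: word_ball_card_mono.
Qed.

Let w_ge1 n : 1 <= w n.
Proof.
rewrite ler1n /word_ball_card cardfs_gt0; apply/fset0Pn; exists 1%g.
by apply/mem_ball; exact: walk_refl.
Qed.

Let w_gt0 n : 0 < w n. Proof. by apply: lt_le_trans (w_ge1 n). Qed.

(* The truncation level is [b n] and the stabilisation range [s n].  As
   [2 b n / sqrt Var] is of order at most [w n ^ (- 3 nu / 8)] and a point has at
   most [C w n ^ (nu / 8)] neighbours at distance [O(s n)], the cumulant of order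
   [j] of the truncated sum is of order at most [w n ^ (1 - nu j / 4)]. *)
Let de := nu / 8.
Let eta := nu / 8 / d2.
Let s n := Num.truncn (w n `^ eta).
Let b n := w n `^ de.

Let de0 : 0 < de. Proof. by rewrite divr_gt0. Qed.
Let eta0 : 0 < eta. Proof. by rewrite divr_gt0. Qed.
Let b_gt0 n : 0 < b n. Proof. exact: powR_gt0. Qed.

Let w_pow_ge (x M : R) : 0 < x -> \forall n \near \oo, M <= w n `^ x.
Proof.
move=> x0; apply: filterS (w_ge (`|M| `^ x^-1)) => n h.
apply: le_trans (ler_norm M) _.
have -> : `|M| = (`|M| `^ x^-1) `^ x by rewrite -powRrM mulVf ?gt_eqF// powRr1.
by rewrite ge0_ler_powR ?(ltW x0)// nnegrE ?powR_ge0.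
Qed.

Let w_powD n x y : w n `^ (x + y) = w n `^ x * w n `^ y.
Proof. by rewrite powRD//; apply/implyP => _; rewrite gt_eqF. Qed.

Let s_ge : \forall n \near \oo, w n `^ eta / 2 <= (s n)%:R.
Proof.
apply: filterS (w_pow_ge 2 eta0) => n h.
by have := truncnS_gt (w n `^ eta); rewrite -/(s n) -natr1; lra.
Qed.

Let superpoly (f : R -> \bar R) (g : R -> R) (be q : R) : 0 < be -> 0 <= q ->
  (forall x, 0 < x -> g x = x `^ (- be)) ->
  (limf_esup (fun x => (g x)%:E * lne (f x))%E (pinfty_nbhs R) < 0)%E ->
  \forall n \near \oo, (f (s n)%:R <= (w n `^ (- q))%:E)%E.
Proof.
move=> be0 q0 gE lim.
have g0 x : 0 < x -> 0 < g x by move=> x0; rewrite gE// powR_gt0.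
have [dl dl0 [M0 fM]] := esup_lne_lt0 lim g0.
pose c := dl * (1 / 2) `^ be.
have c0 : 0 < c by rewrite mulr_gt0// powR_gt0// divr_gt0.
have [M1 M11 hM1] := expR_powR_le c0 (mulr_gt0 eta0 be0) q0.
near=> n.
have h1 : M1 <= w n by near: n; exact: w_ge.
have h2 : 2 * `|M0| + 2 <= w n `^ eta by near: n; exact: w_pow_ge.
have h3 : w n `^ eta / 2 <= (s n)%:R by near: n; exact: s_ge.
have M0n := ler_norm M0; have M0n' := normr_ge0 M0.
apply: le_trans (fM _ _ _) _; [by lra|by lra|].
have sn0 : 0 < (s n)%:R :> R by lra.
rewrite lee_fin; apply: le_trans (hM1 _ h1); rewrite ler_expR lerN2.
rewrite gE// powRN invrK /c powRrM -mulrA ler_pM2l// -powRM ?powR_ge0//.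
apply: ge0_ler_powR; rewrite ?nnegrE ?mulr_ge0 ?powR_ge0 ?(ltW be0)//; lra.
Unshelve. all: by end_near. Qed.

Let alpha_small q : 0 <= q ->
  \forall n \near \oo, (alpha P S0 X (s n)%:R <= (w n `^ (- q))%:E)%E.
Proof. by move=> q0; have [be be0 lim] := hmix; exact: (@superpoly _ (fun x => x `^ (- be)) be). Qed.

Local Notation unst n x := (unstable S0 X xi n (s n) x).

Let scalesP n x : (1 <= n)%N -> x \in W n -> @scales R V S0 (n%:R%:E, x).
Proof.
move=> n1 xW; split; first by left; exists n.
by apply/word_ballP; exact/(mem_ball R S0 n).
Qed.

Let unstable_small q : 0 <= q -> exists2 a : R, 0 <= a & \forall n \near \oo,
  forall x, x \in W n -> fine (P (unst n x)) <= a * w n `^ (- q).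
Proof.
move=> q0; have [a [phi [a0 _ _ tail [c c0 lim]]]] := hql.
exists a; first exact: ltW.
have lim' : (limf_esup (fun x => (x `^ (- c))%:E * lne (phi x)%:E)%E (pinfty_nbhs R) < 0)%E.
  by move: lim; congr (limf_esup _ _ < 0)%E; apply/funext => x; rewrite muleC powRN.
near=> n => x xW.
have n1 : (1 <= n)%N by near: n; exact: nbhs_infty_ge.
have h : ((phi (s n)%:R)%:E <= (w n `^ (- q))%:E)%E.
  by near: n; exact: (@superpoly (EFin \o phi) (fun x => x `^ (- c)) c).
rewrite lee_fin in h.
have mU := measurable_unstable S0 xi hX n (s n) x.
rewrite -lee_fin fineK; last exact: fin_num_measure.
apply: le_trans (le_trans _ (tail (s n)%:R)) _; last by rewrite lee_fin ler_wpM2l// ltW.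
by apply: ereal_sup_ubound; exists (n%:R%:E, x) => //; exact: scalesP.
Unshelve. all: by end_near. Qed.

Local Notation sc n x := (score S0 X xi n x).
Local Notation Mx n x t := (Num.max `|score S0 X xi n x t| 1).

Let msc n x : measurable_fun setT (sc n x).
Proof. exact: measurable_score. Qed.

Let moments p : 1 <= p -> exists C : R, forall n x, (1 <= n)%N -> x \in W n ->
  in_L1 P (fun t => Mx n x t `^ p) /\ mean P (fun t => Mx n x t `^ p) <= C.
Proof.
move=> p1; have := hmom p1; rewrite /moment_condition; set sup := ereal_sup _ => supy.
exists (fine sup) => n x n1 xW.
have le : ('E_P[fun t => (Mx n x t `^ p)%R] <= sup)%E.
  by apply: ereal_sup_ubound; exists (n%:R%:E, x) => //; exact: scalesP.
have mM : measurable_fun setT (fun t => Mx n x t `^ p).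
  apply: (measurableT_comp (f := fun y => y `^ p)); first exact: measurable_powR.
  by apply: measurable_maxr => //; exact: measurableT_comp.
have L : in_L1 P (fun t => Mx n x t `^ p).
  apply/integrableP; split; first exact/measurable_EFinP.
  apply: le_lt_trans supy; apply: le_trans le; rewrite unlock le_eqVlt; apply/orP; left; apply/eqP.
  by apply: eq_integral => t _; rewrite /= ger0_norm// powR_ge0.
split=> //; have := le; rewrite expectation_mean// => le'.
have m0 : 0 <= mean P (fun t => Mx n x t `^ p) by apply: mean_ge0 => t; exact: powR_ge0.
have supf : sup \is a fin_num.
  by rewrite fin_numElt supy andbT (lt_le_trans _ le')// ltNyr.
by rewrite -lee_fin (fineK supf).
Qed.

Local Notation tr n x := (truncated_score S0 X xi n (s n) (b n) x).

Let mtr n x : measurable_fun setT (tr n x).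
Proof. exact: measurable_truncated_score. Qed.

Let Dl n t := \sum_(x <- W n) (sc n x t - tr n x t).

Let truncation_error : exists C : R, \forall n \near \oo, forall x, x \in W n ->
  in_L1 P (fun t => (sc n x t - tr n x t) ^+ 2) /\
  mean P (fun t => (sc n x t - tr n x t) ^+ 2) <= C * w n `^ (-3).
Proof.
have [C1 m4] := @moments 4 ltac:(lra).
have q0 : 0 <= 3 / de by rewrite divr_ge0// ltW.
have [C3 mq] := @moments (2 + 3 / de) ltac:(lra).
have [a a0 un] := @unstable_small 6 ltac:(lra).
exists (C1 + a + C3); near=> n => x xW.
have n1 : (1 <= n)%N by near: n; exact: nbhs_infty_ge.
have unx : fine (P (unst n x)) <= a * w n `^ (- 6).
  by move: x xW; near: n; exact: un.
have [L4 l4] := m4 n x n1 xW; have [Lq lq] := mq n x n1 xW.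
have la0 : 0 < w n `^ (-3) by exact: powR_gt0.
have [L le] := mean_truncation_error_le (msc n x) (measurable_unstable S0 xi hX n (s n) x)
  (mtr n x) (b_gt0 n) la0 q0 L4 Lq l4 lq.
split; first exact: L.
apply: le_trans le _.
have e1 : (w n `^ (- 3))^-1 * w n `^ (- 6) = w n `^ (-3).
  by rewrite -powRN -w_powD; congr (_ `^ _); ring.
have e2 : b n `^ (3 / de) = w n `^ 3.
  by rewrite /b -powRrM; congr (_ `^ _); field; rewrite gt_eqF.
rewrite e2 -[C3 / _]/(C3 * (w n `^ 3)^-1) -[(w n `^ 3)^-1]powRN.
have : (w n `^ (- 3))^-1 * fine (P (unst n x)) <= a * w n `^ (-3).
  by rewrite -[in leRHS]e1 mulrCA ler_wpM2l// invr_ge0 ltW.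
by rewrite !mulrDl (mulrC C1); lra.
Unshelve. all: by end_near. Qed.

Let mDl n : measurable_fun setT (Dl n).
Proof. by apply: measurable_sum => x; exact: measurable_funB. Qed.

Let sum_const (r : seq V) (c : R) : \sum_(x <- r) c = (size r)%:R * c.
Proof. by rewrite big_const_seq iter_addr_0 count_predT mulr_natl. Qed.

Let total_error : exists C : R, \forall n \near \oo,
  in_L1 P (fun t => Dl n t ^+ 2) /\ mean P (fun t => Dl n t ^+ 2) <= C * w n `^ (-1).
Proof.
have [C hC] := truncation_error; exists C; near=> n.
have hx x : x \in W n -> in_L1 P (fun t => (sc n x t - tr n x t) ^+ 2) /\
  mean P (fun t => (sc n x t - tr n x t) ^+ 2) <= C * w n `^ (-3).
  by move: x; near: n.
have sL : in_L1 P (fun t => (size (W n))%:R * \sum_(x <- W n) (sc n x t - tr n x t) ^+ 2).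
  by apply: in_L1Z; apply: in_L1_sum_in => x /hx[].
have le t : `|Dl n t ^+ 2| <= (size (W n))%:R * \sum_(x <- W n) (sc n x t - tr n x t) ^+ 2.
  by rewrite ger0_norm ?sqr_ge0//; exact: sqr_sum_le.
have DL : in_L1 P (fun t => Dl n t ^+ 2) by apply: in_L1_le le sL; exact: measurable_funX.
split=> //.
apply: (@le_trans _ _ (mean P (fun t => (size (W n))%:R * \sum_(x <- W n) (sc n x t - tr n x t) ^+ 2))).
  by apply: mean_le => // t; apply: le_trans (le t); exact: ler_norm.
rewrite meanZ; last by apply: in_L1_sum_in => x /hx[].
rewrite mean_sum_in; last by move=> x /hx[].
apply: (@le_trans _ _ ((size (W n))%:R * \sum_(x <- W n) C * w n `^ (-3))).
  rewrite ler_wpM2l// big_seq [leRHS]big_seq; apply: ler_sum => x xW; exact: (hx x xW).2.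
rewrite sum_const -[(size (W n))%:R]/(w n).
have -> : w n `^ (-1) = w n * w n * w n `^ (-3).
  by rewrite -{2 3}(powRr1 (ltW (w_gt0 n))) -!w_powD; congr (_ `^ _); ring.
by rewrite le_eqVlt; apply/orP; left; apply/eqP; ring.
Unshelve. all: by end_near. Qed.

Let H n t := \sum_(x <- W n) sc n x t.
Let sg n := Num.sqrt (fine 'V_P[total_score S0 X xi n]).
Let Y n t := (H n t - mean P (H n)) / sg n.

Let mH n : measurable_fun setT (H n).
Proof. by apply: measurable_sum => x; exact: msc. Qed.

Let mY n : measurable_fun setT (Y n).
Proof. by apply: measurable_funM => //; exact: measurable_funB. Qed.

Let totalE n : total_score S0 X xi n = H n.
Proof.
apply/funext => t; rewrite /total_score fsbig_finite//; exact: finite_word_ball.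
Qed.

Let fine_expectation (f : T -> R) : fine 'E_P[f] = mean P f.
Proof. by rewrite unlock. Qed.

Let varE n : ('V_P[total_score S0 X xi n] = 'E_P[fun t => ((H n t - mean P (H n)) ^+ 2)%R])%E.
Proof.
rewrite /variance covariance.unlock totalE; congr ('E_P[_])%E; apply/funext => t.
by rewrite /= fine_expectation expr2.
Qed.

Let H_L2 n : (1 <= n)%N -> in_L1 P (fun t => H n t ^+ 2).
Proof.
move=> n1; have [C hC] := @moments 2 ltac:(lra).
have L2 x : x \in W n -> in_L1 P (fun t => sc n x t ^+ 2).
  move=> xW; have [L _] := hC n x n1 xW.
  apply: in_L1_le L; first exact: measurable_funX.
  move=> t; rewrite ger0_norm ?sqr_ge0// powR_mulrn ?le_max ?normr_ge0//.
  by rewrite -(real_normK (num_real (sc n x t))) lerXn2r ?nnegrE ?le_max ?normr_ge0 ?lexx.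
apply: (@in_L1_le _ _ _ _ _ (fun t => (size (W n))%:R * \sum_(x <- W n) sc n x t ^+ 2)).
- exact: measurable_funX.
- by move=> t; rewrite ger0_norm ?sqr_ge0//; exact: sqr_sum_le.
- by apply: in_L1Z; apply: in_L1_sum_in.
Qed.

Let var_ge : \forall n \near \oo, [/\ 0 < sg n, cvar * w n `^ nu <= sg n ^+ 2 &
  mean P (fun t => (H n t - mean P (H n)) ^+ 2) = sg n ^+ 2].
Proof.
near=> n.
have n1 : (1 <= n)%N by near: n; exact: nbhs_infty_ge.
have H2 := H_L2 n1.
have [L _] := mean_centered_sqr_le (in_L1_sqr (mH n) H2) H2.
have : ((cvar * w n `^ nu)%:E <= 'V_P[total_score S0 X xi n])%E by near: n.
have vE : 'V_P[total_score S0 X xi n] = (mean P (fun t => (H n t - mean P (H n)) ^+ 2))%:E.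
  by rewrite varE expectation_mean.
rewrite /sg vE lee_fin /= => le.
have c0 : 0 < cvar * w n `^ nu by rewrite mulr_gt0// powR_gt0.
by rewrite sqrtr_gt0 sqr_sqrtr; [split=> //; exact: lt_le_trans le|exact: le_trans (ltW c0) le].
Unshelve. all: by end_near. Qed.

Let lam n := 2 * b n / sg n.
Let Z n x t := (tr n x t - mean P (tr n x)) / (2 * b n).
Let Yt n t := lam n * \sum_(x <- W n) Z n x t.

Let tr_le n x t : `|tr n x t| <= b n.
Proof. by apply: norm_truncated_score_le; exact: ltW. Qed.

Let tr_L1 n x : in_L1 P (tr n x).
Proof. exact: in_L1_bounded (mtr n x) (tr_le n x). Qed.

Let mZ n x : measurable_fun setT (Z n x).
Proof. by apply: measurable_funM => //; exact: measurable_funB. Qed.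

Let Z_le1 n x t : `|Z n x t| <= 1.
Proof.
have h := tr_le n x t.
have h' : `|mean P (tr n x)| <= b n.
  have := norm_mean_le (tr_L1 n x) (in_L1_cst P (b n)) (tr_le n x).
  by rewrite mean_cst.
have b0 := b_gt0 n.
rewrite normrM normfV (gtr0_norm (_ : 0 < 2 * b n)); last by lra.
rewrite ler_pdivrMr; last by lra.
by rewrite mul1r; have := ler_normB (tr n x t) (mean P (tr n x)); lra.
Qed.

Let Z_local n x t t' : (forall z, walk S0 (s n) x z -> X z t = X z t') -> Z n x t = Z n x t'.
Proof. by move=> tt'; rewrite /Z (truncated_score_local hxi.2 n (b n) tt'). Qed.

Let mYt n : measurable_fun setT (Yt n).
Proof. by apply: measurable_funM => //; exact: measurable_sum. Qed.

Let Yt_pow_L1 n k : in_L1 P (fun t => Yt n t ^+ k).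
Proof.
apply: (@in_L1_bounded _ _ _ _ _ ((`|lam n| * (size (W n))%:R) ^+ k)).
  exact: measurable_funX.
move=> t; rewrite normrX lerXn2r ?nnegrE ?mulr_ge0 ?normr_ge0//.
rewrite normrM ler_wpM2l//; apply: le_trans (ler_norm_sum _ _ _) _.
have -> : (size (W n))%:R = \sum_(x <- W n) 1 :> R by rewrite sum_const mulr1.
by apply: ler_sum => x _; exact: Z_le1.
Qed.

Let Y_diff n t : (1 <= n)%N -> Y n t - Yt n t = (Dl n t - mean P (Dl n)) / sg n.
Proof.
move=> n1; have HL := in_L1_sqr (mH n) (H_L2 n1).
have trL : in_L1 P (fun t => \sum_(x <- W n) tr n x t) by exact: in_L1_sum.
have DE : Dl n = fun t => H n t - \sum_(x <- W n) tr n x t.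
  by apply/funext => u; rewrite /Dl sumrB.
rewrite DE meanB// mean_sum// /Y /Yt /lam.
have -> : \sum_(x <- W n) Z n x t =
    (\sum_(x <- W n) tr n x t - \sum_(x <- W n) mean P (tr n x)) / (2 * b n).
  by rewrite -sumrB mulr_suml.
have b0 : b n != 0 by rewrite gt_eqF.
by set v := (sg n)^-1; field.
Qed.

Let diff_small e : 0 < e -> \forall n \near \oo,
  in_L1 P (fun t => (Y n t - Yt n t) ^+ 2) /\ mean P (fun t => (Y n t - Yt n t) ^+ 2) <= e.
Proof.
move=> e0; have [C hC] := total_error; near=> n.
have n1 : (1 <= n)%N by near: n; exact: nbhs_infty_ge.
have [D2 DC] : in_L1 P (fun t => Dl n t ^+ 2) /\ mean P (fun t => Dl n t ^+ 2) <= C * w n `^ (-1).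
  by near: n.
have [sg0 sgc _] : [/\ 0 < sg n, cvar * w n `^ nu <= sg n ^+ 2 &
  mean P (fun t => (H n t - mean P (H n)) ^+ 2) = sg n ^+ 2] by near: n.
have w1 : cvar^-1 <= w n `^ nu by near: n; exact: w_pow_ge.
have wC : C / e <= w n by near: n; exact: w_ge.
have [L le] := mean_centered_sqr_le (in_L1_sqr (mDl n) D2) D2.
have E : (fun t => (Y n t - Yt n t) ^+ 2) =
    (fun t => (sg n ^+ 2)^-1 * (Dl n t - mean P (Dl n)) ^+ 2).
  by apply/funext => t; rewrite Y_diff// exprMn exprVn mulrC.
rewrite E; split; first exact: in_L1Z.
rewrite meanZ//.
have sg1 : 1 <= sg n ^+ 2.
  by apply: le_trans sgc; rewrite -(ler_pM2l cvar0) divff ?gt_eqF// in w1.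
have m0 : 0 <= mean P (fun t => (Dl n t - mean P (Dl n)) ^+ 2).
  by apply: mean_ge0 => t; exact: sqr_ge0.
apply: (@le_trans _ _ (mean P (fun t => (Dl n t - mean P (Dl n)) ^+ 2))).
  by rewrite ler_piMl// invf_le1// (lt_le_trans ltr01).
apply: le_trans le _; apply: le_trans DC _.
rewrite powR_inv1 ?(ltW (w_gt0 n))// ler_pdivrMr//.
by rewrite ler_pdivrMr// mulrC in wC.
Unshelve. all: by end_near. Qed.

Let Y_sqr : \forall n \near \oo, in_L1 P (fun t => Y n t ^+ 2) /\ mean P (fun t => Y n t ^+ 2) = 1.
Proof.
near=> n.
have n1 : (1 <= n)%N by near: n; exact: nbhs_infty_ge.
have H2 := H_L2 n1.
have [L _] := mean_centered_sqr_le (in_L1_sqr (mH n) H2) H2.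
have [sg0 _ sgE] : [/\ 0 < sg n, cvar * w n `^ nu <= sg n ^+ 2 &
  mean P (fun t => (H n t - mean P (H n)) ^+ 2) = sg n ^+ 2] by near: n.
have E : (fun t => Y n t ^+ 2) = (fun t => (sg n ^+ 2)^-1 * (H n t - mean P (H n)) ^+ 2).
  by apply/funext => t; rewrite exprMn exprVn mulrC.
rewrite E meanZ// sgE mulVf ?expf_neq0 ?gt_eqF//; split=> //; exact: in_L1Z.
Unshelve. all: by end_near. Qed.

Let Yt_var : mean P (fun t => Yt n t ^+ 2) @[n --> \oo] --> (1 : R).
Proof.
apply/cvgrPdist_le => e e0.
pose u := (e / 2) / (1 + 2 / e).
have c0 : 0 < 1 + 2 / e by rewrite addr_gt0// divr_gt0.
have u0 : 0 < u by rewrite divr_gt0// divr_gt0.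
near=> n.
have [Y2 Y1] : in_L1 P (fun t => Y n t ^+ 2) /\ mean P (fun t => Y n t ^+ 2) = 1 by near: n.
have [E2 Eu] : in_L1 P (fun t => (Y n t - Yt n t) ^+ 2) /\
  mean P (fun t => (Y n t - Yt n t) ^+ 2) <= u by near: n; exact: diff_small.
rewrite -Y1 -meanB//.
apply: (@le_trans _ _ (mean P (fun t => (1 + 2 / e) * (Y n t - Yt n t) ^+ 2 + e / 2 * Y n t ^+ 2))).
  apply: norm_mean_le; [exact: in_L1B|by apply: in_L1D; exact: in_L1Z|move=> t].
  set y := Y n t; set x := y - Yt n t.
  have -> : y ^+ 2 - Yt n t ^+ 2 = 2 * x * y - x ^+ 2 by rewrite /x; ring.
  have e2 : 0 < e / 2 by rewrite divr_gt0.
  have sq z : 0 <= e / 2 * (y - z * x * (2 / e)) ^+ 2 by rewrite mulr_ge0 ?sqr_ge0// ltW.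
  have en : e != 0 by rewrite gt_eqF.
  have sqE z : z ^+ 2 = 1 -> e / 2 * (y - z * x * (2 / e)) ^+ 2 =
      e / 2 * y ^+ 2 - 2 * z * x * y + 2 / e * x ^+ 2.
    move=> z2; transitivity (e / 2 * y ^+ 2 - 2 * z * x * y + 2 / e * z ^+ 2 * x ^+ 2).
      by field.
    by rewrite z2 mulr1.
  have := sq 1; have := sq (-1); rewrite !sqE ?sqrrN ?expr1n//.
  have := sqr_ge0 x; rewrite ler_norml mulrDl mul1r.
  by move=> h1 h2 h3; apply/andP; split; lra.
rewrite meanD; [|exact: in_L1Z|exact: in_L1Z].
rewrite !meanZ// Y1 mulr1.
have : (1 + 2 / e) * mean P (fun t => (Y n t - Yt n t) ^+ 2) <= e / 2.
  by rewrite -ler_pdivlMl// mulrC.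
by lra.
Unshelve. all: by end_near. Qed.

Let Em n l := mean P (fun t => \prod_(x <- l) Z n x t).

Let prod_Z_L1 n l : in_L1 P (fun t => \prod_(x <- l) Z n x t).
Proof.
apply: (@in_L1_bounded _ _ _ _ _ 1); last by move=> t; exact: norm_prod_local_le (Z_le1 n) l t.
exact: measurable_prod.
Qed.

Let Em0 n : Em n [::] = 1.
Proof. by rewrite /Em -[RHS](mean_cst P); congr mean; apply/funext => t; rewrite big_nil. Qed.

Let Em_le1 n l : `|Em n l| <= 1.
Proof.
have := norm_mean_le (prod_Z_L1 n l) (in_L1_cst P 1) (norm_prod_local_le (Z_le1 n) l).
by rewrite mean_cst.
Qed.

Let Yt_moment n j : mean P (fun t => Yt n t ^+ j) = lam n ^+ j * list_sum (W n) j (Em n).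
Proof.
have [L1 L2] := mean_list_sum (W n) j (prod_Z_L1 n).
rewrite -L2 -meanZ//; congr mean; apply/funext => t.
by rewrite /Yt exprMn expr_sum_list_sum.
Qed.

Let ka n j := lam n ^+ j * list_sum (W n) j (joint_cumulant (Em n)).

Let Yt_cumulant n : moment_cumulant (fun j => mean P (fun t => Yt n t ^+ j)) (ka n).
Proof.
under [X in moment_cumulant X]funext do rewrite Yt_moment.
exact: moment_cumulant_scale (moment_cumulant_list_sum _ (Em0 n)).
Qed.

Let Yt_mean n : mean P (fun t => Yt n t ^+ 1) = 0.
Proof.
have ZL x : in_L1 P (Z n x) := in_L1_bounded P (mZ n x) (Z_le1 n x).
rewrite (_ : (fun t => _) = fun t => lam n * \sum_(x <- W n) Z n x t)//.
rewrite meanZ; last exact: in_L1_sum.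
rewrite mean_sum// big1 ?mulr0// => x _.
rewrite (_ : Z n x = fun t => (2 * b n)^-1 * (tr n x t - mean P (tr n x))); last first.
  by apply/funext => t; rewrite mulrC.
by rewrite meanZ ?meanB ?mean_cst ?subrr ?mulr0//; [exact: in_L1_cst|apply: in_L1B => //; exact: in_L1_cst].
Qed.

Let decoupled n c : (alpha P S0 X (s n)%:R <= c%:E)%E -> forall x t l,
  all (fun y => `[< walk S0 t x y >] || ~~ `[< walk S0 (t + 3 * s n) x y >]) l ->
  `|Em n l - Em n (seq.filter (fun y => `[< walk S0 t x y >]) l) *
     Em n (seq.filter (predC (fun y => `[< walk S0 t x y >])) l)| <= 4 * c.
Proof.
move=> ac x t l /allP hl; set I := seq.filter _ _; set J := seq.filter _ _.
have -> : Em n l = mean P (fun u => (\prod_(y <- I) Z n y u) * \prod_(y <- J) Z n y u).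
  congr mean; apply/funext => u; rewrite !big_filter.
  by rewrite (bigID (fun y => `[< walk S0 t x y >])).
apply: (decoupling S0_sym hX (@Z_local n) (Z_le1 n) ac) => y z.
rewrite !mem_filter => /andP[/asboolP xy _] /andP[/= xz zl] yz.
have := hl z zl; rewrite (negbTE xz) /= => /asboolP; apply.
exact: walk_trans xy yz.
Qed.

Let s_large (M : nat) : \forall n \near \oo, (M <= s n)%N.
Proof.
near=> n; rewrite -(ler_nat R).
have h : 2 * M%:R <= w n `^ eta by near: n; exact: w_pow_ge.
apply: (@le_trans _ _ (w n `^ eta / 2)); first by rewrite ler_pdivlMr// mulrC.
by near: n; exact: s_ge.
Unshelve. all: by end_near. Qed.

Let s_le n : (s n)%:R <= w n `^ eta.
Proof. by rewrite truncn_le; exact: powR_ge0. Qed.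

Let neighbours k : (0 < k)%N -> exists B : R, \forall n \near \oo,
  w (k * (3 * s n)) <= B * w n `^ de.
Proof.
move=> k0; have [n0 _ hg] := hgrowth.
exists (`|C2| * (k * 3)%:R `^ d2); near=> n.
have sn0 : (n0 <= s n)%N by near: n; exact: s_large.
have := hg (k * (3 * s n))%N; rewrite /= => /(_ _) h.
apply: le_trans (h _) _.
  by rewrite mulnA (leq_trans sn0)// leq_pmull// muln_gt0 k0.
apply: (@le_trans _ _ (`|C2| * (k * (3 * s n))%:R `^ d2)).
  by rewrite ler_wpM2r ?powR_ge0 ?ler_norm.
rewrite mulnA natrM powRM// -mulrA ler_wpM2l// ler_wpM2l ?powR_ge0//.
have -> : de = eta * d2 by rewrite /eta divfK ?gt_eqF.
by rewrite powRrM ge0_ler_powR ?nnegrE ?powR_ge0 ?(ltW d20).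
Unshelve. all: by end_near. Qed.

Let lam_le : \forall n \near \oo, 0 <= lam n <= 2 / Num.sqrt cvar * w n `^ (- (3 * nu / 8)).
Proof.
near=> n.
have [sg0 sgc _] : [/\ 0 < sg n, cvar * w n `^ nu <= sg n ^+ 2 &
  mean P (fun t => (H n t - mean P (H n)) ^+ 2) = sg n ^+ 2] by near: n.
have b0 := b_gt0 n.
have c0 : 0 < Num.sqrt cvar by rewrite sqrtr_gt0.
have wn0 : 0 < w n `^ (nu / 2) by exact: powR_gt0.
rewrite /lam divr_ge0 ?(ltW sg0)//=; last by rewrite mulr_ge0 ?(ltW b0).
have sgl : Num.sqrt cvar * w n `^ (nu / 2) <= sg n.
  rewrite -(@ler_pXn2r _ 2)// ?nnegrE ?(ltW sg0) ?mulr_ge0 ?(ltW c0) ?(ltW wn0)//.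
  rewrite exprMn sqr_sqrtr ?(ltW cvar0)// -powR_mulrn ?(ltW wn0)// -powRrM.
  by have -> : nu / 2 * 2 = nu by field.
have -> : 2 / Num.sqrt cvar * w n `^ (- (3 * nu / 8)) = 2 * b n / (Num.sqrt cvar * w n `^ (nu / 2)).
  rewrite invfM -powRN /b mulrACA -w_powD; congr (_ * _ `^ _).
  by rewrite /de; field.
by rewrite ler_pM2l ?lef_pV2 ?posrE ?mulr_gt0.
Unshelve. all: by end_near. Qed.

Let K := (Num.truncn (4 / nu)).+2.

Let cumulant_cvg0 j : (K <= j)%N -> ka n j @[n --> \oo] --> (0 : R).
Proof.
case: j => // k Kk; have k0 : (0 < k)%N by rewrite (leq_trans _ (Kk : (_ < k)%N)).
have jnu : 4 / nu < k.+1%:R.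
  by apply: lt_le_trans (truncnS_gt _) _; rewrite ler_nat ltnW.
pose x := nu * k.+1%:R / 4 - 1.
have x0 : 0 < x by rewrite subr_gt0 ltr_pdivlMr// mul1r mulrC -ltr_pdivrMr.
have [B hB] := neighbours k0.
pose A := (2 / Num.sqrt cvar) ^+ k.+1.
have A0 : 0 <= A by rewrite exprn_ge0// divr_ge0// sqrtr_ge0.
pose C := A * ((jcum_bound k.+1)%:R * `|B| ^+ k + (jcum_mix_bound k.+1)%:R * 4).
have Cw : C * w n `^ (- x) @[n --> \oo] --> (0 : R).
  by rewrite -[X in _ --> X](mulr0 C); apply: cvgMl_tmp; exact: powRN_cvg0.
apply/cvgr0Pnorm_le => e e0; have /cvgr0Pnorm_le/(_ _ e0) Cwe := Cw.
near=> n.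
have Cwen : `|C * w n `^ (- x)| <= e by near: n.
apply: le_trans (le_trans (ler_norm _) Cwen).
have /andP[l0 ll] : 0 <= lam n <= 2 / Num.sqrt cvar * w n `^ (- (3 * nu / 8)) by near: n; exact: lam_le.
have NB : w (k * (3 * s n)) <= B * w n `^ de by near: n.
have ac : (alpha P S0 X (s n)%:R <= (w n `^ (- k.+1%:R))%:E)%E.
  by near: n; exact: alpha_small (ler0n _ _).
set c := w n `^ (- k.+1%:R) in ac.
have uW : uniq (W n) by exact: fset_uniq.
have c0 : 0 <= 4 * c by rewrite mulr_ge0// powR_ge0.
pose D (y : V) (m : nat) : pred V := fun z => `[< walk S0 m y z >].
have D_refl y m : D y m y by apply/asboolP; exact: walk_refl.
have D_mono y p q : (p <= q)%N -> subpred (D y p) (D y q).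
  by move=> pq z /asboolP h; apply/asboolP; exact: walk_mono h.
have := @norm_sum_joint_cumulant_le _ _ (W n) (Em n) D (3 * s n) (word_ball_card R S0 (k * (3 * s n)))
  (4 * c) (Em0 n) (Em_le1 n) c0 D_refl D_mono (fun y t l _ _ => @decoupled n c ac y t l) k
  (fun y _ => @count_walk_le R V S0 y _ (W n) uW).
rewrite -[(size (W n))%:R]/(w n) => bound.
rewrite /ka normrM normrX (ger0_norm l0).
apply: le_trans (ler_wpM2l (exprn_ge0 _ l0) bound) _.
pose L := w n `^ (- (3 * nu / 8 * k.+1%:R)).
have L0 : 0 <= L by exact: powR_ge0.
have lamj : lam n ^+ k.+1 <= A * L.
  have -> : L = (w n `^ (- (3 * nu / 8))) ^+ k.+1.
    by rewrite -powR_mulrn ?powR_ge0// -powRrM mulNr.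
  by rewrite -exprMn lerXn2r ?nnegrE// (le_trans l0).
have Nk : w (k * (3 * s n)) ^+ k <= `|B| ^+ k * w n `^ (de * k%:R).
  rewrite powRrM powR_mulrn ?powR_ge0// -exprMn lerXn2r ?nnegrE ?mulr_ge0 ?powR_ge0//.
  by apply: le_trans NB _; rewrite ler_wpM2r ?powR_ge0// ler_norm.
have wc : w n ^+ k.+1 * c = 1.
  by rewrite /c powRN powR_mulrn ?divff// expf_neq0// gt_eqF.
have e1 : L * (w n * w n `^ (de * k%:R)) <= w n `^ (- x).
  rewrite -{1}(powRr1 (ltW (w_gt0 n))) /L -!w_powD; apply: ler_powR; first exact: w_ge1.
  rewrite -subr_ge0 (_ : _ - _ = nu / 8) ?divr_ge0 ?(ltW hnu)//.
  by rewrite /x /de -[k.+1%:R]natr1; field.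
have e2 : L <= w n `^ (- x).
  apply: ler_powR; first exact: w_ge1.
  have : 0 <= nu * k.+1%:R by rewrite mulr_ge0// ltW.
  by rewrite /x; lra.
apply: (@le_trans _ _ (A * L * ((jcum_bound k.+1)%:R * w n * (`|B| ^+ k * w n `^ (de * k%:R))
    + (jcum_mix_bound k.+1)%:R * w n ^+ k.+1 * (4 * c)))).
  apply: ler_pM => //; first exact: exprn_ge0.
    by rewrite addr_ge0 ?mulr_ge0 ?exprn_ge0 /c ?powR_ge0.
  by rewrite lerD2r ler_wpM2l// mulr_ge0// ltW.
have -> : (jcum_mix_bound k.+1)%:R * w n ^+ k.+1 * (4 * c) =
    (jcum_mix_bound k.+1)%:R * 4 * (w n ^+ k.+1 * c) by ring.
rewrite wc mulr1; set q := w n `^ (de * k%:R).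
have -> : A * L * ((jcum_bound k.+1)%:R * w n * (`|B| ^+ k * q) + (jcum_mix_bound k.+1)%:R * 4) =
    A * ((jcum_bound k.+1)%:R * `|B| ^+ k * (L * (w n * q)) + (jcum_mix_bound k.+1)%:R * 4 * L) by ring.
rewrite /C -(mulrA A) ler_wpM2l// [leRHS]mulrDl; apply: lerD; rewrite ler_wpM2l//.
Unshelve. all: by end_near. Qed.

Let gauss : probability _ R := normal_prob (0 : R) 1.

Let gauss_pow0 : mean gauss (fun x => x ^+ 0) = 1.
Proof. exact: mean_cst. Qed.

Let Yt_moments_cvg j :
  mean P (fun t => Yt n t ^+ j) @[n --> \oo] --> mean gauss (fun x => x ^+ j).
Proof.
apply: (gaussian_moments_cvg (m := fun n j => mean P (fun t => Yt n t ^+ j)) (k := ka) (K := K)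
  (g := fun j => mean gauss (fun x => x ^+ j))) => //.
- by move=> n; exact: positive_moments_mean (Yt_pow_L1 n).
- exact: mean_normal_pow1.
- exact: mean_normal_powSS.
Qed.

Let cos_cvg a c :
  mean P (fun t => cos (a * Y n t + c)) @[n --> \oo] --> mean gauss (fun x => cos (a * x + c)).
Proof.
have : mean P (fun t => cos (a * Yt n t + c)) @[n --> \oo] --> mean gauss (fun x => cos (a * x + c)).
  exact: (@mean_cos_cvg _ _ _ P _ _ gauss Yt id Yt_pow_L1 (@in_L1_normal_pow R) Yt_moments_cvg
    (@mean_normal_even_cvg0 R) a c).
move=> /cvgrPdist_le lim; apply/cvgrPdist_le => e e0.
have e2 : 0 < e / 2 by rewrite divr_gt0.
have a2 : 0 < a ^+ 2 + 1 by have := sqr_ge0 a; lra.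
have u0 : 0 < (e / 2) ^+ 2 / (a ^+ 2 + 1) by rewrite divr_gt0// exprn_gt0.
near=> n.
have [E2 Eu] : in_L1 P (fun t => (Y n t - Yt n t) ^+ 2) /\
  mean P (fun t => (Y n t - Yt n t) ^+ 2) <= (e / 2) ^+ 2 / (a ^+ 2 + 1) by near: n; exact: diff_small.
have near_Yt : `|mean gauss (fun x => cos (a * x + c)) - mean P (fun t => cos (a * Yt n t + c))| <= e / 2.
  by near: n; exact: lim.
have cosL (f : T -> R) : measurable_fun setT f -> in_L1 P (fun t => cos (a * f t + c)).
  move=> mf; apply: (@in_L1_bounded _ _ _ _ _ 1) => [|t]; last exact: cos_max.
  apply: (measurableT_comp (f := cos)).
    by apply: continuous_measurable_fun; exact: continuous_cos.
  by apply: measurable_funD => //; exact: measurable_funM.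
have near_Y : `|mean P (fun t => cos (a * Yt n t + c)) - mean P (fun t => cos (a * Y n t + c))| <= e / 2.
  rewrite distrC -meanB; [|exact: cosL|exact: cosL].
  apply: (@le_trans _ _ (mean P (fun t => e^-1 * a ^+ 2 * (Y n t - Yt n t) ^+ 2 + e / 4))).
    apply: norm_mean_le => [| |t]; first by apply: in_L1B; exact: cosL.
      by apply: in_L1D; [exact: in_L1Z|exact: in_L1_cst].
    apply: le_trans (norm_cosB_le _ _) _; set x := Y n t - Yt n t.
    have -> : a * Y n t + c - (a * Yt n t + c) = a * x by rewrite /x; ring.
    rewrite -mulrA -exprMn -(real_normK (num_real (a * x))); set y := `|a * x|.
    rewrite -subr_ge0 (_ : _ - y = e^-1 * (y - e / 2) ^+ 2); first by rewrite mulr_ge0 ?sqr_ge0 ?invr_ge0 ?(ltW e0).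
    by field; rewrite gt_eqF.
  rewrite meanD; [|exact: in_L1Z|exact: in_L1_cst].
  rewrite meanZ// mean_cst.
  suff : e^-1 * a ^+ 2 * mean P (fun t => (Y n t - Yt n t) ^+ 2) <= e / 4 by lra.
  have ea : 0 <= e^-1 * a ^+ 2 by rewrite mulr_ge0 ?sqr_ge0 ?invr_ge0 ?(ltW e0).
  apply: le_trans (ler_wpM2l ea Eu) _.
  rewrite [leLHS](_ : _ = e / 4 * (a ^+ 2 / (a ^+ 2 + 1))); last by field; rewrite ?gt_eqF.
  by rewrite ler_piMr// ?divr_ge0 ?(ltW e0)// ler_pdivrMr// mul1r; lra.
rewrite -(subrKA (mean P (fun t => cos (a * Yt n t + c)))).
by apply: le_trans (ler_normD _ _) _; lra.
Unshelve. all: by end_near. Qed.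

Lemma standardized_score_cvg : cvg_in_distribution P
  (fun n t => (total_score S0 X xi n t - fine 'E_P[total_score S0 X xi n])
     / Num.sqrt (fine 'V_P[total_score S0 X xi n]))
  (normal_prob (0 : R) 1).
Proof.
move=> f cf [M fM].
have YE n : (fun t => (total_score S0 X xi n t - fine 'E_P[total_score S0 X xi n])
     / Num.sqrt (fine 'V_P[total_score S0 X xi n])) = Y n.
  by apply/funext => t; rewrite totalE fine_expectation /Y /sg totalE.
under [X in X @ _ --> _]funext do rewrite YE.
have mf : measurable_fun setT f by exact: continuous_measurable_fun.
have fL n : in_L1 P (f \o Y n).
  by apply: in_L1_bounded => [|t]; [exact: measurableT_comp|exact: fM].
suff lim : ('E_P[f \o Y n] @[n --> \oo] --> (mean gauss f)%:E)%E.
  by rewrite (integral_normal_prob_mean erefl); [exact: lim|exact: (in_L1_bounded gauss mf fM)].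
under [X in X @ _ --> _]funext do rewrite expectation_mean//.
apply: cvg_EFin; first exact: nearW.
apply: (@weak_cvg _ _ _ P _ _ gauss Y id mY _ 1 _ _ cos_cvg) => //; last by exists M.
- by apply: filterS Y_sqr => n [L ->].
- split; first exact: in_L1_normal_pow.
  by have := @mean_normal_powSS R 0; rewrite mul1r => ->; rewrite gauss_pow0.
Qed.

End CentralLimit.

Unset Implicit Arguments.

Theorem theorem1p13 (R : realType)
    (V : groupType) (S0 : {fset V}) (hG : cayley_generators S0)
    (hgrowth : polynomial_growth R S0)
    (d : measure_display) (T : measurableType d) (P : probability T R)
    (S : countType) (X : V -> T -> S) (hX : random_field X)
    (hstat : stationary P X) (hmix : exponentially_alpha_mixing P S0 X)
    (xi : V -> config V S -> R) (hxi : score_function xi)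
    (hql : exponentially_quasi_local P S0 X xi)
    (hmom : forall p : R, 1 <= p -> moment_condition P S0 X xi p)
    (nu : R) (hnu : 0 < nu)
    (hvar : exists2 c : R, 0 < c & \forall n \near \oo,
       ((c * (word_ball_card R S0 n)%:R `^ nu)%:E <= 'V_P[total_score S0 X xi n])%E) :
  cvg_in_distribution P
    (fun (n : nat) (om : T) =>
       (total_score S0 X xi n om - fine 'E_P[total_score S0 X xi n])
       / Num.sqrt (fine 'V_P[total_score S0 X xi n]))
    (normal_prob 0 1).
Proof.
have [d2 d20 [C2 hC2]] := hgrowth; have [c c0 hc] := hvar.
exact: (standardized_score_cvg hG hX hmix hxi hql hmom hnu c0 hc d20 hC2).
Qed.
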